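(* Let $\mu=(\mu_1,\dots,\mu_m\,|\,\mu_{m+1},\dots,\mu_{m+n})$ be a composition of $(M|N)$, write $Y_\mu=Y(\mathfrak{gl}_{M|N})$, and let $Y_\mu^0$, $Y_\mu^+$, $Y_\mu^-$ be the subalgebras of $Y_\mu$ generated by all the elements $D_{a;i,j}^{(r)}$, all the elements $E_{a,b;i,j}^{(r)}$, and all the elements $F_{b,a;i,j}^{(r)}$, respectively. Monomials below are ordered monomials containing no second or higher powers of odd elements. (1) The set of monomials in $\{D_{a;i,j}^{(r)} : 1\le a\le m+n,\ 1\le i,j\le\mu_a,\ r\ge1\}$ taken in a certain fixed order forms a basis for $Y_\mu^0$. (2) The set of monomials in $\{E_{a,b;i,j}^{(r)} : 1\le a<b\le m+n,\ 1\le i\le\mu_a,\ 1\le j\le\mu_b,\ r\ge1\}$ taken in a certain fixed order forms a basis for $Y_\mu^+$. (3) The set of monomials in $\{F_{b,a;i,j}^{(r)} : 1\le a<b\le m+n,\ 1\le i\le\mu_b,\ 1\le j\le\mu_a,\ r\ge1\}$ taken in a certain fixed order forms a basis for $Y_\mu^-$. (4) The set of monomials in the union of the elements listed in (1), (2) and (3) taken in a certain fixed order forms a basis for $Y_\mu$.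
   Context: Super Yangian. Let $M,N\ge0$ be integers, not both zero. For $1\le i\le M+N$ put $\mathrm{par}(i)=0$ if $i\le M$ and $\mathrm{par}(i)=1$ if $i>M$. The super Yangian $Y(\mathfrak{gl}_{M|N})$ is the unital associative superalgebra over $\mathbb{C}$ with generators $t_{ij}^{(r)}$ ($1\le i,j\le M+N$, $r\ge1$), $t_{ij}^{(r)}$ having parity $\mathrm{par}(i)+\mathrm{par}(j)$, and, with $t_{ij}^{(0)}:=\delta_{ij}$, defining relations \[[t_{ij}^{(r)},t_{hk}^{(s)}]=(-1)^{\mathrm{par}(i)\mathrm{par}(j)+\mathrm{par}(i)\mathrm{par}(h)+\mathrm{par}(j)\mathrm{par}(h)}\sum_{t=0}^{\min(r,s)-1}\big(t_{hj}^{(t)}t_{ik}^{(r+s-1-t)}-t_{hj}^{(r+s-1-t)}t_{ik}^{(t)}\big),\] where $[x,y]=xy-(-1)^{|x||y|}yx$ is the supercommutator. Put $t_{ij}(u)=\sum_{r\ge0}t_{ij}^{(r)}u^{-r}$ and $T(u)=(t_{ij}(u))_{1\le i,j\le M+N}$, a matrix with entries in $Y(\mathfrak{gl}_{M|N})[[u^{-1}]]$; such matrices are multiplied in the usual way (no extra signs). Composition. Let $\lambda=(\lambda_1,\dots,\lambda_m)$ be a composition of $M$ and $\nu=(\nu_1,\dots,\nu_n)$ a composition of $N$ (positive parts). Put $\mu_i=\lambda_i$ for $1\le i\le m$, $\mu_{m+j}=\nu_j$ for $1\le j\le n$; then $\mu=(\mu_1,\dots,\mu_m|\mu_{m+1},\dots,\mu_{m+n})$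 is called a composition of $(M|N)$. Gauss decomposition. View $T(u)$ as an $(m+n)\times(m+n)$ block matrix whose $(a,b)$ block has size $\mu_a\times\mu_b$. There is a unique factorization $T(u)=F(u)D(u)E(u)$ with $D(u)$ block diagonal with diagonal blocks $D_a(u)$, $E(u)$ block upper unitriangular with blocks $E_{a,b}(u)$ ($a<b$), and $F(u)$ block lower unitriangular with blocks $F_{b,a}(u)$ ($a<b$). Write $D_{a;i,j}(u)=\sum_{r\ge0}D_{a;i,j}^{(r)}u^{-r}$, $E_{a,b;i,j}(u)=\sum_{r\ge1}E_{a,b;i,j}^{(r)}u^{-r}$, $F_{b,a;i,j}(u)=\sum_{r\ge1}F_{b,a;i,j}^{(r)}u^{-r}$ for the $(i,j)$ entries. The elements $E_{a,b;i,j}^{(r)}$ and $F_{b,a;i,j}^{(r)}$ are odd exactly when $a\le m<b$; all $D_{a;i,j}^{(r)}$ are even. *)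

(* Defs.v *)
From HB Require Import structures.
From mathcomp Require Import all_boot all_order all_algebra.
From mathcomp Require Import boolp classical_sets reals.
From mathcomp Require Import complex monalg.

Set Implicit Arguments.
Unset Strict Implicit.
Unset Printing Implicit Defensive.

Import GRing.Theory.

Set Warnings "-redundant-canonical-projection".

Local Open Scope ring_scope.
Local Open Scope classical_set_scope.
Local Open Scope quotient_scope.

Section FreeAlgebra.
Context (K : comNzRingType) (G : choiceType).

Definition free_alg : Type := {malg K[{fmonom G}]}.
HB.instance Definition _ := GRing.Lalgebra.on free_alg.

Lemma free_alg_scalerAr (c : K) (x y : free_alg) : c *: (x * y) = x * (c *: y).
Proof.
suff comm : (x : {malg K[{fmonom G}]}) * c%:MP = c%:MP * x.
  rewrite -[LHS]mul_malgC -[in RHS](mul_malgC c y) (mulrA x) comm.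
  exact: mulrA.
rewrite mul_malgC malgM_def fgmulgU malgZ_def.
by apply: eq_bigr => k _; rewrite mulrC mulm1.
Qed.

HB.instance Definition _ := GRing.Lalgebra_isAlgebra.Build K free_alg
  free_alg_scalerAr.

Definition free_gen (g : G) : free_alg := << fmu g >>.

Definition free_aug : free_alg -> K :=
  mcoeff (mone : {fmonom G}).
HB.instance Definition _ := GRing.RMorphism.on free_aug.

Lemma free_aug_gen g : free_aug (free_gen g) = 0.
Proof. by rewrite /free_aug /free_gen mcoeffU1 fmP fmU fm1. Qed.

End FreeAlgebra.

Definition two_sided_ideal (A : pzRingType) (S : set A) : Prop :=
  [/\ S 0,
      forall x y, S x -> S y -> S (x - y),
      forall a x, S x -> S (a * x) &
      forall a x, S x -> S (x * a)].

Lemma two_sided_idealM (A : pzRingType) (S : set A) (x x' y y' : A) :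
  two_sided_ideal S -> S (x - x') -> S (y - y') -> S (x * y - x' * y').
Proof.
case=> S0 SB Sl Sr Sx Sy.
have -> : x * y - x' * y' = (x - x') * y - x' * (- (y - y')).
  by rewrite mulrN opprK mulrBl mulrBr addrA subrK.
by apply: (SB); [exact: Sr | apply: Sl; rewrite -sub0r; exact: (SB)].
Qed.

(* x and y are homogeneous of parities p and q modulo 2. *)
Definition supercomm (A : pzRingType) (p q : nat) (x y : A) : A :=
  x * y - (-1) ^+ (p * q) * (y * x).

Section SuperYangian.
Context (K : fieldType) (M N : nat).

(* Indices start at 0, so the even ones are 0, ..., M - 1. *)
Definition par (i : 'I_(M + N)) : nat := (M <= i)%N.

(* [(i, j, r)] stands for the generator t_{ij}^{(r+1)}. *)
Definition yang_gen : Type := ('I_(M + N) * 'I_(M + N) * nat)%type.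
HB.instance Definition _ := Choice.on yang_gen.

Local Notation yang_free := (free_alg K yang_gen).

Definition free_t (i j : 'I_(M + N)) (r : nat) : yang_free :=
  if r is r'.+1 then free_gen K ((i, j, r') : yang_gen) else (i == j)%:R.

(* Left minus right side of the defining relation for a family t in A. *)
Definition yang_relator (A : pzRingType) (t : 'I_(M + N) -> 'I_(M + N) -> nat -> A)
    (i j h k : 'I_(M + N)) (r s : nat) : A :=
  supercomm (par i + par j) (par h + par k) (t i j r) (t h k s)
  - (-1) ^+ (par i * par j + par i * par h + par j * par h) *
    \sum_(l < minn r s)
      (t h j l * t i k (r + s - 1 - l)%N - t h j (r + s - 1 - l)%N * t i k l).

Definition yang_relators : set yang_free :=
  [set x | exists i j h k r s,
     [/\ (0 < r)%N, (0 < s)%N & x = yang_relator free_t i j h k r s]].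

Definition yang_ideal_set : set yang_free :=
  smallest (@two_sided_ideal _) yang_relators.

Definition yang_ideal : {pred yang_free} := fun x => `[< yang_ideal_set x >].

Lemma yang_ideal_set_ideal : two_sided_ideal yang_ideal_set.
Proof.
split=> [S [[S0 _ _ _] _] //|x y Ix Iy S HS|a x Ix S HS|a x Ix S HS];
  case: (HS) => -[_ SB Sl Sr] _.
- by apply: SB; [apply: Ix|apply: Iy].
- by apply: Sl; apply: Ix.
- by apply: Sr; apply: Ix.
Qed.

Lemma yang_ideal_zmod : zmod_closed yang_ideal.
Proof.
case: yang_ideal_set_ideal => I0 IB _ _.
by split=> [|x y /asboolP xI /asboolP yI]; apply/asboolP => //; apply: IB.
Qed.

HB.instance Definition _ :=
  GRing.isZmodClosed.Build yang_free yang_ideal yang_ideal_zmod.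

Lemma yang_idealMl a x : x \in yang_ideal -> a * x \in yang_ideal.
Proof.
case: yang_ideal_set_ideal => _ _ Il _.
by move=> /asboolP xI; apply/asboolP; apply: Il.
Qed.

Lemma yang_idealMr a x : x \in yang_ideal -> x * a \in yang_ideal.
Proof.
case: yang_ideal_set_ideal => _ _ _ Ir.
by move=> /asboolP xI; apply/asboolP; apply: Ir.
Qed.

Lemma yang_relator_rmorph (A B : pzRingType) (phi : {rmorphism A -> B})
    (t : 'I_(M + N) -> 'I_(M + N) -> nat -> A) i j h k r s :
    (forall i j r, (0 < r)%N -> phi (t i j r) = 0) ->
  (0 < r)%N -> (0 < s)%N -> phi (yang_relator t i j h k r s) = 0.
Proof.
move=> phi0 r0 s0; rewrite /yang_relator /supercomm.
rewrite rmorphB rmorphB !rmorphM (phi0 _ _ _ r0) (phi0 _ _ _ s0).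
rewrite !mulr0 subrr sub0r rmorph_sum big1 ?mulr0 ?oppr0 // => l _.
have rs : (0 < r + s - 1 - l)%N.
  have := ltn_ord l; rewrite leq_min => /andP[tr ts].
  rewrite -subnDA subn_gt0 add1n (leq_ltn_trans tr) //.
  by rewrite -[ltnLHS]addn0 ltn_add2l.
by rewrite rmorphB !rmorphM !(phi0 _ _ _ rs) mulr0 mul0r subrr.
Qed.

Lemma yang_ideal_aug x : x \in yang_ideal -> free_aug x = 0.
Proof.
pose phi : {rmorphism yang_free -> K} := @free_aug K yang_gen.
have phi0 i j r : (0 < r)%N -> phi (free_t i j r) = 0.
  by case: r => // r _; apply: free_aug_gen.
rewrite -[free_aug _]/(phi _); move: phi phi0 => phi phi0.
move=> /asboolP /(_ [set y | phi y = 0]); apply; split.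
  split=> /= [|x' y hx hy|a y hy|a y hy].
  - exact: rmorph0.
  - by rewrite rmorphB hx hy subr0.
  - by rewrite rmorphM hy mulr0.
  - by rewrite rmorphM hy mul0r.
move=> _ [i [j [h [k [r [s [r0 s0 ->]]]]]]] /=.
exact: yang_relator_rmorph.
Qed.

Definition superYangian : Type := Quotient.quot yang_ideal.
Local Notation Y := superYangian.
HB.instance Definition _ := GRing.Zmodule.on Y.
HB.instance Definition _ := EqQuotient.on Y.

Definition yang_pi (x : yang_free) : Y := \pi_Y x.
Definition yang_one : Y := yang_pi 1.
Definition yang_mul (x y : Y) : Y :=
  yang_pi ((repr x : yang_free) * (repr y : yang_free)).
Definition yang_scale (c : K) (x : Y) : Y :=
  yang_pi (c *: (repr x : yang_free)).

Lemma yang_pi_repr (x : Y) : yang_pi (repr x : yang_free) = x.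
Proof. exact: reprK. Qed.

Lemma yang_piP (x : Y) : exists y, x = yang_pi y.
Proof. by exists (repr x); rewrite yang_pi_repr. Qed.

Lemma yang_piE (x y : yang_free) :
  (yang_pi x = yang_pi y) <-> (x - y \in yang_ideal).
Proof. by rewrite Quotient.idealrBE; split=> /eqP. Qed.

Lemma yang_pi0 : yang_pi 0 = 0.
Proof. by rewrite /yang_pi !piE. Qed.

Lemma yang_piD (x y : yang_free) : yang_pi (x + y) = yang_pi x + yang_pi y.
Proof. by rewrite /yang_pi !piE. Qed.

Lemma yang_piM (x y : yang_free) :
  yang_pi (x * y) = yang_mul (yang_pi x) (yang_pi y).
Proof.
apply/yang_piE; have hx := yang_pi_repr (yang_pi x).
have hy := yang_pi_repr (yang_pi y).
move: (repr _ : yang_free) (repr _ : yang_free) hx hy => x' y'.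
move=> /esym/yang_piE/asboolP hx /esym/yang_piE/asboolP hy; apply/asboolP.
exact: two_sided_idealM yang_ideal_set_ideal hx hy.
Qed.

Lemma yang_piZ c (x : yang_free) : yang_pi (c *: x) = yang_scale c (yang_pi x).
Proof.
apply/yang_piE; rewrite -scalerBr -mulr_algl.
by apply/yang_idealMl/yang_piE; rewrite yang_pi_repr.
Qed.

Lemma yang_mulA : associative yang_mul.
Proof.
move=> x y z; have [x' ->] := yang_piP x; have [y' ->] := yang_piP y.
by have [z' ->] := yang_piP z; rewrite -!yang_piM mulrA.
Qed.

Lemma yang_mul1 : left_id yang_one yang_mul.
Proof. by move=> x; have [x' ->] := yang_piP x; rewrite -yang_piM mul1r. Qed.

Lemma yang_mulr1 : right_id yang_one yang_mul.
Proof. by move=> x; have [x' ->] := yang_piP x; rewrite -yang_piM mulr1. Qed.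

Lemma yang_mulDl : left_distributive yang_mul +%R.
Proof.
move=> x y z; have [x' ->] := yang_piP x; have [y' ->] := yang_piP y.
by have [z' ->] := yang_piP z; rewrite -yang_piD -!yang_piM mulrDl yang_piD.
Qed.

Lemma yang_mulDr : right_distributive yang_mul +%R.
Proof.
move=> x y z; have [x' ->] := yang_piP x; have [y' ->] := yang_piP y.
by have [z' ->] := yang_piP z; rewrite -yang_piD -!yang_piM mulrDr yang_piD.
Qed.

Lemma yang_oner_neq0 : yang_one != 0.
Proof.
apply/eqP; rewrite -yang_pi0 => /yang_piE; rewrite subr0 => /yang_ideal_aug.
by rewrite rmorph1 => /eqP; rewrite oner_eq0.
Qed.

HB.instance Definition _ := GRing.Zmodule_isNzRing.Build Y
  yang_mulA yang_mul1 yang_mulr1 yang_mulDl yang_mulDr yang_oner_neq0.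

Lemma yang_scalerA a b x : yang_scale a (yang_scale b x) = yang_scale (a * b) x.
Proof. by have [x' ->] := yang_piP x; rewrite -!yang_piZ scalerA. Qed.

Lemma yang_scale1r : left_id 1 yang_scale.
Proof. by move=> x; have [x' ->] := yang_piP x; rewrite -yang_piZ scale1r. Qed.

Lemma yang_scalerDr : right_distributive yang_scale +%R.
Proof.
move=> c x y; have [x' ->] := yang_piP x; have [y' ->] := yang_piP y.
by rewrite -yang_piD -!yang_piZ scalerDr yang_piD.
Qed.

Lemma yang_scalerDl x : {morph yang_scale^~ x : a b / a + b}.
Proof.
move=> a b; have [x' ->] := yang_piP x.
by rewrite -!yang_piZ scalerDl yang_piD.
Qed.

HB.instance Definition _ := GRing.Zmodule_isLmodule.Build K Y
  yang_scalerA yang_scale1r yang_scalerDr yang_scalerDl.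

Lemma yang_scalerAl (c : K) (x y : Y) : c *: (x * y) = (c *: x) * y.
Proof.
have [x' ->] := yang_piP x; have [y' ->] := yang_piP y.
rewrite [LHS](_ : _ = yang_scale c (yang_mul (yang_pi x') (yang_pi y'))) //.
by rewrite -yang_piM -yang_piZ scalerAl yang_piM yang_piZ.
Qed.

HB.instance Definition _ := GRing.Lmodule_isLalgebra.Build K Y yang_scalerAl.

Lemma yang_scalerAr (c : K) (x y : Y) : c *: (x * y) = x * (c *: y).
Proof.
have [x' ->] := yang_piP x; have [y' ->] := yang_piP y.
rewrite [LHS](_ : _ = yang_scale c (yang_mul (yang_pi x') (yang_pi y'))) //.
by rewrite -yang_piM -yang_piZ scalerAr yang_piM yang_piZ.
Qed.

HB.instance Definition _ := GRing.Lalgebra_isAlgebra.Build K Y yang_scalerAr.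

Lemma yang_pi_zmod : zmod_morphism yang_pi.
Proof. by move=> x y; rewrite /yang_pi !piE. Qed.

HB.instance Definition _ :=
  GRing.isZmodMorphism.Build yang_free Y yang_pi yang_pi_zmod.

Lemma yang_pi_monoid : monoid_morphism yang_pi.
Proof. by split; [|exact: yang_piM]. Qed.

HB.instance Definition _ :=
  GRing.isMonoidMorphism.Build yang_free Y yang_pi yang_pi_monoid.

Definition yang_t (i j : 'I_(M + N)) (r : nat) : Y := yang_pi (free_t i j r).

End SuperYangian.

(* A matrix with entries in A[[u^-1]] is encoded by its sequence of matrix
   coefficients: [X r] is the coefficient of u^-r. *)
Section PowerSeries.
Context (A : pzRingType) (n : nat).

Definition mxser_mul (X Y : nat -> 'M[A]_n) (r : nat) : 'M[A]_n :=
  \sum_(s < r.+1) X s *m Y (r - s)%N.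

End PowerSeries.

Section Gauss.
Context (A : pzRingType) (k : nat) (mu : 'I_k -> nat).
Local Notation M := 'M[A]_(\sum_(a < k) mu a).

Definition block_diagonal (X : nat -> M) : Prop :=
  forall r (a b : 'I_k), a != b -> submxblock (X r) a b = 0.

(* The constant series 1 has coefficients 1, 0, 0, ... *)
Definition block_upper_unitri (X : nat -> M) : Prop :=
  (forall r a, submxblock (X r) a a = if r == 0%N then 1%:M else 0) /\
  (forall r (a b : 'I_k), (b < a)%N -> submxblock (X r) a b = 0).

Definition block_lower_unitri (X : nat -> M) : Prop :=
  (forall r a, submxblock (X r) a a = if r == 0%N then 1%:M else 0) /\
  (forall r (a b : 'I_k), (a < b)%N -> submxblock (X r) a b = 0).

Definition gauss_decomposition (T F D E : nat -> M) : Prop :=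
  [/\ T = mxser_mul (mxser_mul F D) E,
      block_lower_unitri F, block_diagonal D & block_upper_unitri E].

End Gauss.

Lemma mxser_mul_eq (A : pzRingType) n (X X' Z Z' : nat -> 'M[A]_n) i :
    (forall r, (r <= i)%N -> X r = X' r) -> (forall r, (r <= i)%N -> Z r = Z' r) ->
  mxser_mul X Z i = mxser_mul X' Z' i.
Proof.
move=> eX eZ; apply: eq_bigr => s _.
by rewrite eX ?eZ ?leq_subr // -ltnS ltn_ord.
Qed.

Lemma mxser_mulB (A : pzRingType) n (X X' Z Z' : nat -> 'M[A]_n) i :
    (0 < i)%N -> X 0%N = 1%:M -> Z 0%N = 1%:M ->
    (forall r, (r < i)%N -> X' r = X r) -> (forall r, (r < i)%N -> Z' r = Z r) ->
  mxser_mul X' Z' i = mxser_mul X Z i + (X' i - X i) + (Z' i - Z i).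
Proof.
case: i => // i _ X0 Z0 eX eZ.
have mulS (V W : nat -> 'M[A]_n) : mxser_mul V W i.+1 =
    V 0%N *m W i.+1 + \sum_(s < i) V s.+1 *m W (i - s)%N + V i.+1 *m W 0%N.
  rewrite /mxser_mul big_ord_recr big_ord_recl /= subn0 subnn.
  by congr (_ + _ + _); apply: eq_bigr => s _; rewrite /bump /= add1n subSS.
rewrite !mulS (eX 0%N) // (eZ 0%N) // X0 Z0 !mul1mx !mulmx1.
rewrite (eq_bigr (fun s : 'I_i => X s.+1 *m Z (i - s)%N)); last first.
  by move=> s _; rewrite eX ?ltnS // eZ // ltnS leq_subr.
have ab (V : zmodType) (z t x x' z' : V) :
    z' + t + x' = z + t + x + (x' - x) + (z' - z).
  rewrite -[z + t + x + _]addrA [x + _]addrC subrK [RHS]addrC -!addrA.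
  by rewrite addKr.
exact: ab.
Qed.

Section GaussExists.
Context (A : pzRingType) (k : nat) (mu : 'I_k -> nat).
Local Notation M := 'M[A]_(\sum_(a < k) mu a).
Implicit Types (X : M) (T F D E : nat -> M).

Let low X : M := \mxblock_(a, b) if (b < a)%N then submxblock X a b else 0.
Let dia X : M := \mxblock_(a, b) if a == b then submxblock X a b else 0.
Let upp X : M := \mxblock_(a, b) if (a < b)%N then submxblock X a b else 0.

Let low_dia_upp X : low X + dia X + upp X = X.
Proof.
apply/mxblockP => a b; rewrite !submxblockD !mxblockK.
case: (ltngtP b a) => [ba|ab|/val_inj->]; last by rewrite eqxx add0r addr0.
- by rewrite (gtn_eqF ba : (a == b) = false) !addr0.
- by rewrite (ltn_eqF ab : (a == b) = false) !add0r.
Qed.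

Let submxblock1 (a b : 'I_k) : submxblock (1%:M : M) a b =
  if a == b then conform_mx 0 (1%:M : 'M_(mu a)) else 0.
Proof. by rewrite -mxdiagZ mxblockK. Qed.

Let one : nat -> M := fun r => if r == 0%N then 1%:M else 0.

Let unitri F D E : Prop :=
  [/\ block_lower_unitri F, block_diagonal D & block_upper_unitri E].

Let unitri_one : unitri one one one.
Proof.
split; [split|idtac|split]; rewrite /one.
- move=> [|r] a /=; rewrite ?submxblock0 // submxblock1 eqxx.
  by rewrite conform_mx_id.
- move=> [|r] a b ab /=; rewrite ?submxblock0 // submxblock1.
  by rewrite (ltn_eqF ab : (a == b) = false).
- by move=> [|r] a b /negbTE ab /=; rewrite ?submxblock0 // submxblock1 ab.
- move=> [|r] a /=; rewrite ?submxblock0 // submxblock1 eqxx.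
  by rewrite conform_mx_id.
- move=> [|r] a b ab /=; rewrite ?submxblock0 // submxblock1.
  by rewrite (gtn_eqF ab : (a == b) = false).
Qed.

Let upd (X : nat -> M) i x : nat -> M := fun r => if r == i then x else X r.

Let unitri_upd F D E i X : (0 < i)%N -> unitri F D E ->
  unitri (upd F i (low X)) (upd D i (dia X)) (upd E i (upp X)).
Proof.
move=> i0 [[F1 F2] D1 [E1 E2]]; rewrite /upd; split; [split|idtac|split].
- by move=> r a; case: (r =P i) => [->|_] //; rewrite (gtn_eqF i0) mxblockK ltnn.
- move=> r a b ab; case: (r =P i) => [_|_]; last exact: F2.
  by rewrite mxblockK ltnNge (ltnW ab).
- move=> r a b ab; case: (r =P i) => [_|_]; last exact: D1.
  by rewrite mxblockK (negbTE ab).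
- by move=> r a; case: (r =P i) => [->|_] //; rewrite (gtn_eqF i0) mxblockK ltnn.
- move=> r a b ab; case: (r =P i) => [_|_]; last exact: E2.
  by rewrite mxblockK ltnNge (ltnW ab).
Qed.

Let mul3 F D E := mxser_mul (mxser_mul F D) E.

Let mul3_0 F D E : mul3 F D E 0%N = F 0%N *m D 0%N *m E 0%N.
Proof. by rewrite /mul3 /mxser_mul !big_ord1. Qed.

Let mul3_eq F F' D D' E E' i : (forall r, (r <= i)%N -> F r = F' r) ->
    (forall r, (r <= i)%N -> D r = D' r) -> (forall r, (r <= i)%N -> E r = E' r) ->
  mul3 F D E i = mul3 F' D' E' i.
Proof.
move=> eF eD eE; apply: mxser_mul_eq => // r ri.
by apply: mxser_mul_eq => s sr; [apply: eF|apply: eD]; apply: leq_trans sr ri.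
Qed.

Let mul3B F F' D D' E E' i : (0 < i)%N -> F 0%N = 1%:M -> D 0%N = 1%:M ->
    E 0%N = 1%:M -> (forall r, (r < i)%N -> F' r = F r) ->
    (forall r, (r < i)%N -> D' r = D r) -> (forall r, (r < i)%N -> E' r = E r) ->
  mul3 F' D' E' i = mul3 F D E i + ((F' i - F i) + (D' i - D i) + (E' i - E i)).
Proof.
move=> i0 F0 D0 E0 eF eD eE.
have FD0 : mxser_mul F D 0%N = 1%:M.
  by rewrite /mxser_mul big_ord1 F0 D0 mulmx1.
have eFD r : (r < i)%N -> mxser_mul F' D' r = mxser_mul F D r.
  by move=> ri; apply: mxser_mul_eq => s sr; [apply: eF|apply: eD];
    apply: leq_ltn_trans sr ri.
rewrite /mul3 (mxser_mulB i0 FD0 E0 eFD eE) (mxser_mulB i0 F0 D0 eF eD).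
by rewrite -[X in X - _]addrA [X in _ + X + _]addrC addKr -!addrA.
Qed.

Let state : Type := ((nat -> M) * (nat -> M) * (nat -> M))%type.

Let step T n (s : state) : state :=
  let: (F, D, E) := s in
  let X := T n.+1 - mul3 F D E n.+1 in
  (upd F n.+1 (low X), upd D n.+1 (dia X), upd E n.+1 (upp X)).

Let st T : nat -> state :=
  fix st n := if n is n'.+1 then step T n' (st n') else (one, one, one).

Let good T n (s : state) : Prop :=
  let: (F, D, E) := s in
  [/\ unitri F D E, [/\ F 0%N = 1%:M, D 0%N = 1%:M & E 0%N = 1%:M],
    (forall r, (n < r)%N -> [/\ F r = 0, D r = 0 & E r = 0]) &
    forall r, (r <= n)%N -> mul3 F D E r = T r].

Let st_good T n : T 0%N = 1%:M -> good T n (st T n).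
Proof.
move=> T0; elim: n => [|n] /=.
  split=> [||[|r] //|r]; [exact: unitri_one|by []|].
  by rewrite leqn0 => /eqP->; rewrite mul3_0 !mulmx1.
case: (st T n) => [[F D] E] [tri [F0 D0 E0] z mE] /=.
set X := T n.+1 - _.
have [zF zD zE] := z n.+1 (ltnSn n).
split; first exact: unitri_upd.
- by rewrite /upd.
- move=> r nr; rewrite /upd (gtn_eqF nr); apply: z; exact: ltnW.
move=> r; rewrite leq_eqVlt => /predU1P[->|rn].
  have old (W : nat -> M) x s : (s < n.+1)%N -> upd W n.+1 x s = W s.
    by move=> sn; rewrite /upd (ltn_eqF sn).
  rewrite (@mul3B F _ D _ E) //; try by move=> ?; apply: old.
  by rewrite /upd eqxx zF zD zE !subr0 low_dia_upp /X subrKC.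
rewrite -mE //; apply: mul3_eq => s sr; rewrite /upd;
  by rewrite (ltn_eqF (leq_ltn_trans sr rn)).
Qed.

Let st_stable T n r : (r <= n)%N ->
  [/\ (st T n).1.1 r = (st T r).1.1 r, (st T n).1.2 r = (st T r).1.2 r
    & (st T n).2 r = (st T r).2 r].
Proof.
elim: n => [|n IH]; first by rewrite leqn0 => /eqP->.
rewrite leq_eqVlt => /predU1P[->//|rn].
have [<- <- <-] := IH rn; move=> /=.
by case: (st T n) => [[F D] E] /=; rewrite /upd (ltn_eqF rn).
Qed.

Lemma gauss_decomposition_exists T : T 0%N = 1%:M ->
  exists F D E, gauss_decomposition T F D E.
Proof.
move=> T0.
exists (fun r => (st T r).1.1 r), (fun r => (st T r).1.2 r), (fun r => (st T r).2 r).
have tri n : let: (F, D, E) := st T n in unitri F D E.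
  by have := st_good n T0; case: (st T n) => [[F D] E] [].
split.
- apply/funext => r; rewrite -/(mul3 _ _ _).
  have eqs s (sr : (s <= r)%N) := st_stable T sr.
  rewrite (@mul3_eq _ (st T r).1.1 _ (st T r).1.2 _ (st T r).2) =>
    [|s /eqs[->]|s /eqs[_ ->]|s /eqs[_ _ ->]] //.
  by have := st_good r T0; case: (st T r) => [[F D] E] [_ _ _ ->].
- by split=> r; have := tri r; case: (st T r) => [[F D] E] [[F1 F2] _ _];
    [apply: F1|apply: F2].
- by move=> r; have := tri r; case: (st T r) => [[F D] E] [_ D1 _]; apply: D1.
- by split=> r; have := tri r; case: (st T r) => [[F D] E] [_ _ [E1 E2]];
    [apply: E1|apply: E2].
Qed.

Let mul3_one (F D E : nat -> M) : unitri F D E -> mul3 F D E 0%N = 1%:M ->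
  [/\ F 0%N = 1%:M, D 0%N = 1%:M & E 0%N = 1%:M].
Proof.
move=> [[F1 F2] D1 [E1 E2]]; rewrite mul3_0.
pose blk (X : M) := submxblock X.
have blkM (X Z : M) a b : blk (X *m Z) a b = \sum_c blk X a c *m blk Z c b.
  rewrite -[X in LHS]submxblockK -[Z in LHS]submxblockK mul_mxblock.
  by rewrite /blk mxblockK.
set G := F 0%N *m D 0%N => GE.
have GEb a b : \sum_c blk G a c *m blk (E 0%N) c b = blk 1%:M a b.
  by rewrite -blkM GE.
have GF a b : blk G a b = blk (F 0%N) a b *m blk (D 0%N) b b.
  rewrite blkM (bigD1 b) //= big1 ?addr0 // => c cb.
  by rewrite [X in _ *m X]D1 ?mulmx0.
have Gup (a b : 'I_k) : (a < b)%N -> blk G a b = 0.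
  by move=> ab; rewrite GF [blk _ _ _]F2 ?mul0mx.
have key n (c : 'I_k) : (c < n)%N ->
    [/\ forall a : 'I_k, (c <= a)%N -> blk G a c = blk 1%:M a c
      & forall b : 'I_k, (c < b)%N -> blk (E 0%N) c b = 0].
  elim: n c => // n IH c; rewrite ltnS => cn.
  have Gc (a : 'I_k) : (c <= a)%N -> blk G a c = blk 1%:M a c.
    move=> ca; rewrite -GEb (bigD1 c) //= [blk (E _) c c]E1 /= mulmx1.
    rewrite big1 ?addr0 // => d dc; case: (ltngtP d c) => [ltdc|ltcd|/val_inj e].
    - by have [_ ->] := IH d (leq_trans ltdc cn); rewrite ?mulmx0.
    - by rewrite [blk (E _) _ _]E2 ?mulmx0.
    - by rewrite e eqxx in dc.
  split=> // b cb.
  have := GEb c b; rewrite (bigD1 c) //= Gc // [blk 1%:M c c]submxblock1 eqxx.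
  rewrite conform_mx_id mul1mx big1 ?addr0 => [->|d dc].
    by rewrite [LHS]submxblock1 (ltn_eqF cb : (c == b) = false).
  case: (ltngtP d c) => [ltdc|ltcd|/val_inj e].
  - have [H _] := IH d (leq_trans ltdc cn); rewrite (H c (ltnW ltdc)).
    by rewrite [blk 1%:M _ _]submxblock1 (gtn_eqF ltdc : (c == d) = false) mul0mx.
  - by rewrite Gup // mul0mx.
  - by rewrite e eqxx in dc.
have G1 : G = 1%:M.
  apply/mxblockP => a b; case: (leqP b a) => [ba|ab].
    by have [H _] := key b.+1 b (ltnSn b); apply: H.
  by rewrite [LHS]Gup // submxblock1 (ltn_eqF ab : (a == b) = false).
have E0 : E 0%N = 1%:M by rewrite -GE G1 mul1mx.
have D0 : D 0%N = 1%:M.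
  apply/mxblockP => a b; case: (eqVneq a b) => [<-|ab]; last first.
    by rewrite D1 // submxblock1 (negbTE ab).
  by rewrite -G1 -/(blk G a a) GF [blk (F _) _ _]F1 mul1mx.
by split=> //; rewrite -G1 /G D0 mulmx1.
Qed.

Lemma gauss_decomposition_unique T F D E F' D' E' : T 0%N = 1%:M ->
    gauss_decomposition T F D E -> gauss_decomposition T F' D' E' ->
  [/\ F' = F, D' = D & E' = E].
Proof.
move=> T0 [TE F1 D1 E1] [TE' F1' D1' E1'].
have h r : mul3 F D E r = T r by rewrite TE.
have h' r : mul3 F' D' E' r = T r by rewrite TE'.
have [F0 D0 E0] : [/\ F 0%N = 1%:M, D 0%N = 1%:M & E 0%N = 1%:M].
  by apply: mul3_one; rewrite ?h.
have [F0' D0' E0'] : [/\ F' 0%N = 1%:M, D' 0%N = 1%:M & E' 0%N = 1%:M].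
  by apply: mul3_one; rewrite ?h'.
have key n : forall r, (r <= n)%N -> [/\ F' r = F r, D' r = D r & E' r = E r].
  elim: n => [|n IH] r; first by rewrite leqn0 => /eqP->; rewrite F0 D0 E0.
  rewrite leq_eqVlt => /predU1P[->|]; last exact: IH.
  have eF r' : (r' < n.+1)%N -> F' r' = F r' by move/IH=> [].
  have eD r' : (r' < n.+1)%N -> D' r' = D r' by move/IH=> [].
  have eE r' : (r' < n.+1)%N -> E' r' = E r' by move/IH=> [].
  have := mul3B (ltn0Sn n) F0 D0 E0 eF eD eE; rewrite h h'.
  rewrite -[LHS]addr0 => /addrI/esym sum0.
  have sub0 a b : [/\ submxblock (F' n.+1) a b = submxblock (F n.+1) a b,
     submxblock (D' n.+1) a b = submxblock (D n.+1) a b &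
     submxblock (E' n.+1) a b = submxblock (E n.+1) a b].
    have := congr1 (fun X => submxblock X a b) sum0.
    rewrite /= !submxblockD !submxblockN submxblock0.
    case: F1 F1' E1 E1' => [F1 F2] [F1' F2'] [E1 E2] [E1' E2'].
    case: (ltngtP a b) => [ab|ba|/val_inj e].
    - have nab : a != b by rewrite -val_eqE /= (ltn_eqF ab).
      rewrite F2 // F2' // D1 // D1' // subrr !add0r.
      by move/subr0_eq->.
    - have nab : a != b by rewrite -val_eqE /= (gtn_eqF ba).
      rewrite E2 // E2' // D1 // D1' // subrr !addr0.
      by move/subr0_eq->.
    - rewrite -{}e F1 F1' E1 E1' subrr add0r addr0.
      by move/subr0_eq->.
  by split; apply/mxblockP => a b; have [] := sub0 a b.
by split; apply/funext => r; have [] := key r r (leqnn r).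
Qed.

End GaussExists.
Record composition (M N m n : nat) (mu : 'I_(m + n) -> nat) : Prop := {
  composition_gt0 : forall a, (0 < mu a)%N;
  composition_even : (\sum_(a < m) mu (lshift n a))%N = M;
  composition_odd : (\sum_(a < n) mu (rshift m a))%N = N
}.

Lemma composition_size M N m n (mu : 'I_(m + n) -> nat) :
  composition M N mu -> (M + N)%N = (\sum_a mu a)%N.
Proof. by case=> _ <- <-; rewrite big_split_ord. Qed.

Definition yang_T (K : fieldType) (M N : nat) (r : nat)
    : 'M[superYangian K M N]_(M + N) :=
  \matrix_(i, j) yang_t K i j r.

Definition yang_T_mu (K : fieldType) M N m n (mu : 'I_(m + n) -> nat)
    (hmu : composition M N mu) (r : nat)
    : 'M[superYangian K M N]_(\sum_a mu a) :=
  castmx (composition_size hmu, composition_size hmu) (yang_T K M N r).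

Lemma yang_T_mu_0 (K : fieldType) M N m n (mu : 'I_(m + n) -> nat)
    (hmu : composition M N mu) : yang_T_mu K hmu 0%N = 1%:M.
Proof.
rewrite /yang_T_mu; have -> : yang_T K M N 0%N = 1%:M.
  by apply/matrixP => i j; rewrite !mxE /yang_t /= rmorph_nat.
by case: _ / (composition_size hmu).
Qed.

Section Generators.
Context (A : pzRingType) (m n : nat) (mu : 'I_(m + n) -> nat).
Local Notation block_pair := {ab : 'I_(m + n) * 'I_(m + n) | (ab.1 < ab.2)%N}.

(* [existT _ a (i, j, r)] and [existT _ (a, b) (i, j, r)] with a < b index the
   elements with superscript r + 1, so that superscripts range over r >= 1. *)
Definition D_index : Type := {a : 'I_(m + n) & 'I_(mu a) * 'I_(mu a) * nat}%type.
Definition E_index : Type :=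
  {ab : block_pair & 'I_(mu (val ab).1) * 'I_(mu (val ab).2) * nat}%type.
Definition F_index : Type :=
  {ab : block_pair & 'I_(mu (val ab).2) * 'I_(mu (val ab).1) * nat}%type.
HB.instance Definition _ := Choice.on D_index.
HB.instance Definition _ := Choice.on E_index.
HB.instance Definition _ := Choice.on F_index.

Context (F D E : nat -> 'M[A]_(\sum_a mu a)).

Definition D_elt (x : D_index) : A :=
  let: existT a (i, j, r) := x in submxblock (D r.+1) a a i j.

Definition E_elt (x : E_index) : A :=
  let: existT ab (i, j, r) := x in
  submxblock (E r.+1) (val ab).1 (val ab).2 i j.

Definition F_elt (x : F_index) : A :=
  let: existT ab (i, j, r) := x in
  submxblock (F r.+1) (val ab).2 (val ab).1 i j.

Definition DEF_elt (x : D_index + E_index + F_index) : A :=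
  match x with
  | inl (inl d) => D_elt d
  | inl (inr e) => E_elt e
  | inr f => F_elt f
  end.

(* E_{a,b} and F_{b,a} are odd when a is one of the first m blocks and b is not. *)
Definition odd_pair (ab : block_pair) : bool :=
  ((val ab).1 < m <= (val ab).2)%N.

Definition D_odd (x : D_index) : bool := false.
Definition E_odd (x : E_index) : bool := odd_pair (projT1 x).
Definition F_odd (x : F_index) : bool := odd_pair (projT1 x).
Definition DEF_odd (x : D_index + E_index + F_index) : bool :=
  match x with
  | inl (inl d) => D_odd d
  | inl (inr e) => E_odd e
  | inr f => F_odd f
  end.

End Generators.

Section Basis.
Context (K : nzRingType) (A : lalgType K).

Definition subalgebra_gen (G : set A) : set A :=
  smallest [set S : set A | GRing.subalg_closed [in S]] G.

Definition lin_independent (J : choiceType) (B : set J) (v : J -> A) : Prop :=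
  forall (s : seq J) (c : J -> K), uniq s -> [set` s] `<=` B ->
    \sum_(j <- s) c j *: v j = 0 -> forall j, j \in s -> c j = 0.

Definition lin_span (J : choiceType) (B : set J) (v : J -> A) : set A :=
  [set y | exists (s : seq J) (c : J -> K),
     [set` s] `<=` B /\ y = \sum_(j <- s) c j *: v j].

Definition is_basis (J : choiceType) (B : set J) (v : J -> A) (S : set A) : Prop :=
  lin_independent B v /\ lin_span B v = S.

Definition total_order (I : Type) (le : rel I) : Prop :=
  [/\ antisymmetric le, transitive le & total le].

(* An ordered monomial is the weakly increasing list of its factors. *)
Definition ordered_monomials (I : choiceType) (isodd : pred I) (le : rel I)
    : set (seq I) :=
  [set s | sorted le s /\ forall x, isodd x -> (count_mem x s <= 1)%N].

Definition monomial (I : Type) (g : I -> A) (s : seq I) : A := \prod_(x <- s) g x.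

Definition pbw_basis (I : choiceType) (isodd : pred I) (g : I -> A) (S : set A)
    : Prop :=
  forall le : rel I, total_order le ->
    is_basis (ordered_monomials isodd le) (monomial g) S.

End Basis.

Section TriangularParts.
Context (K : fieldType) (M N m n : nat) (mu : 'I_(m + n) -> nat).
Local Notation Y := (superYangian K M N).
Context (F D E : nat -> 'M[Y]_(\sum_a mu a)).

Definition Y0 : set Y :=
  subalgebra_gen [set y | exists a (i j : 'I_(mu a)) r,
    y = submxblock (D r) a a i j].

Definition Yplus : set Y :=
  subalgebra_gen [set y | exists (a b : 'I_(m + n)) (i : 'I_(mu a)) (j : 'I_(mu b)) r,
    [/\ (a < b)%N, (0 < r)%N & y = submxblock (E r) a b i j]].

Definition Yminus : set Y :=
  subalgebra_gen [set y | exists (a b : 'I_(m + n)) (i : 'I_(mu b)) (j : 'I_(mu a)) r,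
    [/\ (a < b)%N, (0 < r)%N & y = submxblock (F r) b a i j]].

End TriangularParts.

(* Main.v *)
Require Import Defs.
From HB Require Import structures.
From mathcomp Require Import all_boot all_order all_algebra.
From mathcomp Require Import finmap zify.
From mathcomp Require Import boolp classical_sets reals complex monalg.

Set Implicit Arguments.
Unset Strict Implicit.
Unset Printing Implicit Defensive.

Import GRing.Theory.
Local Open Scope ring_scope.

(** Two gradings are needed. With t_ij^(r) of weight r, commutators drop in weight, which is what
    reordering needs, but F, D and E differ from the t's by products of the same weight. With
    t_ij^(r) of degree r - 1, those products drop, because each has at least two factors; but a
    commutator may keep the degree r + s - 2 and then only becomes shorter. Hence spanning uses the
    weight, while independence compares the degree first and the length second. The obstacle to
    spanning is that a commutator of two E's must be expressed by E's alone, or nothing is learnt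
    about the subalgebra they generate. Quotients are chosen for this reason: F and D cancel in the
    quotient of T by a corner, which depends on E only. The relation between two quotients appears
    multiplied by (u - v)^2; u - v is not a zero divisor in series in u^-1 and v^-1, and cancelling
    it keeps track of weights. Characteristic 0 enters twice: a repeated letter is counted by its
    multiplicity when differentiated, and the square of an odd generator is half its supercommutator
    with itself. *)

(* The defining relations say that t(u) and t(v) satisfy the exchange relation
   (u - v) [t_ij(u), t_hk(v)] = +-(t_hj(u) t_ik(v) - t_hj(v) t_ik(u)).
   Independence.  Matrix units, with signs, form a solution
   delta_ij + c^(r-1) E_ij u^-r of the relations, and the matrix product of two
   supercommuting solutions is again a solution; by the universal property this
   gives a morphism Psi from Y to the matrices over Y[c].  The coefficient of
   c^(r-1) in the entry (i,j) of Psi acts on the leading part of an ordered monomial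
   in the t's as the derivative with respect to t_ij^(r), so ordered monomials in the
   t's are independent by induction on the length; modulo lower terms, the entries of
   F, D and E are the t's.
   Spanning.  Each of the three families is supercommutative modulo words of smaller
   weight, so ordered monomials span what words span.  For E, the rows of E in block b
   are rows of the quotient of T by its corner T_b of blocks <= b, and linear algebra
   over T_a and T_b turns the exchange relation of T into one between such quotients;
   F is treated by transposition, and D through the inverses of the corners. *)

(** * Formal power series *)

(** The coefficient at r is that of u^-r. Sequences of matrices are of this type by conversion, with
    [mxser_mul] as product. *)
Definition fps (A : Type) : Type := nat -> A.
HB.instance Definition _ (A : Type) := gen_eqMixin (fps A).
HB.instance Definition _ (A : Type) := gen_choiceMixin (fps A).

Section Fps.
Context (A : pzRingType).
Implicit Types f g h : fps A.

Definition fps_add f g : fps A := fun r => f r + g r.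
Definition fps_opp f : fps A := fun r => - f r.
Definition fps_zero : fps A := fun=> 0.
Definition fps_mul f g : fps A := fun r => \sum_(s < r.+1) f s * g (r - s)%N.
Definition fps_cst (a : A) : fps A := fun r => if r is 0%N then a else 0.

Lemma fps_addA : associative fps_add.
Proof. by move=> f g h; apply: funext => r; rewrite /fps_add addrA. Qed.
Lemma fps_addC : commutative fps_add.
Proof. by move=> f g; apply: funext => r; rewrite /fps_add addrC. Qed.
Lemma fps_add0 : left_id fps_zero fps_add.
Proof. by move=> f; apply: funext => r; rewrite /fps_add add0r. Qed.
Lemma fps_addN : left_inverse fps_zero fps_opp fps_add.
Proof. by move=> f; apply: funext => r; rewrite /fps_add addNr. Qed.

HB.instance Definition _ := GRing.isZmodule.Build (fps A)
  fps_addA fps_addC fps_add0 fps_addN.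

Lemma fps_mulA : associative fps_mul.
Proof.
move=> f g h; apply: funext => r; rewrite /fps_mul.
under eq_bigr do rewrite mulr_sumr.
under [RHS]eq_bigr do rewrite mulr_suml.
rewrite -[LHS](big_mkord predT (fun s => \sum_(t < (r - s).+1) f s * (g t * h (r - s - t)%N))).
rewrite -[RHS](big_mkord predT (fun s => \sum_(t < s.+1) f t * g (s - t)%N * h (r - s)%N)).
(* Shifting the inner index by s makes both double sums run over 0 <= s <= t <= r. *)
have -> : \sum_(0 <= s < r.+1) \sum_(t < (r - s).+1) f s * (g t * h (r - s - t)%N) =
  \sum_(0 <= s < r.+1) \sum_(s <= t < r.+1) f s * (g (t - s)%N * h (r - t)%N).
  rewrite [LHS]big_nat [RHS]big_nat; apply: eq_bigr => s /= sr.
  rewrite -(big_mkord predT (fun t => f s * (g t * h (r - s - t)%N))) /=.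
  rewrite -[X in index_iota X r.+1]add0n big_addn subSn //.
  by apply: eq_bigr => t _; rewrite addnK -subnDA addnC.
under [LHS]eq_bigr => s _ do rewrite (@big_nat_widenl _ _ _ s 0) //=.
rewrite (exchange_big_dep_nat predT) //= big_nat [RHS]big_nat.
apply: eq_bigr => s /= sr; rewrite -(big_mkord predT (fun t => f t * g (s - t)%N * h (r - s)%N)).
rewrite [RHS](big_nat_widen _ _ r.+1) //=.
by apply: eq_bigr => t _; rewrite mulrA.
Qed.

Lemma fps_mul1 : left_id (fps_cst 1) fps_mul.
Proof.
move=> f; apply: funext => r; rewrite /fps_mul big_ord_recl /= mul1r subn0.
by rewrite big1 ?addr0 // => s _; rewrite /= mul0r.
Qed.

Lemma fps_mulr1 : right_id (fps_cst 1) fps_mul.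
Proof.
move=> f; apply: funext => r; rewrite /fps_mul big_ord_recr /= subnn mulr1.
rewrite big1 ?add0r // => s _ /=; have := ltn_ord s.
by rewrite -subn_gt0; case: (r - s)%N => // k _; rewrite mulr0.
Qed.

Lemma fps_mulDl : left_distributive fps_mul +%R.
Proof.
move=> f g h; apply: funext => r; rewrite /fps_mul.
by under eq_bigr do rewrite mulrDl; rewrite big_split.
Qed.

Lemma fps_mulDr : right_distributive fps_mul +%R.
Proof.
move=> f g h; apply: funext => r; rewrite /fps_mul.
by under eq_bigr do rewrite mulrDr; rewrite big_split.
Qed.

HB.instance Definition _ := GRing.Zmodule_isPzRing.Build (fps A)
  fps_mulA fps_mul1 fps_mulr1 fps_mulDl fps_mulDr.

Lemma fpsD f g r : (f + g) r = f r + g r. Proof. by []. Qed.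
Lemma fpsN f r : (- f) r = - f r. Proof. by []. Qed.
Lemma fpsB f g r : (f - g) r = f r - g r. Proof. by []. Qed.
Lemma fps0 r : (0 : fps A) r = 0. Proof. by []. Qed.
Lemma fpsM f g r : (f * g) r = \sum_(s < r.+1) f s * g (r - s)%N.
Proof. by []. Qed.
Lemma fps1 r : (1 : fps A) r = (r == 0%N)%:R. Proof. by case: r. Qed.
Lemma fps_sum I (s : seq I) (P : pred I) (F : I -> fps A) r :
  (\sum_(i <- s | P i) F i) r = \sum_(i <- s | P i) F i r.
Proof. exact: (big_morph (fun f : fps A => f r)). Qed.

Lemma fpsM0 f g : (f * g) 0%N = f 0%N * g 0%N.
Proof. by rewrite fpsM big_ord1. Qed.

Lemma fps_cst_zmod : zmod_morphism fps_cst.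
Proof. by move=> a b; apply: funext => -[|r] //; rewrite fpsB subr0. Qed.
Lemma fps_cst_monoid : monoid_morphism fps_cst.
Proof.
split=> // a b; apply: funext => -[|r]; first by rewrite fpsM0.
rewrite fpsM big1 // => -[[|s] lt_s] _ /=; first by rewrite mulr0.
by rewrite mul0r.
Qed.
HB.instance Definition _ := GRing.isZmodMorphism.Build A (fps A) fps_cst fps_cst_zmod.
HB.instance Definition _ :=
  GRing.isMonoidMorphism.Build A (fps A) fps_cst fps_cst_monoid.

Lemma fps_cstM a f r : (fps_cst a * f) r = a * f r.
Proof.
rewrite fpsM big_ord_recl subn0 big1 ?addr0 // => s _.
by rewrite /= mul0r.
Qed.
Lemma fpsM_cst a f r : (f * fps_cst a) r = f r * a.
Proof.
rewrite fpsM big_ord_recr /= subnn big1 ?add0r // => s _ /=.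
by have := ltn_ord s; rewrite -subn_gt0; case: (r - s)%N => // k _; rewrite mulr0.
Qed.

Definition fpsX : fps A := fun r => (r == 1%N)%:R.

Lemma fpsXM f r : (fpsX * f) r = if r is r'.+1 then f r' else 0.
Proof.
case: r => [|r]; first by rewrite fpsM0 mul0r.
rewrite fpsM big_ord_recl /= mul0r add0r big_ord_recl /= mul1r big1.
  by rewrite addr0 subSS subn0.
by move=> s _; rewrite /= /fpsX /= mul0r.
Qed.
Lemma fpsMX f r : (f * fpsX) r = if r is r'.+1 then f r' else 0.
Proof.
case: r => [|r]; first by rewrite fpsM0 mulr0.
rewrite fpsM big_ord_recr /= subnn mulr0 addr0 big_ord_recr /= subSnn mulr1.
rewrite big1 ?add0r // => s _ /=; have := ltn_ord s.
by rewrite -subn_gt0 /fpsX subSn ?eqSS ?(ltnW (ltn_ord s)) //;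
   case: (r - s)%N => // k _; rewrite mulr0.
Qed.
Lemma fpsX_comm f : fpsX * f = f * fpsX.
Proof. by apply: funext => r; rewrite fpsXM fpsMX. Qed.

Lemma fps_exp_low f n r : f 0%N = 0 -> (r < n)%N -> (f ^+ n) r = 0.
Proof.
move=> f0; elim: n r => // n IH r rn; rewrite exprS fpsM.
rewrite big_ord_recl f0 mul0r add0r big1 // => s _.
by rewrite IH ?mulr0 //= /bump /= add1n (leq_trans _ (_ : r <= n)%N) // ltn_subrL;
  case: (r) s => [[]|].
Qed.

(** The sum of all powers of f: if f has no constant term, the coefficient at r only sees the powers
    up to r. *)
Definition fps_geom f : fps A := fun r => (\sum_(i < r.+1) f ^+ i) r.

Lemma fps_geomE f r k : f 0%N = 0 -> (r < k)%N ->
  fps_geom f r = (\sum_(i < k) f ^+ i) r.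
Proof.
move=> f0; elim: k => // k IH; rewrite ltnS leq_eqVlt => /predU1P[->//|rk].
by rewrite big_ord_recr /= fpsD -IH // fps_exp_low // addr0.
Qed.

Lemma fps_geomL f : f 0%N = 0 -> (1 - f) * fps_geom f = 1.
Proof.
move=> f0; apply: funext => r.
transitivity (((1 - f) * \sum_(i < r.+1) f ^+ i) r).
  rewrite !fpsM; apply: eq_bigr => s _.
  by rewrite (@fps_geomE _ _ r.+1) // ltnS leq_subr.
have -> : (1 - f) * (\sum_(i < r.+1) f ^+ i) = 1 - f ^+ r.+1.
  by rewrite -opprB mulNr -subrX1 opprB.
by rewrite fpsB fps_exp_low // subr0.
Qed.

Lemma fps_geomR f : f 0%N = 0 -> fps_geom f * (1 - f) = 1.
Proof.
move=> f0; apply: funext => r.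
transitivity (((\sum_(i < r.+1) f ^+ i) * (1 - f)) r).
  rewrite !fpsM; apply: eq_bigr => s _.
  by rewrite (@fps_geomE _ _ r.+1).
have -> : (\sum_(i < r.+1) f ^+ i) * (1 - f) = 1 - f ^+ r.+1.
  have comm : GRing.comm (\sum_(i < r.+1) f ^+ i) (1 - f).
    apply: commr_sym; apply: commr_sum => i _; apply: commrX.
    by apply: commr_sym; apply: commrB => //; apply: commr1.
  by rewrite comm -opprB mulNr -subrX1 opprB.
by rewrite fpsB fps_exp_low // subr0.
Qed.

Definition fps_inv f : fps A := fps_geom (1 - f).

Lemma fps_mulVl f : f 0%N = 1 -> fps_inv f * f = 1.
Proof.
move=> f1; rewrite -{2}(subKr 1 f); apply: fps_geomR.
by rewrite fpsB f1 subrr.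
Qed.
Lemma fps_mulVr f : f 0%N = 1 -> f * fps_inv f = 1.
Proof.
move=> f1; rewrite -{1}(subKr 1 f); apply: fps_geomL.
by rewrite fpsB f1 subrr.
Qed.

End Fps.

(** * Identities between noncommutative polynomials *)

(** Syntax for the reflexive tactic [nc], which decides identities in a noncommutative ring with two
    distinguished central elements, in practice kap and th. *)
Inductive ncexp := NVar of nat | NZero | NOne | NAdd of ncexp & ncexp
  | NOpp of ncexp | NMul of ncexp & ncexp.

Section NcNorm.
Context (B : pzRingType).

(* The variables 0 and 1 stand for central elements. *)
Variable env : seq B.
Hypothesis env0 : forall z, env`_0 * z = z * env`_0.
Hypothesis env1 : forall z, env`_1 * z = z * env`_1.

Fixpoint nceval e : B := match e with
  | NVar k => env`_k | NZero => 0 | NOne => 1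
  | NAdd e1 e2 => nceval e1 + nceval e2 | NOpp e1 => - nceval e1
  | NMul e1 e2 => nceval e1 * nceval e2 end.

Fixpoint ncnorm e : seq (bool * seq nat) := match e with
  | NVar k => [:: (false, [:: k])] | NZero => [::] | NOne => [:: (false, [::])]
  | NAdd e1 e2 => ncnorm e1 ++ ncnorm e2
  | NOpp e1 => [seq (~~ u.1, u.2) | u <- ncnorm e1]
  | NMul e1 e2 =>
    [seq (u.1 (+) v.1, u.2 ++ v.2) | u <- ncnorm e1, v <- ncnorm e2] end.

Definition ncword (w : seq nat) : B := \prod_(k <- w) env`_k.
Definition ncsum (s : seq (bool * seq nat)) : B :=
  \sum_(u <- s) (-1) ^+ u.1 * ncword u.2.

Lemma ncnormE e : nceval e = ncsum (ncnorm e).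
Proof.
elim: e => [k|||e1 IH1 e2 IH2|e1 IH1|e1 IH1 e2 IH2] /=.
- by rewrite /ncsum big_seq1 mul1r /ncword big_seq1.
- by rewrite /ncsum big_nil.
- by rewrite /ncsum big_seq1 mul1r /ncword big_nil.
- by rewrite IH1 IH2 /ncsum big_cat.
- rewrite IH1 /ncsum big_map -sumrN; apply: eq_bigr => u _ /=.
  by rewrite signrN mulNr.
rewrite IH1 IH2 /ncsum big_allpairs_dep mulr_suml.
apply: eq_bigr => u _; rewrite mulr_sumr; apply: eq_bigr => v _ /=.
by rewrite /ncword big_cat signr_addb /= -!mulrA; congr (_ * _);
  rewrite !mulrA; congr (_ * _); rewrite commr_sign.
Qed.

(** Central letters move to the front; the order of all other letters is kept. *)
Definition ncsort (w : seq nat) :=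
  [seq k <- w | k == 0%N] ++ [seq k <- w | k == 1%N] ++ [seq k <- w | (1 < k)%N].

Lemma ncsortE w : ncword (ncsort w) = ncword w.
Proof.
rewrite /ncword /ncsort !big_cat !big_filter /=.
elim: w => [|k w IH]; first by rewrite !big_nil !mulr1.
rewrite !big_cons -IH; case: k => [|[|k]] /=; first by rewrite !mulrA.
  by rewrite !mulrA -env1.
have c0 : GRing.comm env`_k.+2 (\prod_(j <- w | j == 0%N) env`_j).
  by apply: (big_ind (GRing.comm env`_k.+2)) => [|x y|i /eqP->];
    [exact: commr1|exact: commrM|rewrite /GRing.comm env0].
have c1 : GRing.comm env`_k.+2 (\prod_(j <- w | j == 1%N) env`_j).
  by apply: (big_ind (GRing.comm env`_k.+2)) => [|x y|i /eqP->];
    [exact: commr1|exact: commrM|rewrite /GRing.comm env1].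
by rewrite !mulrA c0 -(mulrA _ env`_k.+2) c1 !mulrA.
Qed.

Fixpoint ncrem (b : bool) (w : seq nat) (s : seq (bool * seq nat)) :=
  if s is u :: s' then
    if (u.1 == b) && (u.2 == w) then Some s'
    else if ncrem b w s' is Some t then Some (u :: t) else None
  else None.

Lemma ncremP b w s t : ncrem b w s = Some t ->
  ncsum s = (-1) ^+ b * ncword w + ncsum t.
Proof.
elim: s t => //= -[c v] s IH t /=; case: ifP => [/andP[/eqP-> /eqP->] [<-]|_].
  by rewrite /ncsum big_cons.
case: ncrem IH => // t' /(_ _ erefl) IH [<-].
by rewrite /ncsum !big_cons -/(ncsum s) IH addrCA.
Qed.

(** The head must cancel against an equal word of opposite sign. [k] is fuel; the length of the list
    suffices, since every step shortens it. *)
Fixpoint nczero k (s : seq (bool * seq nat)) := match k, s with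
  | _, [::] => true
  | 0, _ => false
  | k'.+1, u :: s' =>
    if ncrem (~~ u.1) u.2 s' is Some t then nczero k' t else false
  end.

Lemma nczeroP k s : nczero k s -> ncsum s = 0.
Proof.
elim: k s => [|k IH] [|[b w] s] //=; try by rewrite /ncsum big_nil.
case E: ncrem => [t|] // /IH t0; rewrite /ncsum big_cons -/(ncsum s).
by rewrite (ncremP E) t0 addr0 /= signrN mulNr subrr.
Qed.

Definition nccheck e1 e2 :=
  let s := [seq (u.1, ncsort u.2) | u <- ncnorm (NAdd e1 (NOpp e2))] in
  nczero (size s) s.

Lemma nccheckP e1 e2 : nccheck e1 e2 -> nceval e1 = nceval e2.
Proof.
move=> /nczeroP s0; apply/eqP; rewrite -subr_eq0; apply/eqP.
rewrite -[LHS]/(nceval (NAdd e1 (NOpp e2))) ncnormE -[RHS]s0 /ncsum big_map.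
by apply: eq_bigr => u _; rewrite /= ncsortE.
Qed.

End NcNorm.

Ltac nc_index x env := lazymatch env with
  | x :: _ => constr:(0%N)
  | _ :: ?env' => let k := nc_index x env' in constr:(k.+1)
  end.
Ltac nc_mem x env := lazymatch env with
  | x :: _ => constr:(true)
  | _ :: ?env' => nc_mem x env'
  | _ => constr:(false)
  end.
Ltac nc_env x env := lazymatch x with
  | @Algebra.add _ ?y ?z => let env := nc_env y env in nc_env z env
  | @GRing.mul _ ?y ?z => let env := nc_env y env in nc_env z env
  | @Algebra.opp _ ?y => nc_env y env
  | @Algebra.zero _ => env
  | @GRing.one _ => env
  | _ => lazymatch nc_mem x env with
    | true => env
    | false => let rec snoc e := lazymatch e with
        | ?y :: ?e' => let e'' := snoc e' in constr:(y :: e'')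
        | _ => constr:([:: x]) end in snoc env
    end
  end.
Ltac nc_reify x env := lazymatch x with
  | @Algebra.add _ ?y ?z => let e := nc_reify y env in let f := nc_reify z env in
     constr:(NAdd e f)
  | @GRing.mul _ ?y ?z => let e := nc_reify y env in let f := nc_reify z env in
     constr:(NMul e f)
  | @Algebra.opp _ ?y => let e := nc_reify y env in constr:(NOpp e)
  | @Algebra.zero _ => constr:(NZero)
  | @GRing.one _ => constr:(NOne)
  | _ => let k := nc_index x env in constr:(NVar k)
  end.
Ltac nc c0 c1 := rewrite ?(mulr1n, mulr0n); lazymatch goal with |- @eq ?T ?x ?y =>
  lazymatch type of c0 with forall z, @eq ?T' (?k * z) _ =>
  lazymatch type of c1 with forall z, @eq _ (?t * z) _ =>
  let env := nc_env x constr:([:: k; t]) in let env := nc_env y env in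
  let e := nc_reify x env in let f := nc_reify y env in
  refine (@nccheckP _ env c0 c1 e f _); vm_compute; reflexivity end end end.

(** Proves an equation as a linear combination of known ones: [u = v] is assembled from them, and
    the remaining goal is a free identity for [nc]. *)
Lemma eq_lincomb (V : zmodType) (x y u v : V) : u = v -> x - y = u - v -> x = y.
Proof. by move=> -> /eqP; rewrite subrr subr_eq0 => /eqP. Qed.

(** * Exchange relations in a ring *)

Section Sign.
Context (B : pzRingType).
Implicit Types (x y : B) (b c : bool).

(** With boolean signs, case analysis on parities computes every sign and leaves goals that [nc]
    decides. *)
Definition sgn b x : B := if b then - x else x.

Lemma sgnE b x : sgn b x = (-1) ^+ b * x.
Proof. by case: b; rewrite ?mulN1r ?mul1r. Qed.
Lemma sgnMl b x y : sgn b x * y = sgn b (x * y).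
Proof. by case: b; rewrite /= ?mulNr. Qed.
Lemma sgnMr b x y : x * sgn b y = sgn b (x * y).
Proof. by case: b; rewrite /= ?mulrN. Qed.
Lemma sgnD b x y : sgn b (x + y) = sgn b x + sgn b y.
Proof. by case: b; rewrite /= ?opprD. Qed.
Lemma sgnN b x : sgn b (- x) = - sgn b x.
Proof. by case: b. Qed.
Lemma sgnB b x y : sgn b (x - y) = sgn b x - sgn b y.
Proof. by rewrite sgnD sgnN. Qed.
Lemma sgn0 b : sgn b 0 = 0.
Proof. by case: b; rewrite /= ?oppr0. Qed.
Lemma sgnK b c x : sgn b (sgn c x) = sgn (b (+) c) x.
Proof. by case: b; case: c; rewrite /= ?opprK. Qed.
Lemma sgn_sum b I (r : seq I) (P : pred I) (F : I -> B) :
  sgn b (\sum_(i <- r | P i) F i) = \sum_(i <- r | P i) sgn b (F i).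
Proof. by case: b; rewrite /= ?sumrN. Qed.
Lemma sgn_inj b : injective (sgn b).
Proof. by case: b => // x y /oppr_inj. Qed.

End Sign.

Lemma sgnZ (L : nzRingType) (V : lalgType L) (b : bool) (a : L) (z : V) :
  sgn b (a *: z) = a *: sgn b z.
Proof. by case: b; rewrite //= scalerN. Qed.

Section Exchange.
Context (B : pzRingType) (n : nat) (pa : 'I_n -> bool) (kap th : B).
Context (kapC : forall z, kap * z = z * kap) (thC : forall z, th * z = z * th).
Local Notation fam := ('I_n -> 'I_n -> B).
Implicit Types (a b l m : fam) (i j h k p q : 'I_n) (d e : pred 'I_n).

Local Notation s4 i j h k := ((pa i (+) pa j) && (pa h (+) pa k)).
Local Notation s3 i j h := ((pa i && pa j) (+) (pa i && pa h) (+) (pa j && pa h)).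

(* The relation between t(u) and t(v), with kap = u - v and th = 1 up to a
   common factor. *)
Definition exchange a b : Prop := forall i j h k,
  kap * (a i j * b h k - sgn (s4 i j h k) (b h k * a i j)) =
  sgn (s3 i j h) (th * (a h j * b i k - b h j * a i k)).

Definition supercommute a b : Prop := forall i j h k,
  b h k * a i j = sgn (s4 h k i j) (a i j * b h k).

Definition fmul a l : fam := fun i j => \sum_p a i p * l p j.

(** * Products of supercommuting solutions *)

Section Coproduct.
Variables (a b l m : fam).
Hypotheses (ab : exchange a b) (lm : exchange l m).
Hypotheses (bl : supercommute b l) (am : supercommute a m).

(** [M] and [H] are the two kinds of terms of the exchange relation for the products. [G] is the
    intermediate state, with a and b exchanged but l and m not yet. *)
Let M i j h k p q :=
  sgn (s3 i j h (+) s4 p j i q) (th * (a h p * b i q * (l p j * m q k))).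
Let G i j h k p q :=
  sgn (s3 i p h (+) s4 p j h q) (th * (b h p * a i q * (l p j * m q k))).
Let H i j h k p q :=
  sgn (s3 i j h (+) s4 p j i q) (th * (b h p * a i q * (m p j * l q k))).

Let pointL i j h k p q :
  kap * (a i p * l p j * (b h q * m q k)) -
  sgn (s4 i j h k) (kap * (b h q * m q k * (a i p * l p j))) =
  (M i j h k p q - G i j h k p q) + (G i j h k q p - H i j h k q p).
Proof.
have -> : a i p * l p j * (b h q * m q k) =
    sgn (s4 p j h q) (a i p * b h q * (l p j * m q k)).
  by rewrite -mulrA (mulrA (l p j)) bl sgnMl sgnMr !mulrA.
have -> : b h q * m q k * (a i p * l p j) =
    sgn (s4 q k i p) (b h q * a i p * (m q k * l p j)).
  by rewrite -mulrA (mulrA (m q k)) am sgnMl sgnMr !mulrA.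
(* a and b are exchanged in front of l m, then l and m are exchanged behind b a. *)
apply: (eq_lincomb (congr2 (fun x y => sgn (s4 p j h q) (x * (l p j * m q k)) +
  sgn (s4 p j h q (+) s4 i p h q) (b h q * a i p * y)) (ab i p h q) (lm p j q k))).
rewrite /M /G /H.
by move: (pa i) (pa j) (pa h) (pa p) (pa q) (pa k) => [] [] [] [] [] [] /=; nc kapC thC.
Qed.

Let pointR i j h k p q :
  sgn (s3 i j h) (th * (a h p * l p j * (b i q * m q k) - b h p * m p j * (a i q * l q k))) =
  M i j h k p q - H i j h k p q.
Proof.
have -> : a h p * l p j * (b i q * m q k) =
    sgn (s4 p j i q) (a h p * b i q * (l p j * m q k)).
  by rewrite -mulrA (mulrA (l p j)) bl sgnMl sgnMr !mulrA.
have -> : b h p * m p j * (a i q * l q k) =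
    sgn (s4 p j i q) (b h p * a i q * (m p j * l q k)).
  by rewrite -mulrA (mulrA (m p j)) am sgnMl sgnMr !mulrA.
rewrite /M /H.
by move: (pa i) (pa j) (pa h) (pa p) (pa q) (pa k) => [] [] [] [] [] [] /=; nc kapC thC.
Qed.

Lemma exchange_fmul : exchange (fmul a l) (fmul b m).
Proof.
move=> i j h k.
transitivity (\sum_p \sum_q ((M i j h k p q - G i j h k p q) +
                             (G i j h k q p - H i j h k q p))).
  rewrite /fmul !big_distrlr /= [X in _ - sgn _ X]exchange_big mulrBr sgnMr /=.
  rewrite !mulr_sumr sgn_sum -sumrB; apply: eq_bigr => p _.
  rewrite !mulr_sumr sgn_sum -sumrB; apply: eq_bigr => q _.
  exact: pointL.
transitivity (\sum_p \sum_q (M i j h k p q - H i j h k p q)).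
  (* Renaming (q, p) to (p, q) in the second half of the sum cancels all the terms [G]. *)
  under eq_bigr do rewrite big_split.
  rewrite big_split /= [X in _ + X]exchange_big -big_split /=.
  apply: eq_bigr => p _; rewrite -big_split; apply: eq_bigr => q _ /=.
  by rewrite addrA subrK.
rewrite /fmul !big_distrlr /= -sumrB mulr_sumr sgn_sum; apply: eq_bigr => p _.
rewrite -sumrB mulr_sumr sgn_sum; apply: eq_bigr => q _.
by rewrite pointR.
Qed.

End Coproduct.

(** * Quotients by invertible corners *)

Section CutOff.
Variables (a b : fam).
Hypotheses (ab : exchange a b) (kap_reg : forall z, kap * z = 0 -> z = 0).

Definition left_inverse_on d m t : Prop :=
  forall i j, d i -> d j -> \sum_(q | d q) m i q * t q j = (i == j)%:R.

(** A linear system with left invertible matrix has at most one solution. Identities for quotients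
    and inverses are checked after multiplication by the corner. *)
Lemma left_inverse_cancel d m t (x y : 'I_n -> B) : left_inverse_on d m t ->
    (forall i, d i -> \sum_(q | d q) t i q * x q = \sum_(q | d q) t i q * y q) ->
  forall q, d q -> x q = y q.
Proof.
move=> mt xy q dq.
have canc (z : 'I_n -> B) : \sum_(i | d i) m q i * (\sum_(p | d p) t i p * z p) = z q.
  under eq_bigr do rewrite mulr_sumr; rewrite exchange_big /= (bigD1 q) //=.
  under eq_bigr do rewrite mulrA; rewrite -mulr_suml mt // eqxx mul1r.
  rewrite big1 ?addr0 // => p /andP[dp pq].
  under eq_bigr do rewrite mulrA; rewrite -mulr_suml mt // eq_sym (negbTE pq).
  by rewrite mul0r.
by rewrite -(canc x) -(canc y); apply: eq_bigr => i di; rewrite xy.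
Qed.

(** Super Leibniz rule: the commutator of a_ij with the product r of row h of [b] and the column [x]
    splits into commutators with [b], known from [ab], and with [x]. The parity of x_q is that of q
    plus [c]. *)
Lemma exchange_cut d i j h (c : bool) (x : 'I_n -> B) :
  \sum_(q | d q) b h q * sgn ((pa i (+) pa j) && pa q)
    (kap * (a i j * x q - sgn ((pa i (+) pa j) && (pa q (+) c)) (x q * a i j))) =
  let r := \sum_(q | d q) b h q * x q in
  sgn ((pa i (+) pa j) && pa h)
   (kap * (a i j * r - sgn ((pa i (+) pa j) && (pa h (+) c)) (r * a i j)) -
    sgn (s3 i j h) (th * (a h j * (\sum_(q | d q) b i q * x q) -
                          b h j * (\sum_(q | d q) a i q * x q)))).
Proof.
rewrite /= !mulr_sumr mulr_suml sgn_sum -!sumrB !mulr_sumr sgn_sum -sumrB sgn_sum.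
apply: eq_bigr => q _.
apply: (eq_lincomb (congr1 (fun y : B => sgn ((pa i (+) pa j) && pa h) (y * - x q))
  (ab i j h q))).
by move: (pa i) (pa j) (pa h) (pa q) c => [] [] [] [] [] /=; nc kapC thC.
Qed.

Section Quotient.
Variables (d : pred 'I_n) (sb xa xb : fam).
Hypotheses (sbK : left_inverse_on d sb b).
Hypotheses (axa : forall i k, d i -> \sum_(q | d q) a i q * xa q k = a i k).
Hypotheses (bxb : forall i k, d i -> \sum_(q | d q) b i q * xb q k = b i k).

Definition delta_sum i k := \sum_(q | d q) a i q * (xb q k - xa q k).

(** Multiply by the corner of [b]. Since b xb = b, the Leibniz rule meets the relation of a_ij with
    b_hk itself; the terms a_hj b_ik cancel, and b_hj times [delta_sum] remains. *)
Lemma exchange_quotient i j h k : d i -> d h ->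
  kap * (a i j * xb h k - sgn (s4 i j h k) (xb h k * a i j)) =
  sgn (s3 i j h) (th * (xb h j * delta_sum i k)).
Proof.
move=> di dh; apply: (@sgn_inj _ ((pa i (+) pa j) && pa h)).
pose z q := sgn ((pa i (+) pa j) && pa q)
  (kap * (a i j * xb q k - sgn (s4 i j q k) (xb q k * a i j))).
pose z' q := sgn (pa i && pa j) (th * (xb q j * delta_sum i k)).
have <- : z' h = sgn ((pa i (+) pa j) && pa h)
    (sgn (s3 i j h) (th * (xb h j * delta_sum i k))).
  by rewrite sgnK /z'; congr (sgn _ _); move: (pa i) (pa j) (pa h) => [] [] [].
apply: (left_inverse_cancel (x := z) (y := z') sbK _ dh) => {dh}h dh.
rewrite /z exchange_cut /= !bxb // /z'.
under [RHS]eq_bigr do rewrite sgnMr mulrA -thC -mulrA.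
rewrite -sgn_sum -mulr_sumr.
under [in RHS]eq_bigr do rewrite mulrA.
rewrite -mulr_suml bxb //.
have -> : delta_sum i k = \sum_(q | d q) a i q * xb q k - a i k.
  by rewrite -(axa k di) -sumrB; apply: eq_bigr => q _; rewrite mulrBr.
apply: (eq_lincomb (congr1 (fun y : B => sgn ((pa i (+) pa j) && pa h) y)
  (ab i j h k))).
by move: (pa i) (pa j) (pa h) (pa k) => [] [] [] [] /=; nc kapC thC.
Qed.

Lemma quotient_delta h k : d h -> d k -> xb h k = (h == k)%:R.
Proof.
move=> dh dk.
apply: (left_inverse_cancel (x := xb^~ k) (y := fun h => (h == k)%:R) sbK _ dh) => i di.
by rewrite bxb // (bigD1 k) //= eqxx mulr1 big1 ?addr0 // => q /andP[_ /negbTE->];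
   rewrite mulr0.
Qed.

End Quotient.

Section QuotientQuotient.
Variables (d e : pred 'I_n) (sa sb xa xe xb : fam).
Hypotheses (de : forall i, d i -> e i).
Hypotheses (saK : left_inverse_on d sa a) (sbK : left_inverse_on e sb b).
Hypotheses (axa : forall i k, d i -> \sum_(q | d q) a i q * xa q k = a i k).
Hypotheses (axe : forall i k, e i -> \sum_(q | e q) a i q * xe q k = a i k).
Hypotheses (bxb : forall i k, e i -> \sum_(q | e q) b i q * xb q k = b i k).

(** [w] is the solution of a w = y on the rows in d, so it serves to divide the relation for the
    corner e by the corner d. *)
Let y i k := delta_sum e xe xb i k.
Let w i k := \sum_(p | e p) xa i p * (xb p k - xe p k).

Let yE i k : d i -> \sum_(q | d q) a i q * w q k = y i k.
Proof.
move=> di; under eq_bigr do rewrite mulr_sumr; rewrite exchange_big /=.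
apply: eq_bigr => p _; under eq_bigr do rewrite mulrA.
by rewrite -mulr_suml axa.
Qed.

(** The equation is multiplied by the corner d of [a], which turns xa into a, and
    [exchange_quotient] applies. It is applied again to move [xb h j] past [a i p], whence the
    second factor kap. The right side contains quotients only. *)
Lemma exchange_quotient2 i j h k : d i -> e h ->
  kap * (kap * (xa i j * xb h k - sgn (s4 i j h k) (xb h k * xa i j))) =
  kap * (th * \sum_(p | e p) sgn ((pa j && pa h) (+) (pa p && (pa h (+) pa j)))
    (xa i p * xb h j * (xb p k - xe p k)))
  - th * (th * (w i j * (xb h k - xe h k)))
  - kap * (th * (if d h then sgn (pa h (+) ((pa h (+) pa j) && (pa h (+) pa k)))
                    (w i k * xa h j) else 0)).
Proof.
move=> di eh; move: i di; apply: (left_inverse_cancel saK) => i di.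
have ei := de di.
have rel q : kap * (a i q * xb h k) = sgn (s4 i q h k) (kap * (xb h k * a i q)) +
    sgn (s3 i q h) (th * (xb h q * y i k)).
  have := exchange_quotient sbK axe bxb q k ei eh.
  by rewrite mulrBr sgnMr => /eqP; rewrite subr_eq addrC => /eqP.
have xbd p : e p -> xb h p = (h == p)%:R by move=> ep; apply: (quotient_delta sbK bxb).
have -> : \sum_(q | d q) a i q *
    (kap * (kap * (xa q j * xb h k - sgn (s4 q j h k) (xb h k * xa q j)))) =
    kap * (sgn (s3 i j h) (th * (xb h j * y i k))) -
    kap * (th * (if d h then sgn (pa h (+) ((pa h (+) pa j) && (pa h (+) pa k)))
                    (y i k * xa h j) else 0)).
  transitivity (kap * (kap * (a i j * xb h k)) -
     sgn (s4 i j h k) (kap * (kap * (xb h k * a i j))) -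
     \sum_(q | d q) sgn ((pa q (+) pa j) && (pa h (+) pa k) (+) s3 i q h)
       (kap * (th * (xb h q * y i k)) * xa q j)).
    rewrite -{1}(axa j di) -{1}(axa j di) mulr_suml !mulr_sumr sgn_sum -!sumrB.
    apply: eq_bigr => q _.
    apply: (eq_lincomb (congr1 (fun y : B => - sgn ((pa q (+) pa j) && (pa h (+) pa k))
       (kap * y * xa q j)) (rel q))).
    by move: (pa i) (pa j) (pa h) (pa q) (pa k) => [] [] [] [] [] /=; nc kapC thC.
  rewrite rel mulrDr sgnMr [X in X - _]addrC addKr; congr (_ - _).
  (* On the columns in e, [xb h q] is a Kronecker delta, so only q = h survives, and only if h lies
     in d. *)
  case: ifP => dh.
    rewrite (bigD1 h) //= (xbd h) // eqxx mul1r big1.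
      by rewrite addr0; move: (pa i) (pa j) (pa h) (pa k) => [] [] [] [] /=; nc kapC thC.
    move=> q /andP[dq]; rewrite xbd ?de // eq_sym => /negbTE->.
    by rewrite mul0r !mulr0 mul0r sgn0.
  rewrite !mulr0 big1 // => q dq; rewrite xbd ?de //.
  case: eqP dq => [<-|_ _]; first by rewrite dh.
  by rewrite mul0r !mulr0 mul0r sgn0.
have -> : \sum_(q | d q) a i q *
   (kap * (th * \sum_(p | e p) sgn ((pa j && pa h) (+) (pa p && (pa h (+) pa j)))
    (xa q p * xb h j * (xb p k - xe p k)))
  - th * (th * (w q j * (xb h k - xe h k)))
  - kap * (th * (if d h then sgn (pa h (+) ((pa h (+) pa j) && (pa h (+) pa k)))
                    (w q k * xa h j) else 0))) =
   kap * (th * \sum_(p | e p) sgn ((pa j && pa h) (+) (pa p && (pa h (+) pa j)))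
    (a i p * xb h j * (xb p k - xe p k)))
  - th * (th * (y i j * (xb h k - xe h k)))
  - kap * (th * (if d h then sgn (pa h (+) ((pa h (+) pa j) && (pa h (+) pa k)))
                    (y i k * xa h j) else 0)).
  have -> : \sum_(p | e p) sgn ((pa j && pa h) (+) (pa p && (pa h (+) pa j)))
      (a i p * xb h j * (xb p k - xe p k)) =
      \sum_(q | d q) a i q * \sum_(p | e p)
        sgn ((pa j && pa h) (+) (pa p && (pa h (+) pa j)))
        (xa q p * xb h j * (xb p k - xe p k)).
    under [RHS]eq_bigr do rewrite mulr_sumr; rewrite exchange_big /=.
    apply: eq_bigr => p _; rewrite -(axa p di) !mulr_suml sgn_sum.
    by apply: eq_bigr => q _; rewrite sgnMr !mulrA.
  rewrite -!(yE _ di) (_ : (if d h then sgn _ (_ * xa h j) else 0) =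
    \sum_(q | d q) a i q * (if d h then
       sgn (pa h (+) ((pa h (+) pa j) && (pa h (+) pa k))) (w q k * xa h j) else 0)).
    rewrite !mulr_suml !mulr_sumr -!sumrB; apply: eq_bigr => q _.
    by nc kapC thC.
  case: ifP => _; last by rewrite big1 // => q _; rewrite mulr0.
  by rewrite mulr_suml sgn_sum; apply: eq_bigr => q _; rewrite sgnMr mulrA.
congr (_ - _).
(* Moving [xb h j] past [a i p] produces [xb h p], again a Kronecker delta; the th^2 term is written
   as a sum over p so that the comparison is termwise. *)
have -> : th * (th * (y i j * (xb h k - xe h k))) =
   \sum_(p | e p) th * (th * (xb h p * y i j * (xb p k - xe p k))).
  rewrite (bigD1 h) //= (xbd h) // eqxx mul1r big1 ?addr0 // => p /andP[ep ph].
  by rewrite (xbd p) // eq_sym (negbTE ph) !mul0r !mulr0.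
rewrite {1}/y /delta_sum !mulr_sumr sgn_sum !mulr_sumr -sumrB.
apply: eq_bigr => p ep.
apply: (eq_lincomb (congr1 (fun y : B => - sgn (s3 i j h (+) s4 i p h j) (th * y *
   (xb p k - xe p k))) (exchange_quotient sbK axe bxb p j ei eh))).
rewrite -/(y i j); case: (eqVneq h p) => [<-|hp].
  by move: (pa i) (pa j) (pa h) => [] [] [] /=; nc kapC thC.
rewrite (xbd p ep) (negbTE hp) !mul0r !mulr0 sgn0 !mulr0 !mul0r sgn0.
by move: (pa i) (pa j) (pa h) (pa p) => [] [] [] [] /=; nc kapC thC.
Qed.

End QuotientQuotient.

(** * Inverses of corners *)

Section Inverse.
Variables (d : pred 'I_n) (sb : fam).
Hypotheses (sbK : left_inverse_on d sb b) (bsbK : left_inverse_on d b sb).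

Let ts i k := \sum_(q | d q) a i q * sb q k.
Let st h j := \sum_(q | d q) sb h q * a q j.

(** The product b sb has Kronecker deltas as entries on d and supercommutes with a_ij. By the
    Leibniz rule the commutator with sb is, up to signs, - sb [a, b] sb. *)
Lemma exchange_inverse i j h k : d i -> d j -> d h -> d k ->
  kap * (a i j * sb h k - sgn (s4 i j h k) (sb h k * a i j)) =
  sgn (s3 i j h) (th * ((h == j)%:R * ts i k - (i == k)%:R * st h j)).
Proof.
move=> di dj dh dk; apply: (@sgn_inj _ ((pa i (+) pa j) && pa h)).
pose z q := sgn ((pa i (+) pa j) && pa q)
  (kap * (a i j * sb q k - sgn (s4 i j q k) (sb q k * a i j))).
pose z' q := sgn (pa i && pa j) (th * ((q == j)%:R * ts i k - (i == k)%:R * st q j)).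
have <- : z' h = sgn ((pa i (+) pa j) && pa h)
    (sgn (s3 i j h) (th * ((h == j)%:R * ts i k - (i == k)%:R * st h j))).
  by rewrite sgnK /z'; congr (sgn _ _); move: (pa i) (pa j) (pa h) => [] [] [].
apply: (left_inverse_cancel (x := z) (y := z') sbK _ dh) => {dh}h dh.
rewrite /z exchange_cut /= !bsbK // -/(ts i k).
have -> : \sum_(q | d q) b h q * z' q =
    sgn (pa i && pa j) (th * (b h j * ts i k - (i == k)%:R * a h j)).
  have bst : a h j = \sum_(q | d q) b h q * st q j.
    under eq_bigr do rewrite mulr_sumr; rewrite exchange_big /=.
    under eq_bigr do under eq_bigr do rewrite mulrA.
    rewrite (bigD1 h) //= -mulr_suml bsbK // eqxx mul1r big1 ?addr0 //.
    move=> q /andP[dq qh]; rewrite -mulr_suml bsbK // eq_sym (negbTE qh).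
    by rewrite mul0r.
  have -> : b h j * ts i k = \sum_(q | d q) b h q * ((q == j)%:R * ts i k).
    rewrite (bigD1 j) //= eqxx mul1r big1 ?addr0 // => q /andP[_ /negbTE->].
    by rewrite mul0r mulr0.
  rewrite bst mulr_sumr -sumrB mulr_sumr sgn_sum; apply: eq_bigr => q _.
  rewrite sgnMr mulrA -thC -mulrA; congr (sgn _ (th * _)).
  by rewrite mulrBr; congr (_ - _); rewrite !mulrA; congr (_ * _);
    case: (i == k); rewrite ?mulr1 ?mul1r ?mulr0 ?mul0r.
have -> : kap * (a i j * (h == k)%:R -
    sgn (s4 i j h k) ((h == k)%:R * a i j)) = 0.
  case: eqP => [->|_]; last by rewrite mulr0 mul0r sgn0 subrr mulr0.
  by rewrite addbb andbF mulr1 mul1r subrr mulr0.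
by case: (i == k); move: (pa i) (pa j) (pa h) => [] [] [] /=; nc kapC thC.
Qed.

(** The hypothesis [pa h = pa k] makes [sb h k] even, so the ordinary commutator appears; this is
    the case of two indices in one diagonal block. *)
Lemma exchange_inverse2 (sa : fam) i j h k : left_inverse_on d sa a ->
    left_inverse_on d a sa -> d i -> d j -> d h -> d k -> pa h = pa k ->
  kap * (sa i j * sb h k - sb h k * sa i j) =
  sgn (pa h) (th * (sa i k * sb h j - sb i k * sa h j)).
Proof.
move=> saK asaK di dj dh dk hk.
apply: (left_inverse_cancel (x := fun i => kap * (sa i j * sb h k - sb h k * sa i j))
  (y := fun i => sgn (pa h) (th * (sa i k * sb h j - sb i k * sa h j))) saK _ di).
move=> {di}i di.
have -> : \sum_(q | d q) a i q * (kap * (sa q j * sb h k - sb h k * sa q j)) =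
    \sum_(q | d q) - (sgn (s3 i q h)
       (th * ((h == q)%:R * ts i k - (i == k)%:R * st h q)) * sa q j).
  transitivity (kap * ((i == j)%:R * sb h k) - kap * (sb h k * (i == j)%:R) -
    \sum_(q | d q) kap * (a i q * sb h k - sb h k * a i q) * sa q j).
    rewrite -(asaK i j) // mulr_suml !mulr_sumr -!sumrB.
    by apply: eq_bigr => q _; nc kapC thC.
  rewrite (_ : (i == j)%:R * _ = sb h k * (i == j)%:R); last first.
    by case: (i == j); rewrite ?mulr1 ?mul1r ?mulr0 ?mul0r.
  rewrite subrr sub0r -sumrN; apply: eq_bigr => q dq; congr (- (_ * _)).
  by rewrite -exchange_inverse // hk addbb andbF.
rewrite (eq_bigr (fun q => sgn (pa h) (th * ((i == k)%:R * st h q * sa q j)) -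
   (if q == h then sgn (pa h) (th * (ts i k * sa h j)) else 0))); last first.
  move=> q dq; rewrite [h == q]eq_sym; case: (eqVneq q h) => [->|_].
    case: (eqVneq i k) => [->|_].
      by rewrite hk; move: (pa k) => [] /=; nc kapC thC.
    by move: (pa i) (pa h) => [] [] /=; nc kapC thC.
  case: (eqVneq i k) => [->|_].
    by rewrite hk; move: (pa k) (pa q) => [] [] /=; nc kapC thC.
  by move: (pa i) (pa h) (pa q) => [] [] [] /=; nc kapC thC.
rewrite sumrB -big_mkcondr /= (_ : \sum_(q | d q && (q == h)) _ =
    sgn (pa h) (th * (ts i k * sa h j))); last first.
  rewrite (big_pred1 h) // => q /=.
  by case: (eqVneq q h) => [->|_]; rewrite ?andbF ?dh.
have -> : \sum_(q | d q) sgn (pa h) (th * ((i == k)%:R * st h q * sa q j)) =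
    sgn (pa h) (th * ((i == k)%:R * sb h j)).
  rewrite -sgn_sum -mulr_sumr; congr (sgn _ (th * _)).
  under eq_bigr do rewrite -mulrA; rewrite -mulr_sumr; congr (_ * _).
  under eq_bigr do rewrite mulr_suml; rewrite exchange_big /=.
  under eq_bigr do under eq_bigr do rewrite -mulrA.
  rewrite (bigD1 j) //= -mulr_sumr asaK // eqxx mulr1 big1 ?addr0 //.
  by move=> q /andP[dq qj]; rewrite -mulr_sumr asaK // (negbTE qj) mulr0.
rewrite -(asaK i k) // /ts !mulr_suml !mulr_sumr !sgn_sum -sumrB.
by apply: eq_bigr => q _; move: (pa h) => [] /=; nc kapC thC.
Qed.

(** For h and k outside d' both Kronecker deltas of [exchange_inverse] vanish. As kap is regular,
    [sb h k] commutes with the corner d' of [a], hence with its inverse. *)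
Lemma inverse_commute d' (sa : fam) i j h k : (forall i, d' i -> d i) ->
    left_inverse_on d' sa a -> left_inverse_on d' a sa ->
    d' i -> d' j -> d h -> d k -> ~~ d' h -> ~~ d' k -> pa h = pa k ->
  sa i j * sb h k = sb h k * sa i j.
Proof.
move=> d'd saK asaK di dj dh dk d'h d'k hk; apply/eqP; rewrite -subr_eq0; apply/eqP.
apply: (left_inverse_cancel (x := fun i => sa i j * sb h k - sb h k * sa i j)
  (y := fun=> 0) saK _ di) => {di}i di.
rewrite [RHS]big1 => [|q _]; last by rewrite mulr0.
transitivity ((i == j)%:R * sb h k - sb h k * (i == j)%:R).
  rewrite -(asaK i j) // mulr_suml mulr_sumr -sumrB; apply: eq_bigr => q dq.
  rewrite mulrBr !mulrA; congr (_ - _ * _).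
  apply/eqP; rewrite -subr_eq0; apply/eqP/kap_reg.
  have hq : (h == q) = false by apply: contraNF d'h => /eqP ->.
  have ik : (i == k) = false by apply: contraNF d'k => /eqP <-.
  have := exchange_inverse (d'd _ di) (d'd _ dq) dh dk.
  by rewrite hk addbb andbF hq ik !mul0r subrr mulr0 sgn0.
by case: (i == j); rewrite ?mulr1 ?mul1r ?mulr0 ?mul0r subrr.
Qed.

End Inverse.

End CutOff.

(** Transposition combined with reversal of products preserves the relation, which carries results
    on E over to F. *)
Lemma exchange_converse (a b : fam) : exchange a b ->
  forall i j h k, let a' i j : B^c := a j i in let b' i j : B^c := b j i in
  (kap : B^c) * (a' i j * b' h k - sgn (s4 i j h k) (b' h k * a' i j)) =
  sgn (s3 i j h) ((th : B^c) * (a' h j * b' i k - b' h j * a' i k)).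
Proof.
move=> ab i j h k /=.
rewrite -[LHS]/((b k h * a j i - sgn (s4 i j h k) (a j i * b k h)) * kap).
rewrite -[RHS]/(sgn (s3 i j h) ((b k i * a j h - a k i * b j h) * th)) -kapC -thC.
apply: (eq_lincomb (congr1 (fun y : B => - sgn (s4 i j h k) y) (ab j i k h))).
by move: (pa i) (pa j) (pa h) (pa k) => [] [] [] [] /=; nc kapC thC.
Qed.

End Exchange.

(** * Generating series of a solution of the defining relations *)

Lemma supercomm_deltal (A : pzRingType) n (pa : 'I_n -> bool) i j b (z : A) :
  (i == j)%:R * z - sgn ((pa i (+) pa j) && b) (z * (i == j)%:R) = 0.
Proof.
case: eqP => [->|_]; last by rewrite mul0r mulr0 sgn0 subrr.
by rewrite addbb mul1r mulr1 subrr.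
Qed.

Lemma supercomm_deltar (A : pzRingType) n (pa : 'I_n -> bool) i j b (z : A) :
  z * (i == j)%:R - sgn (b && (pa i (+) pa j)) ((i == j)%:R * z) = 0.
Proof.
case: eqP => [->|_]; last by rewrite mul0r mulr0 sgn0 subrr.
by rewrite addbb andbF mul1r mulr1 subrr.
Qed.

Section TwoVariables.
Context (A : pzRingType).

Definition inU (f : fps A) : fps (fps A) := fun r => fps_cst (f r).
Definition inV (f : fps A) : fps (fps A) := fps_cst f.

(* The variables of the outer and of the inner series are u^-1 and v^-1. *)
Definition kapUV : fps (fps A) := fps_cst (fpsX A) - fpsX (fps A).
Definition thUV : fps (fps A) := fpsX (fps A) * fps_cst (fpsX A).

Lemma inU_sum I (r : seq I) (P : pred I) (f : I -> fps A) :
  inU (\sum_(i <- r | P i) f i) = \sum_(i <- r | P i) inU (f i).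
Proof. by apply: funext => s; rewrite /inU !fps_sum rmorph_sum. Qed.
Lemma inUM f g : inU (f * g) = inU f * inU g.
Proof.
apply: funext => r; rewrite /inU !fpsM rmorph_sum; apply: eq_bigr => s _.
exact: rmorphM.
Qed.
Lemma inU_nat (b : bool) : inU b%:R = b%:R.
Proof.
case: b; apply: funext => r; rewrite /inU ?mulr1n ?mulr0n.
  by rewrite !fps1 rmorph_nat.
by rewrite !fps0 rmorph0.
Qed.

Lemma inU_inV f g r s : (inU f * inV g) r s = f r * g s.
Proof. by rewrite fpsM_cst fps_cstM. Qed.
Lemma inV_inU f g r s : (inV g * inU f) r s = g s * f r.
Proof. by rewrite fps_cstM fpsM_cst. Qed.

Lemma kapUVE z r s : (kapUV * z) r s =
  (if s is s'.+1 then z r s' else 0) - (if r is r'.+1 then z r' s else 0).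
Proof.
rewrite mulrBl !fpsB fps_cstM fpsXM fpsXM; congr (_ - _).
by case: r.
Qed.
Lemma thUVE z r s : (thUV * z) r s =
  if r is r'.+1 then if s is s'.+1 then z r' s' else 0 else 0.
Proof.
rewrite -mulrA fpsXM; case: r => [|r]; first by [].
by rewrite fps_cstM fpsXM.
Qed.

Lemma sgn_coef b (z : fps (fps A)) r s : (sgn b z) r s = sgn b (z r s).
Proof. by case: b. Qed.

Lemma kapUV_comm z : kapUV * z = z * kapUV.
Proof.
rewrite mulrBl mulrBr fpsX_comm; congr (_ - _).
by apply: funext => r; rewrite fps_cstM fpsM_cst fpsX_comm.
Qed.
Lemma thUV_comm z : thUV * z = z * thUV.
Proof.
rewrite -mulrA [fps_cst _ * z](_ : _ = z * fps_cst (fpsX A)).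
  by rewrite !mulrA fpsX_comm -!mulrA fpsX_comm.
by apply: funext => r; rewrite fps_cstM fpsM_cst fpsX_comm.
Qed.
(** The coefficient of kap z at (r + 1, s + 1) is z(r + 1, s) - z(r, s + 1), and at (0, s + 1) it is
    z(0, s); so induction on r recovers z. *)
Lemma kapUV_reg z : kapUV * z = 0 -> z = 0.
Proof.
move=> z0; have E r s : (kapUV * z) r s = 0 by rewrite z0.
apply: funext => r; apply: funext; rewrite !fps0; elim: r => [|r IH] s.
  by have := E 0%N s.+1; rewrite kapUVE subr0.
by have := E r.+1 s.+1; rewrite kapUVE IH subr0.
Qed.

End TwoVariables.

Section Relation.
Context (A : pzRingType) (n : nat) (pa : 'I_n -> bool) (t : 'I_n -> 'I_n -> fps A).
Hypothesis t0 : forall i j, t i j 0%N = (i == j)%:R.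

Local Notation s4 i j h k := ((pa i (+) pa j) && (pa h (+) pa k)).
Local Notation s3 i j h := ((pa i && pa j) (+) (pa i && pa h) (+) (pa j && pa h)).

Let cm i j h k r s := t i j r * t h k s - sgn (s4 i j h k) (t h k s * t i j r).
Let qd i j h k r s := t h j r * t i k s - t h j s * t i k r.
Let sm i j h k r s := \sum_(l < minn r s) qd i j h k l (r + s - 1 - l)%N.

Definition yang_relation : Prop := forall i j h k r s,
  t i j r * t h k s - sgn (s4 i j h k) (t h k s * t i j r) =
  sgn (s3 i j h) (\sum_(l < minn r s)
    (t h j l * t i k (r + s - 1 - l)%N - t h j (r + s - 1 - l)%N * t i k l)).

Let cm0 i j h k s : cm i j h k 0 s = 0.
Proof. by rewrite /cm t0 supercomm_deltal. Qed.

Let cmr0 i j h k r : cm i j h k r 0 = 0.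
Proof. by rewrite /cm t0 supercomm_deltar. Qed.

(** Both sums have the same terms, since r + s + 1 is shared; only their lengths differ, by one term
    or, for r = s, not at all. As [qd] is antisymmetric, that term is right in both cases. *)
Let smS i j h k r s : sm i j h k r.+1 s - sm i j h k r s.+1 = qd i j h k r s.
Proof.
rewrite /sm addnS addSn; set F := qd i j h k.
case: (ltngtP r s) => [rs|sr|->].
- rewrite (minn_idPl rs) (minn_idPl (leqW (ltnW rs))) big_ord_recr /=.
  by rewrite addrAC subrr add0r subn1 /= addKn.
- rewrite (minn_idPr (leqW (ltnW sr))) (minn_idPr sr) big_ord_recr /=.
  by rewrite opprD addrA subrr add0r subn1 /= addnK /F /qd opprB.
by rewrite (minn_idPr (leqnSn s)) (minn_idPl (leqnSn s)) subrr /F /qd subrr.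
Qed.

Let exch i j h k r s :
  (kapUV A * (inU (t i j) * inV (t h k) -
     sgn (s4 i j h k) (inV (t h k) * inU (t i j)))) r s =
  (if s is s'.+1 then cm i j h k r s' else 0) -
  (if r is r'.+1 then cm i j h k r' s else 0).
Proof.
rewrite kapUVE; congr (_ - _).
  by case: s => // s; rewrite !fpsB sgn_coef inU_inV inV_inU.
by case: r => // r; rewrite !fpsB sgn_coef inU_inV inV_inU.
Qed.

Let exchR i j h k r s :
  (sgn (s3 i j h) (thUV A * (inU (t h j) * inV (t i k) - inV (t h j) * inU (t i k)))) r s
  = if r is r'.+1 then if s is s'.+1 then sgn (s3 i j h) (qd i j h k r' s') else 0 else 0.
Proof.
rewrite sgn_coef thUVE; case: r => [|r]; first by rewrite sgn0.
case: s => [|s]; first by rewrite sgn0.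
by rewrite !fpsB inU_inV inV_inU.
Qed.

Lemma yang_relation_exchange : yang_relation ->
  exchange pa (kapUV A) (thUV A) (fun i j => inU (t i j)) (fun i j => inV (t i j)).
Proof.
move=> rel i j h k; apply: funext => r; apply: funext => s; rewrite exch exchR.
have cmE r' s' : cm i j h k r' s' = sgn (s3 i j h) (sm i j h k r' s') by apply: rel.
case: r s => [|r] [|s]; rewrite ?cm0 ?cmr0 ?subrr //.
by rewrite !cmE -sgnB smS.
Qed.

Lemma exchange_yang_relation :
  exchange pa (kapUV A) (thUV A) (fun i j => inU (t i j)) (fun i j => inV (t i j)) ->
  yang_relation.
Proof.
move=> ex i j h k r s; rewrite -/(cm i j h k r s) -[X in sgn _ X]/(sm i j h k r s).
(* The relation at (r + 1, s) follows from that at (r, s + 1), so it spreads along antidiagonals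
   from r = 0, where both sides vanish. *)
elim: r s => [|r IH] s; first by rewrite cm0 /sm min0n big_ord0 sgn0.
have := congr1 (fun z : fps (fps A) => z r.+1 s.+1) (ex i j h k).
rewrite /= exch exchR IH => /eqP; rewrite subr_eq => /eqP->.
by rewrite -sgnD -smS subrK.
Qed.

End Relation.

(** * Spans of words in a family of generators *)

Section WordSpan.
Context (K : fieldType) (A : algType K).

Lemma monomial_cat (J : Type) (g : J -> A) u v :
  monomial g (u ++ v) = monomial g u * monomial g v.
Proof. exact: big_cat. Qed.
Lemma monomial_cons (J : Type) (g : J -> A) x u :
  monomial g (x :: u) = g x * monomial g u.
Proof. exact: big_cons. Qed.
Lemma monomial_nil (J : Type) (g : J -> A) : monomial g [::] = 1.
Proof. exact: big_nil. Qed.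
Lemma monomial1 (J : Type) (g : J -> A) x : monomial g [:: x] = g x.
Proof. exact: big_seq1. Qed.

(** Linear combinations as lists of terms in which words may repeat, so sums and products need no
    normalisation; [lin_spanE] links this to [lin_span]. *)
Inductive wspan (J : Type) (g : J -> A) (P : seq J -> Prop) : A -> Prop :=
| wspan0 : wspan g P 0
| wspan_step c w x : P w -> wspan g P x -> wspan g P (c *: monomial g w + x).

Section Closure.
Context (J : Type) (g : J -> A).
Implicit Types (P Q R : seq J -> Prop) (x y : A).

Lemma wspan_word P w : P w -> wspan g P (monomial g w).
Proof.
by move=> Pw; rewrite -[monomial g w]scale1r -[_ *: _]addr0;
  apply: wspan_step (wspan0 _ _).
Qed.

Lemma wspanD P x y : wspan g P x -> wspan g P y -> wspan g P (x + y).
Proof.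
elim=> [|c w {}x Pw _ IH] Py; first by rewrite add0r.
by rewrite -addrA; apply: wspan_step (IH Py).
Qed.

Lemma wspanZ P c x : wspan g P x -> wspan g P (c *: x).
Proof.
elim=> [|d w {}x Pw _ IH]; first by rewrite scaler0; exact: wspan0.
by rewrite scalerDr scalerA; apply: wspan_step.
Qed.

Lemma wspanN P x : wspan g P x -> wspan g P (- x).
Proof. by rewrite -scaleN1r; exact: wspanZ. Qed.

Lemma wspanB P x y : wspan g P x -> wspan g P y -> wspan g P (x - y).
Proof. by move=> Px /wspanN; exact: wspanD. Qed.

Lemma wspan_sgn P b x : wspan g P x -> wspan g P (sgn b x).
Proof. by case: b => //; exact: wspanN. Qed.

Lemma wspan_sum P I (r : seq I) (S : pred I) (F : I -> A) :
  (forall i, S i -> wspan g P (F i)) -> wspan g P (\sum_(i <- r | S i) F i).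
Proof. by move=> PF; apply: big_ind => //; [exact: wspan0|exact: wspanD]. Qed.

Lemma wspan_subst (J' : Type) (h : J' -> A) (Q : seq J' -> Prop) P x :
  (forall w, Q w -> wspan g P (monomial h w)) -> wspan h Q x -> wspan g P x.
Proof.
move=> QP; elim=> [|c w {}x Qw _ IH]; first exact: wspan0.
by apply: wspanD => //; apply: wspanZ; apply: QP.
Qed.

Lemma wspan_mono P Q x : (forall w, P w -> Q w) -> wspan g P x -> wspan g Q x.
Proof. by move=> PQ; apply: wspan_subst => w /PQ; exact: wspan_word. Qed.

Lemma wspanM P Q R x y : (forall u v, P u -> Q v -> R (u ++ v)) ->
  wspan g P x -> wspan g Q y -> wspan g R (x * y).
Proof.
move=> PQR; elim=> [|c u {}x Pu _ IH] Qy; first by rewrite mul0r; exact: wspan0.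
rewrite mulrDl -scalerAl; apply: wspanD; last exact: IH.
apply: wspanZ; elim: Qy => [|d v {IH}y' Qv _ IH]; first by rewrite mulr0; exact: wspan0.
rewrite mulrDr -scalerAr -monomial_cat; apply: wspan_step => //; exact: PQR.
Qed.

Lemma wspan_eq0 P x : (forall w, ~ P w) -> wspan g P x -> x = 0.
Proof. by move=> nP; case=> // c w y /nP. Qed.

Lemma wspan1 P : P [::] -> wspan g P 1.
Proof. by rewrite -(monomial_nil g); exact: wspan_word. Qed.

End Closure.

Definition weight (J : Type) (wt : J -> nat) (w : seq J) : nat := \sum_(x <- w) wt x.
Definition parity (J : Type) (odd : J -> bool) (w : seq J) : bool :=
  \big[addb/false]_(x <- w) odd x.

Lemma weight_cat (J : Type) (wt : J -> nat) u v :
  weight wt (u ++ v) = (weight wt u + weight wt v)%N.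
Proof. exact: big_cat. Qed.
Lemma weight_cons (J : Type) (wt : J -> nat) x v :
  weight wt (x :: v) = (wt x + weight wt v)%N.
Proof. exact: big_cons. Qed.
Lemma weight_nil (J : Type) (wt : J -> nat) : weight wt [::] = 0%N.
Proof. exact: big_nil. Qed.
Lemma parity_cat (J : Type) (o : J -> bool) u v :
  parity o (u ++ v) = parity o u (+) parity o v.
Proof. exact: big_cat. Qed.
Lemma parity_cons (J : Type) (o : J -> bool) x v :
  parity o (x :: v) = o x (+) parity o v.
Proof. exact: big_cons. Qed.
Lemma parity_nil (J : Type) (o : J -> bool) : parity o [::] = false.
Proof. exact: big_nil. Qed.

Lemma word_subst (J J' : Type) (g : J -> A) (h : J' -> A) wt wt' odd odd' :
  (forall x, wspan g (fun w => (weight wt w <= wt' x)%N /\ parity odd w = odd' x) (h x)) ->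
  forall w', wspan g (fun w => (weight wt w <= weight wt' w')%N /\
                               parity odd w = parity odd' w') (monomial h w').
Proof.
move=> gh; elim=> [|x w' IH].
  by rewrite monomial_nil; apply: wspan1; rewrite !weight_nil !parity_nil.
rewrite monomial_cons; apply: wspanM (gh x) IH => u v [ux uo] [vw vo].
by rewrite !weight_cat !parity_cat weight_cons parity_cons uo vo leq_add.
Qed.

(** * Reordering words modulo smaller weight *)

Section SuperCommutation.
Context (J : Type) (g : J -> A) (wt : J -> nat) (odd : J -> bool).

Definition below (N : nat) : A -> Prop := wspan g (fun w => (weight wt w < N)%N).

Definition almost_supercommutative : Prop := forall x y,
  below (wt x + wt y) (g x * g y - sgn (odd x && odd y) (g y * g x)).

Lemma belowMl N w x : below N x -> below (weight wt w + N) (monomial g w * x).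
Proof.
move=> Nx; apply: wspanM (wspan_word g (erefl w)) Nx => u v <-.
by rewrite weight_cat ltn_add2l.
Qed.

Lemma belowMr N w x : below N x -> below (N + weight wt w) (x * monomial g w).
Proof.
move=> Nx; apply: wspanM Nx (wspan_word g (erefl w)) => u v uN <-.
by rewrite weight_cat ltn_add2r.
Qed.

Hypothesis comm : almost_supercommutative.

Lemma commute_gen_word x w : below (wt x + weight wt w)
  (g x * monomial g w - sgn (odd x && parity odd w) (monomial g w * g x)).
Proof.
elim: w => [|y w IH].
  rewrite monomial_nil parity_nil andbF mulr1 mul1r subrr; exact: wspan0.
rewrite monomial_cons weight_cons parity_cons.
rewrite [X in below _ X](_ : _ =
  (g x * g y - sgn (odd x && odd y) (g y * g x)) * monomial g w +
  sgn (odd x && odd y) (g y *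
   (g x * monomial g w - sgn (odd x && parity odd w) (monomial g w * g x)))).
  apply: wspanD; first by rewrite addnA; apply: belowMr.
  apply: wspan_sgn; rewrite -[g y](monomial1 g) addnCA -[wt y](_ : weight wt [:: y] = _).
    exact: belowMl.
  by rewrite weight_cons weight_nil addn0.
rewrite mulrBl mulrBr sgnB sgnMl sgnMr sgnK !mulrA andb_addr.
by rewrite addrA subrK.
Qed.

Lemma commute_words w w' : below (weight wt w + weight wt w')
  (monomial g w * monomial g w' -
   sgn (parity odd w && parity odd w') (monomial g w' * monomial g w)).
Proof.
elim: w => [|x w IH].
  rewrite monomial_nil parity_nil mulr1 mul1r subrr; exact: wspan0.
rewrite monomial_cons weight_cons parity_cons.
rewrite [X in below _ X](_ : _ =
  g x * (monomial g w * monomial g w' -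
   sgn (parity odd w && parity odd w') (monomial g w' * monomial g w)) +
  sgn (parity odd w && parity odd w') ((g x * monomial g w' -
    sgn (odd x && parity odd w') (monomial g w' * g x)) * monomial g w)).
  apply: wspanD.
    rewrite -[g x](monomial1 g) -addnA -[wt x](_ : weight wt [:: x] = _).
      exact: belowMl.
    by rewrite weight_cons weight_nil addn0.
  by apply: wspan_sgn; rewrite addnAC; apply: belowMr; exact: commute_gen_word.
rewrite mulrBl mulrBr sgnB sgnMl sgnMr sgnK !mulrA andb_addl addbC.
by rewrite addrA subrK.
Qed.

Lemma commute_wspan N N' p p' x y :
    wspan g (fun w => (weight wt w <= N)%N /\ parity odd w = p) x ->
    wspan g (fun w => (weight wt w <= N')%N /\ parity odd w = p') y ->
  below (N + N') (x * y - sgn (p && p') (y * x)).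
Proof.
move=> xN yN'; elim: xN => [|c u {}x [uN up] _ IH].
  by rewrite mul0r mulr0 sgn0 subrr; exact: wspan0.
rewrite mulrDl mulrDr sgnD opprD addrACA; apply: wspanD => {IH} //.
elim: yN' => [|c' v {}y [vN vp] _ IH].
  by rewrite mul0r mulr0 sgn0 subrr; exact: wspan0.
rewrite mulrDl mulrDr sgnD opprD addrACA; apply: wspanD => {IH} //.
rewrite -!scalerAl -!scalerAr !scalerA -up -vp mulrC.
rewrite sgnZ -scalerBr; apply: wspanZ; apply: wspan_mono (commute_words u v) => w lw.
by apply: leq_trans lw _; apply: leq_add.
Qed.

End SuperCommutation.

Section Ordered.
Context (J : choiceType) (g : J -> A) (wt : J -> nat) (odd : pred J).
Hypothesis comm : almost_supercommutative g wt odd.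
Hypothesis two_neq0 : (2%:R : K) != 0.

Lemma permute_word w w' : perm_eq w w' ->
  exists b, below g wt (weight wt w) (monomial g w - sgn b (monomial g w')).
Proof.
elim: w w' => [|x w IH] w'.
  rewrite perm_sym => /perm_nilP ->; exists false.
  by rewrite subrr; exact: wspan0.
move=> ww'; have xw' : x \in w' by rewrite -(perm_mem ww') mem_head.
case/splitPr: xw' ww' => u v; rewrite perm_sym perm_catC /= perm_cons perm_catC.
rewrite perm_sym => ww'; have [b Hb] := IH _ ww'.
exists (b (+) (odd x && parity odd u)).
rewrite monomial_cons monomial_cat monomial_cons weight_cons.
rewrite [X in below _ _ _ X](_ : _ =
  g x * (monomial g w - sgn b (monomial g (u ++ v))) +
  sgn b ((g x * monomial g u - sgn (odd x && parity odd u) (monomial g u * g x))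
    * monomial g v)).
  apply: wspanD.
    rewrite -[g x](monomial1 g) -[wt x](_ : weight wt [:: x] = _).
      exact: belowMl.
    by rewrite weight_cons weight_nil addn0.
  apply: wspan_sgn; have -> : weight wt w = (weight wt u + weight wt v)%N.
    by rewrite -weight_cat /weight (perm_big _ ww').
  by rewrite addnA; apply: belowMr; exact: commute_gen_word.
rewrite monomial_cat mulrBr mulrBl sgnB sgnMl !sgnMr sgnK !mulrA.
by rewrite addrA subrK.
Qed.

Let om (le : rel J) := ordered_monomials odd le.

(** The supercommutator of an odd element with itself is twice its square. *)
Lemma odd_square x : odd x -> below g wt (wt x + wt x) (g x * g x).
Proof.
move=> ox; have := comm x x; rewrite ox /= opprK -mulr2n -scaler_nat.
by move/(wspanZ 2%:R^-1); rewrite scalerA mulVf // scale1r.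
Qed.

Theorem ordered_words_span le w : total_order le -> wspan g (om le) (monomial g w).
Proof.
move=> [le_asym le_tr le_tot].
have [N] := ubnP (weight wt w); elim: N w => // N IH w; rewrite ltnS => wN.
have low x : below g wt (weight wt w) x -> wspan g (om le) x.
  by apply: wspan_subst => u uw; apply: IH; apply: leq_trans uw wN.
have perm w' : perm_eq w w' -> wspan g (om le) (monomial g w') ->
    wspan g (om le) (monomial g w).
  move=> /permute_word[b /low wb] w'b.
  by rewrite -[monomial g w](subrK (sgn b (monomial g w'))); apply: wspanD => //;
    apply: wspan_sgn.
(* A repeated odd letter is brought next to its copy, modulo lower terms, and the square then lowers
   the weight. Otherwise sorting the word suffices. *)
have [/hasP[x xw /andP[ox x2]]|/hasPn nodup] :=
    boolP (has (fun x => odd x && (1 < count_mem x w)%N) w).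
  have [w' ww'] : exists w', perm_eq w [:: x, x & w'].
    have pw := perm_to_rem xw.
    have xw' : x \in rem x w.
      rewrite -has_pred1 has_count; have := permP pw (pred1 x).
      by rewrite /= eqxx => cE; move: x2; rewrite cE add1n ltnS.
    exists (rem x (rem x w)); apply: perm_trans pw _.
    by rewrite perm_cons perm_to_rem.
  apply: (perm _ ww'); apply: low; rewrite !monomial_cons mulrA.
  have -> : weight wt w = (wt x + wt x + weight wt w')%N.
    by rewrite /weight (perm_big _ ww') /= !big_cons addnA.
  by apply: belowMr; exact: odd_square.
have sw : perm_eq w (sort le w) by rewrite perm_sym perm_sort.
apply: (perm _ sw); apply: wspan_word; split; first exact: sort_sorted.
move=> x ox; rewrite -(permP sw); have [xw|] := boolP (x \in w).
  by have := nodup x xw; rewrite ox /= -leqNgt.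
by rewrite -has_pred1 has_count -leqNgt leqn0 => /eqP->.
Qed.

End Ordered.

Lemma lin_spanE (J : choiceType) (g : J -> A) (P : set (seq J)) x :
  wspan g P x <-> lin_span P (monomial g) x.
Proof.
split=> [|[s [c [sP ->]]]]; last first.
  elim: s sP => [|w s IH] sP; first by rewrite big_nil; exact: wspan0.
  rewrite big_cons; apply: wspan_step; first by apply: sP; rewrite /= mem_head.
  by apply: IH => v vs; apply: sP; rewrite /= inE vs orbT.
(* In [lin_span] the coefficient is a function of the word, so repeated words must be merged; this
   is why the list is built duplicate-free. *)
suff: wspan g P x -> exists s (c : seq J -> K), [/\ uniq s,
    forall w, w \in s -> P w & x = \sum_(w <- s) c w *: monomial g w].
  by move=> /[apply] -[s [c [_ sP ->]]]; exists s, c.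
elim=> [|a w {}x Pw _ [s [c [us sP ->]]]].
  by exists [::], (fun=> 0); rewrite big_nil.
have [ws|ws] := boolP (w \in s).
  exists s, (fun v => (if v == w then a else 0) + c v); split=> //.
  rewrite [RHS](eq_bigr (fun v => (if v == w then a *: monomial g v else 0) +
    c v *: monomial g v)); last first.
    by move=> v _; rewrite scalerDl; case: eqP => // _; rewrite scale0r.
  rewrite big_split /=; congr (_ + _); rewrite (bigD1_seq w) //= eqxx big1 ?addr0 //.
  by move=> v /negbTE->.
exists (w :: s), (fun v => if v == w then a else c v); split.
- by rewrite /= ws.
- by move=> v; rewrite inE => /predU1P[->|/sP].
rewrite big_cons eqxx; congr (_ + _); apply: eq_big_seq => v vs.
by case: eqP ws vs => // -> /negP.
Qed.

End WordSpan.

(** * Homomorphisms out of the super Yangian *)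

Section FreeLift.
Context (K : fieldType) (G : choiceType) (B : pzRingType).
Context (f : {rmorphism K -> B}) (tau : G -> B).
Hypothesis fC : forall c z, f c * z = z * f c.

(** The target is a ring with a central morphism from K instead of a K-algebra, so that matrices
    over [{poly A}] are allowed. *)
Definition free_lift (x : free_alg K G) : B :=
  \sum_(k <- msupp x) f (mcoeff k x) * \prod_(g <- (k : seq G)) tau g.

Let free_liftEw (d : {fset {fmonom G}}) (x : free_alg K G) :
  (msupp x `<=` d)%fset ->
  free_lift x = \sum_(k <- d) f (mcoeff k x) * \prod_(g <- (k : seq G)) tau g.
Proof.
move=> le; rewrite /free_lift [LHS](big_fset_incl _ le) => //= k _ /mcoeff_outdom ->.
by rewrite rmorph0 mul0r.
Qed.

Lemma free_lift_zmod : zmod_morphism free_lift.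
Proof.
move=> x y; pose d := (msupp x `|` msupp y `|` msupp (x - y))%fset.
have dx : (msupp x `<=` d)%fset by apply/fsubsetP => k kx; rewrite !in_fsetU kx.
have dy : (msupp y `<=` d)%fset by apply/fsubsetP => k kx; rewrite !in_fsetU kx orbT.
have dxy : (msupp (x - y) `<=` d)%fset.
  by apply/fsubsetP => k kx; rewrite in_fsetU kx orbT.
rewrite (free_liftEw dx) (free_liftEw dy) (free_liftEw dxy).
rewrite -sumrB; apply: eq_bigr => k _.
by rewrite mcoeffB rmorphB mulrBl.
Qed.
HB.instance Definition _ :=
  GRing.isZmodMorphism.Build (free_alg K G) B free_lift free_lift_zmod.

Lemma free_liftU c (k : {fmonom G}) :
  free_lift << c *g k >> = f c * \prod_(g <- (k : seq G)) tau g.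
Proof. by rewrite (@free_liftEw [fset k]%fset) ?msuppU_le // big_seq_fset1 mcoeffUU. Qed.

Lemma free_lift_monoid : monoid_morphism free_lift.
Proof.
split.
  have -> : (1 : free_alg K G) = << (1 : K) *g (mone : {fmonom G}) >> by [].
  by rewrite free_liftU rmorph1 fm1 big_nil mul1r.
move=> x y; have -> : x * y = (x : {malg K[{fmonom G}]}) * y by [].
rewrite malgME raddf_sum mulr_suml.
apply: eq_bigr => k _; rewrite raddf_sum mulr_sumr.
apply: eq_bigr => l _; rewrite /= free_liftU rmorphM.
have -> : mmul k l = k ++ l :> seq G by rewrite fmM.
by rewrite big_cat /= -!mulrA; congr (_ * _); rewrite !mulrA fC.
Qed.
Definition free_lift_rmorphism : {rmorphism free_alg K G -> B} :=
  HB.pack_for {rmorphism free_alg K G -> B} free_lift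
    (GRing.isZmodMorphism.Build _ _ _ free_lift_zmod)
    (GRing.isMonoidMorphism.Build _ _ _ free_lift_monoid).

Lemma free_lift_gen g : free_lift (free_gen K g) = tau g.
Proof. by rewrite free_liftU rmorph1 mul1r fmU big_seq1. Qed.

Lemma free_liftZ c x : free_lift (c *: x) = f c * free_lift x.
Proof.
have -> : c *: x = c *: 1 * x by rewrite -scalerAl mul1r.
rewrite free_lift_monoid.2 /=; congr (_ * _).
have -> : c *: (1 : free_alg K G) = << c *g (mone : {fmonom G}) >>.
  by rewrite [LHS]malgZ_def /fgscale msuppU1 big_seq_fset1 mcoeffUU mulr1.
by rewrite free_liftU fm1 big_nil mulr1.
Qed.

End FreeLift.

Lemma free_alg_span (K : fieldType) (G : choiceType) (x : free_alg K G) :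
  wspan (@free_gen K G) (fun=> True) x.
Proof.
rewrite [x]monalgE; apply: wspan_sum => k _.
have -> : << mcoeff k x *g k >> = mcoeff k x *: monomial (@free_gen K G) k.
  have -> : monomial (@free_gen K G) k = << k >>.
    case: k => k; elim: k => [|g k IH].
      by rewrite monomial_nil; congr << _ >>; apply/eqP; rewrite fmP fm1.
    rewrite monomial_cons IH /free_gen malgM_def fgmulUU mulr1; congr << _ >>.
    by apply/eqP; rewrite fmP fmM fmU.
  by rewrite malgZ_def /fgscale msuppU1 big_seq_fset1 mcoeffUU mulr1.
by apply: wspanZ; exact: wspan_word.
Qed.

Section YangianLift.
Context (K : fieldType) (M N : nat).
Local Notation Y := (superYangian K M N).
Local Notation I := 'I_(M + N).

Definition odd_idx (i : I) : bool := (M <= i)%N.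

Lemma yang_relatorE (A : pzRingType) (t : I -> I -> nat -> A) i j h k r s :
  yang_relator t i j h k r s =
  t i j r * t h k s - sgn ((odd_idx i (+) odd_idx j) && (odd_idx h (+) odd_idx k))
    (t h k s * t i j r) -
  sgn ((odd_idx i && odd_idx j) (+) (odd_idx i && odd_idx h) (+)
       (odd_idx j && odd_idx h))
    (\sum_(l < minn r s)
      (t h j l * t i k (r + s - 1 - l)%N - t h j (r + s - 1 - l)%N * t i k l)).
Proof.
rewrite /yang_relator /supercomm !sgnE -signr_odd oddM !oddD.
rewrite -[X in _ - X * \sum_(l < _) _]signr_odd !oddD !oddM /par.
by rewrite !oddb.
Qed.

Lemma yang_relator_morph (A A' : pzRingType) (phi : {rmorphism A -> A'})
    (t : I -> I -> nat -> A) i j h k r s :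
  phi (yang_relator t i j h k r s) =
  yang_relator (fun i j r => phi (t i j r)) i j h k r s.
Proof.
rewrite !yang_relatorE !rmorphB !rmorphM; congr (_ - _ - _).
  by rewrite !sgnE !rmorphM rmorphXn rmorphN1.
rewrite !sgnE rmorphM rmorphXn rmorphN1 rmorph_sum; congr (_ * _).
by apply: eq_bigr => l _; rewrite rmorphB !rmorphM.
Qed.

Lemma yang_t0 (i j : I) : yang_t K i j 0 = (i == j)%:R.
Proof. by rewrite /yang_t /= rmorph_nat. Qed.

(** The presentation imposes the relations for r, s > 0 only. If r or s is 0, the sum is empty and a
    Kronecker delta supercommutes with everything. *)
Lemma yang_t_relation :
  yang_relation odd_idx (fun i j => yang_t K i j : fps Y).
Proof.
move=> i j h k r s; apply/eqP; rewrite -subr_eq0; apply/eqP.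
case: r s => [|r] [|s]; last first.
- rewrite -yang_relatorE -(yang_relator_morph (@yang_pi K M N)).
  rewrite -yang_pi0; apply/yang_piE; rewrite subr0; apply/asboolP => S [_ Srel].
  by apply: Srel; exists i, j, h, k, r.+1, s.+1.
all: rewrite ?min0n ?minn0 big_ord0 sgn0 subr0 ?yang_t0.
- exact: supercomm_deltar.
- exact: supercomm_deltal.
- exact: supercomm_deltal.
Qed.

Lemma yang_span (y : Y) :
  wspan (fun g : yang_gen M N => yang_t K g.1.1 g.1.2 g.2.+1) (fun=> True) y.
Proof.
have [x ->] := yang_piP y; elim: (free_alg_span x) => [|c w {}x _ _ IH].
  by rewrite yang_pi0; exact: wspan0.
rewrite yang_piD.
have -> : yang_pi (c *: monomial (free_gen K (G := yang_gen M N)) w) =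
    c *: monomial (fun g : yang_gen M N => yang_t K g.1.1 g.1.2 g.2.+1) w.
  rewrite [LHS]yang_piZ; congr yang_scale.
  elim: w => [|[[i j] r] w IHw]; first by rewrite !monomial_nil.
  by rewrite !monomial_cons [LHS]yang_piM IHw.
exact: wspan_step.
Qed.

Context (B : pzRingType) (f : {rmorphism K -> B}) (t' : I -> I -> fps B).
Hypotheses (fC : forall c z, f c * z = z * f c).
Hypotheses (t'0 : forall i j, t' i j 0%N = (i == j)%:R).
Hypotheses (t'rel : yang_relation odd_idx t').

Let tau (g : yang_gen M N) : B := t' g.1.1 g.1.2 g.2.+1.
Let phi : {rmorphism free_alg K (yang_gen M N) -> B} := free_lift_rmorphism tau fC.

Let phi_t i j r : phi (free_t K i j r) = t' i j r.
Proof.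
case: r => [|r]; first by rewrite t'0; exact: (rmorph_nat phi).
by rewrite /= free_lift_gen.
Qed.

Let phi_ideal x : x \in yang_ideal (K := K) (M := M) (N := N) -> phi x = 0.
Proof.
move: phi phi_t => psi psi_t.
move=> /asboolP /(_ [set y | psi y = 0]%classic); apply; split.
  split=> /= [|x' y hx hy|a y hy|a y hy].
  - exact: rmorph0.
  - by rewrite rmorphB hx hy subr0.
  - by rewrite rmorphM hy mulr0.
  - by rewrite rmorphM hy mul0r.
move=> _ [i [j [h [k [r [s [r0 s0 ->]]]]]]] /=.
rewrite yang_relator_morph yang_relatorE /=; apply/eqP; rewrite subr_eq0 !psi_t.
by apply/eqP; rewrite t'rel; congr (sgn _ _); apply: eq_bigr => l _; rewrite !psi_t.
Qed.

Let Phi (y : Y) : B := phi (repr y : free_alg K (yang_gen M N)).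

Let Phi_pi x : Phi (yang_pi x) = phi x.
Proof.
apply/eqP; rewrite -subr_eq0 -rmorphB; apply/eqP/phi_ideal/yang_piE.
exact: yang_pi_repr.
Qed.

Let Phi_zmod : zmod_morphism Phi.
Proof.
move=> x y; have [x' ->] := yang_piP x; have [y' ->] := yang_piP y.
by rewrite -(raddfB (@yang_pi K M N)) !Phi_pi; exact: (rmorphB phi).
Qed.

Let Phi_monoid : monoid_morphism Phi.
Proof.
split=> [|x y]; first by rewrite [LHS]Phi_pi; exact: (rmorph1 phi).
have [x' ->] := yang_piP x; have [y' ->] := yang_piP y.
by rewrite -[_ * _]/(yang_mul (yang_pi x') (yang_pi y')) -yang_piM !Phi_pi; exact: (rmorphM phi).
Qed.

Lemma yang_lift : exists Psi : {rmorphism Y -> B},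
  (forall c y, Psi (c *: y) = f c * Psi y) /\
  (forall i j r, Psi (yang_t K i j r) = t' i j r).
Proof.
pose Psi : {rmorphism Y -> B} := HB.pack_for {rmorphism Y -> B} Phi
    (GRing.isZmodMorphism.Build _ _ _ Phi_zmod)
    (GRing.isMonoidMorphism.Build _ _ _ Phi_monoid).
exists Psi; split=> [c y|i j r].
  have [x ->] := yang_piP y; rewrite -[Psi _]/(Phi (yang_scale c (yang_pi x))).
  rewrite -yang_piZ -[Psi _]/(Phi _) !Phi_pi.
  exact: free_liftZ.
by rewrite -[LHS]/(Phi (yang_pi _)) Phi_pi phi_t.
Qed.

End YangianLift.

(** * The coproduct with values in matrices *)

Section MatrixCoproduct.
Context (A : nzRingType) (n : nat) (pa : 'I_n -> bool) (t : 'I_n -> 'I_n -> fps A).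
Hypothesis t0 : forall i j, t i j 0%N = (i == j)%:R.
Hypothesis t_rel : yang_relation pa t.
Local Notation C := 'M[{poly A}]_n.
Local Notation s4 i j h k := ((pa i (+) pa j) && (pa h (+) pa k)).
Local Notation s3 i j h := ((pa i && pa j) (+) (pa i && pa h) (+) (pa j && pa h)).

(* The signs make [tw b y] supercommute with [ee i j] for y of parity b, so that
   ordinary matrix products compute in the graded tensor product. *)
Definition tw (b : bool) (y : A) : C :=
  diag_mx (\row_p (sgn (pa p && b) y)%:P).
Definition ee (i j : 'I_n) : C := sgn (pa i) (delta_mx i j).
Definition tt (i j : 'I_n) : fps C := fun r => tw (pa i (+) pa j) (t i j r).
Definition ll (i j : 'I_n) : fps C :=
  fun r => if r is r'.+1 then 'X^r' *: ee i j else (i == j)%:R.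

Lemma twE b y p q : tw b y p q = if p == q then (sgn (pa p && b) y)%:P else 0.
Proof. by rewrite !mxE; case: eqP => [->|]. Qed.

Lemma twM b c y z : tw b y * tw c z = tw (b (+) c) (y * z).
Proof.
apply/matrixP => p q; rewrite [_ * _]mulmx_diag twE !mxE; case: eqP => // _.
by rewrite mulr1n -polyCM sgnMl sgnMr sgnK andb_addr.
Qed.

Lemma tw1 : tw false 1 = 1.
Proof.
by apply/matrixP => p q; rewrite twE mxE andbF; case: eqP.
Qed.

Lemma twB b y z : tw b (y - z) = tw b y - tw b z.
Proof.
apply/matrixP => p q; rewrite !mxE -mulrnBl; congr (_ *+ _).
by rewrite sgnB polyCB.
Qed.

Lemma tw_sum b I (r : seq I) (P : pred I) (F : I -> A) :
  tw b (\sum_(i <- r | P i) F i) = \sum_(i <- r | P i) tw b (F i).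
Proof.
apply: (big_morph (tw b)) => [y z|]; last first.
  by apply/matrixP => p q; rewrite !mxE sgn0 polyC0 mul0rn.
by apply/matrixP => p q; rewrite !mxE -mulrnDl sgnD polyCD.
Qed.

Lemma tw_sgn b c y : tw b (sgn c y) = sgn c (tw b y).
Proof.
apply/matrixP => p q; rewrite twE [RHS](_ : _ = sgn c (tw b y p q)); last first.
  by case: c; rewrite /= ?mxE.
by rewrite twE; case: eqP => _; [case: c; rewrite //= ?sgnN ?polyCN|case: c; rewrite //= oppr0].
Qed.

Lemma tt_rel : yang_relation pa tt.
Proof.
move=> i j h k r s; rewrite /tt !twM -tw_sgn.
rewrite [(pa h (+) pa k) (+) _]addbC -twB t_rel tw_sgn tw_sum.
congr (sgn _ _); apply: eq_bigr => l _.
rewrite !twM twB; congr (tw _ _ - tw _ _);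
by move: (pa i) (pa j) (pa h) (pa k) => [] [] [] [].
Qed.

Lemma sgn_mxZ b c (z : C) : sgn b (c *: z) = c *: sgn b z.
Proof. by case: b; rewrite //= scalerN. Qed.

Lemma eeM i j h k : ee i j * ee h k = sgn (pa h) ((j == h)%:R *: ee i k).
Proof.
rewrite /ee sgnMl sgnMr [_ * _]mul_delta_mx_cond.
rewrite -scaler_nat !sgn_mxZ; congr (_ *: _).
by move: (pa i) (pa h) => [] [].
Qed.

Lemma scaleXAr m (x y : C) : x * ('X^m *: y) = 'X^m *: (x * y).
Proof.
apply/matrixP => p q; rewrite !mxE mulr_sumr; apply: eq_bigr => l _.
by rewrite !mxE !mulrA -commr_polyXn.
Qed.

Lemma scaleXAl m (x y : C) : ('X^m *: x) * y = 'X^m *: (x * y).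
Proof. exact: esym (scalemxAl _ _ _). Qed.

Lemma scaleXM r s (x y : C) : ('X^r *: x) * ('X^s *: y) = 'X^(r + s) *: (x * y).
Proof. by rewrite scaleXAr scaleXAl scalerA -exprD addnC. Qed.

Lemma ll_rel : yang_relation pa ll.
Proof.
move=> i j h k [|r] s; first by rewrite min0n big_ord0 sgn0 supercomm_deltal.
case: s => [|s]; first by rewrite minn0 big_ord0 sgn0 supercomm_deltar.
(* For l > 0 both products consist of the same matrix units and the same power of ['X]; only l = 0
   contributes. *)
rewrite minnSS big_ord_recl [X in _ = sgn _ (_ + X)]big1 => [|l _]; last first.
  have := ltn_ord l; rewrite leq_min => /andP[lr ls].
  have -> : (r.+1 + s.+1 - 1 - bump 0 l = (r + s - l).-1.+1)%N.
    rewrite prednK ?subn_gt0 ?(leq_trans lr) ?leq_addr //.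
    by rewrite /bump add1n; lia.
  by rewrite /= !scaleXM addnC subrr.
rewrite addr0 subn0 addSn addnS subn1 /= !scaleXM addnC !eeM.
rewrite [h == j]eq_sym [i == k]eq_sym.
have c1 (z : C) : 1 * z = z * 1 by rewrite mul1r mulr1.
case: (eqVneq j h) => [->|_]; case: (eqVneq k i) => [->|_];
  rewrite ?(scale1r, scale0r, sgn0, scaler0) -?sgn_mxZ;
  by move: (pa i) (pa j) (pa h) (pa k) => [] [] [] [] /=; nc c1 c1.
Qed.

Lemma ee_tw b y i j : ee i j * tw b y = sgn (b && (pa i (+) pa j)) (tw b y * ee i j).
Proof.
rewrite /ee sgnMl sgnMr [delta_mx i j * _]mul_mx_diag [tw b y * _]mul_diag_mx.
apply/matrixP => p q; rewrite [RHS](_ : _ = sgn (b && (pa i (+) pa j)) (sgn (pa i)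
   ((sgn (pa p && b) y)%:P * (delta_mx i j p q)))); last first.
  by case: (_ && _); case: (pa i); rewrite /= ?mxE ?opprK.
rewrite [LHS](_ : _ = sgn (pa i) (delta_mx i j p q * (sgn (pa q && b) y)%:P)); last first.
  by case: (pa i); rewrite /= ?mxE.
rewrite mxE; case: eqP => [->|_] /=; last by rewrite mul0r mulr0 !sgn0.
case: eqP => [->|_] /=; last by rewrite mul0r mulr0 !sgn0.
rewrite mul1r mulr1 sgnK; case: (b); rewrite ?andbF ?addFb // !andbT.
by move: (pa i) (pa j) => [] [] /=; rewrite ?polyCN ?opprK.
Qed.

Lemma ll_tt i j h k r s :
  ll h k r * tt i j s = sgn (s4 h k i j) (tt i j s * ll h k r).
Proof.
case: r => [|r] /=.
  by apply/eqP; rewrite -subr_eq0 supercomm_deltal.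
by rewrite scaleXAl ee_tw scaleXAr sgn_mxZ andbC.
Qed.

Definition tpl (i j : 'I_n) : fps C := fmul tt ll i j.

Lemma tpl0 i j : tpl i j 0%N = (i == j)%:R.
Proof.
rewrite /tpl /fmul fps_sum (bigD1 i) //= fpsM0 /tt t0 addbb eqxx tw1 mul1r.
rewrite big1 ?addr0 // => p pi; rewrite fpsM0 /tt t0 eq_sym (negbTE pi).
suff -> : tw (pa i (+) pa p) 0 = 0 by rewrite mul0r.
by apply/matrixP => a b; rewrite twE sgn0 polyC0 mxE; case: eqP.
Qed.

Lemma inU_fmul (D : pzRingType) (a b : 'I_n -> 'I_n -> fps D) i j :
  inU (fmul a b i j) = fmul (fun i j => inU (a i j)) (fun i j => inU (b i j)) i j.
Proof.
by rewrite inU_sum; apply: eq_bigr => p _; rewrite inUM.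
Qed.

Lemma inV_fmul (D : pzRingType) (a b : 'I_n -> 'I_n -> fps D) i j :
  inV (fmul a b i j) = fmul (fun i j => inV (a i j)) (fun i j => inV (b i j)) i j.
Proof. by rewrite /inV /fmul rmorph_sum; apply: eq_bigr => p _; rewrite rmorphM. Qed.

Lemma tpl_rel : yang_relation pa tpl.
Proof.
apply: exchange_yang_relation tpl0 _.
have tt0 i j : tt i j 0%N = (i == j)%:R.
  rewrite /tt t0; case: eqP => [->|_]; first by rewrite addbb tw1.
  by apply/matrixP => a b; rewrite twE sgn0 polyC0 mxE; case: eqP.
have ext := exchange_fmul (kapUV_comm (A := C)) (thUV_comm (A := C))
  (yang_relation_exchange tt0 tt_rel) (yang_relation_exchange (fun _ _ => erefl) ll_rel).
move=> i j h k; rewrite !inU_fmul !inV_fmul; apply: ext => {i j h k} i j h k.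
  apply: funext => r; apply: funext => s.
  by rewrite sgn_coef inU_inV inV_inU ll_tt.
apply: funext => r; apply: funext => s.
by rewrite sgn_coef inU_inV inV_inU ll_tt.
Qed.

End MatrixCoproduct.

(** * Linear independence of ordered monomials *)

(** Stated for a family with any index set ['I_n], so that it can be transported along the equality
    of M + N with the sum of the parts. *)
Definition universal_solution (K : fieldType) (A : algType K) (n : nat)
    (pa : 'I_n -> bool) (t : 'I_n -> 'I_n -> fps A) : Prop :=
  forall (B : pzRingType) (f : {rmorphism K -> B}) (t' : 'I_n -> 'I_n -> fps B),
    (forall c z, f c * z = z * f c) ->
    (forall i j, t' i j 0%N = (i == j)%:R) -> yang_relation pa t' ->
  exists Psi : {rmorphism A -> B},
    (forall c y, Psi (c *: y) = f c * Psi y) /\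
    (forall i j r, Psi (t i j r) = t' i j r).

Section Independence.
Context (K : fieldType) (A : algType K) (n : nat) (pa : 'I_n -> bool).
Context (t : 'I_n -> 'I_n -> fps A).
Hypothesis t0 : forall i j, t i j 0%N = (i == j)%:R.
Hypothesis t_rel : yang_relation pa t.
Local Notation C := 'M[{poly A}]_n.
Local Notation G := ('I_n * 'I_n * nat)%type.

Definition gen (x : G) : A := t x.1.1 x.1.2 x.2.+1.
Definition godd (x : G) : bool := pa x.1.1 (+) pa x.1.2.
(** The index r stands for the superscript r + 1, so the degree is the superscript minus one. *)
Definition gdeg (x : G) : nat := x.2.

Local Notation deg := (weight gdeg).
Local Notation par := (parity godd).

(* Independence is tested on the words of largest degree and, among these, on the
   longest ones; the other words are collected in [lower]. *)
Definition lower (p l : nat) (w : seq G) : Prop :=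
  (deg w < p)%N \/ deg w = p /\ (size w < l)%N.

(** [lower] for matrices of polynomials: the variable ['X] counts 1 in the degree and 0 in the
    length. *)
Definition clower (p l : nat) (X : C) : Prop := forall i j d,
  wspan gen (fun w => (deg w + d < p)%N \/ ((deg w + d)%N = p /\ (size w < l)%N)) (X i j)`_d.

Lemma clowerD p l X Y : clower p l X -> clower p l Y -> clower p l (X + Y).
Proof. by move=> hX hY i j d; rewrite mxE coefD; apply: wspanD. Qed.

Lemma clower_sum p l I (r : seq I) (P : pred I) (F : I -> C) :
  (forall i, P i -> clower p l (F i)) -> clower p l (\sum_(i <- r | P i) F i).
Proof.
move=> PF; apply: big_ind => // [i j d|X Y]; last exact: clowerD.
by rewrite mxE coef0; exact: wspan0.
Qed.

Lemma clowerW p l l' X : (l <= l')%N -> clower p l X -> clower p l' X.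
Proof.
move=> ll' hX i j d; apply: wspan_mono (hX i j d) => w [|[<- wl]]; [by left|right].
by split=> //; apply: leq_trans wl ll'.
Qed.

(** Both length bounds are strict, so in top degree the lengths add up to at most l + l' - 2. *)
Lemma clowerM p l p' l' X Y : clower p l X -> clower p' l' Y ->
  clower (p + p') (l + l').-1 (X * Y).
Proof.
move=> hX hY i j d; rewrite mxE coef_sum; apply: wspan_sum => k _.
rewrite coefM; apply: wspan_sum => m _.
apply: wspanM (hX i k m) (hY k j (d - m)%N) => u v.
rewrite weight_cat size_cat; have := ltn_ord m; rewrite ltnS; move: (nat_of_ord m) => {}m.
by move: (deg u) (deg v) => du dv; lia.
Qed.

Variable Psi : {rmorphism A -> C}.
Hypothesis PsiZ : forall c y, Psi (c *: y) = (c%:A)%:P%:M * Psi y.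
Hypothesis Psi_t : forall i j r, Psi (t i j r) = tpl pa t i j r.

Let TT (x : G) : C := tw pa (godd x) (gen x).
Let EE (x : G) : C := 'X^(x.2) *: ee A pa x.1.1 x.1.2.

Let TT_lower x : clower x.2 2 (TT x).
Proof.
move=> i j d; rewrite twE; case: eqP => _; last by rewrite coef0; exact: wspan0.
rewrite coefC; case: eqP => [->|_]; last exact: wspan0.
rewrite -(monomial1 gen); apply/wspan_sgn/wspan_word; right.
by split=> //=; rewrite addn0 weight_cons weight_nil addn0.
Qed.

Let ee_coef i j p q (m d : nat) : (('X^m *: ee A pa i j) p q)`_d =
  if (d == m) && (p == i) && (q == j) then sgn (pa i) 1 else 0.
Proof.
rewrite mxE [ee A pa i j p q](_ : _ = sgn (pa i) ((p == i) && (q == j))%:R); last first.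
  by rewrite /ee; case: (pa i); rewrite /= !mxE.
case: (p =P i) => _; last by rewrite ?andbF /= mulr0n sgn0 mulr0 coef0.
case: (q =P j) => _; last by rewrite ?andbF /= mulr0n sgn0 mulr0 coef0.
rewrite !andbT; case: (pa i); rewrite /= ?mulrN1 ?mulr1 ?coefN coefXn;
  by case: eqP => //=; rewrite oppr0.
Qed.

Let EE_lower x : clower x.2 1 (EE x).
Proof.
move=> i j d; rewrite ee_coef; case: ifP => [/andP[/andP[/eqP-> _] _]|_]; last exact: wspan0.
apply: wspan_sgn; apply: wspan1; by right; rewrite weight_nil add0n.
Qed.

(** The other terms of the matrix product pair t^(b+1) with the matrix unit solution at superscript
    m + 1, where b + m + 1 is the degree of x. Their degree is b + m, one too small. *)
Let SS_lower x : clower x.2 0 (Psi (gen x) - TT x - EE x).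
Proof.
rewrite /gen Psi_t /tpl /fmul fps_sum.
have -> : \sum_p (tt pa t x.1.1 p * ll A pa p x.1.2) x.2.+1 =
   TT x + EE x + \sum_p \sum_(b < x.2) tt pa t x.1.1 p b.+1 * ll A pa p x.1.2 (x.2 - b)%N.
  under eq_bigr do rewrite fpsM big_ord_recr big_ord_recl /= subnn ?subn0.
  rewrite !big_split /= addrC -addrA; congr (_ + _).
    rewrite (bigD1 x.1.2) //= eqxx mulr1 big1 ?addr0 // => p /negbTE->.
    by rewrite mulr0.
  congr (_ + _).
    rewrite (bigD1 x.1.1) //= {1}/tt t0 addbb eqxx tw1 mul1r big1 ?addr0 // => p px.
    rewrite /tt t0 eq_sym (negbTE px) (_ : tw _ _ 0 = 0) ?mul0r //.
    by apply/matrixP => a b; rewrite twE sgn0 polyC0 mxE; case: eqP.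
have canc (a b c : C) : a + b + c - a - b = c.
  by rewrite -(addrA a b c) [a + _]addrC addrK [b + c]addrC addrK.
rewrite {}canc.
apply: clower_sum => p _; apply: clower_sum => b _; have bx := ltn_ord b.
move: (nat_of_ord b) bx => {}b bx.
have [m ->] : exists m, x.2 = (b + m.+1)%N.
  by exists (x.2 - b.+1)%N; rewrite -addSnnS subnKC.
rewrite addKn => i j d.
rewrite mxE coef_sum; apply: wspan_sum => q _.
rewrite /tt twE; case: eqP => _; last by rewrite mul0r coef0; exact: wspan0.
rewrite coefCM /ll ee_coef; case: ifP => [/andP[/andP[/eqP-> _] _]|_]; last first.
  by rewrite mulr0; exact: wspan0.
rewrite sgnMr mulr1; apply/wspan_sgn/wspan_sgn.
rewrite -[t _ _ _]/(gen (x.1.1, p, b)) -(monomial1 gen); apply: wspan_word; left.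
by rewrite weight_cons weight_nil /= /gdeg /= addn0 ltn_add2l.
Qed.

Let TW w : C := tw pa (par w) (monomial gen w).

Let TW_cons x w : TW (x :: w) = TT x * TW w.
Proof. by rewrite /TT /TW parity_cons monomial_cons twM. Qed.

Let TW_lower w : clower (deg w) (size w).+1 (TW w).
Proof.
elim: w => [|x w IH] /=; last first.
  by rewrite TW_cons weight_cons; apply: clowerM (TT_lower x) IH.
move=> i j d; rewrite /TW monomial_nil parity_nil tw1 mxE.
case: eqP => _; last by rewrite coef0; exact: wspan0.
rewrite coef1; case: eqP => [->|_]; last exact: wspan0.
by apply: wspan1; right; rewrite weight_nil.
Qed.

Let Psi_lower w : clower (deg w) (size w).+1 (Psi (monomial gen w)).
Proof.
elim: w => [|x w IH].
  by have := TW_lower [::]; rewrite /TW parity_nil monomial_nil tw1 rmorph1.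
rewrite monomial_cons rmorphM weight_cons.
have gL : clower x.2 2 (Psi (gen x)).
  rewrite -[Psi (gen x)](subrK (TT x)) -[X in X + _](subrK (EE x)).
  apply: clowerD (TT_lower x); apply: clowerD; first exact: clowerW (SS_lower x).
  exact: clowerW (EE_lower x).
exact: clowerM gL IH.
Qed.

(* The terms of [Psi w] in which exactly one letter x contributes [EE x] instead
   of [TT x]. *)
Fixpoint first_order w : C :=
  if w is x :: w' then EE x * TW w' + TT x * first_order w' else 0.
Local Notation RR := first_order.

Let RR_lower w : clower (deg w) (size w) (RR w).
Proof.
elim: w => [|x w IH] /=; first by move=> i j d; rewrite mxE coef0; exact: wspan0.
rewrite weight_cons; apply: clowerD; first exact: clowerM (EE_lower x) (TW_lower w).
exact: clowerM (TT_lower x) IH.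
Qed.

(** Expanding the product of the sums TT + EE + rest over the letters: a second factor EE removes a
    second letter, and any rest lowers the degree. *)
Let Psi_word w :
  clower (deg w) (size w).-1 (Psi (monomial gen w) - TW w - RR w).
Proof.
have TW0 : TW [::] = 1 by rewrite /TW parity_nil monomial_nil tw1.
elim: w => [|x [_|y w IH]].
- rewrite monomial_nil rmorph1 TW0 subrr subr0.
  by move=> i j d; rewrite mxE coef0; exact: wspan0.
- rewrite monomial1 TW_cons /= TW0 mulr0 !mulr1 addr0 weight_cons weight_nil addn0.
  exact: SS_lower.
set v := y :: w in IH *.
rewrite (_ : RR (x :: v) = EE x * TW v + TT x * RR v) // TW_cons monomial_cons.
rewrite rmorphM weight_cons.
set S := Psi (gen x) - TT x - EE x; set Q := Psi (monomial gen v) - TW v - RR v in IH.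
have -> : Psi (gen x) * Psi (monomial gen v) - TT x * TW v - (EE x * TW v + TT x * RR v) =
    S * Psi (monomial gen v) + (EE x * RR v + EE x * Q) + TT x * Q.
  have c1 (z : C) : 1 * z = z * 1 by rewrite mul1r mulr1.
  by rewrite /S /Q; nc c1 c1.
have SS := SS_lower x; have EL := EE_lower x; have TL := TT_lower x.
have RL := RR_lower v.
apply: clowerD; last exact: clowerM TL IH.
apply: clowerD; first exact: clowerM SS (Psi_lower v).
apply: clowerD; first exact: clowerM EL RL.
by apply: clowerW (clowerM EL IH); rewrite /= leqnSn.
Qed.

Let rho (x : G) w := (RR w x.1.1 x.1.2)`_(x.2).

Let rho_cons x y w : rho x (y :: w) =
  (if y == x then sgn (pa x.1.1) (sgn (pa x.1.2 && par w) (monomial gen w)) else 0) +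
  sgn (pa x.1.1 && godd y) (gen y * rho x w).
Proof.
rewrite /rho /= mxE coefD; congr (_ + _).
  rewrite mxE coef_sum (bigD1 x.1.2) //= big1 ?addr0 => [|k kx]; last first.
    by rewrite /TW twE (negbTE kx) mulr0 coef0.
  rewrite /TW twE eqxx coefMC ee_coef.
  case: x y => [[i j] r] [[i' j'] r'] /=; rewrite !xpair_eqE.
  rewrite [i' == i]eq_sym [j' == j]eq_sym [r' == r]eq_sym -andbA [(r == r') && _]andbC.
  case: eqP => [->|_] /=; last by rewrite mul0r.
  by case: ifP => _; rewrite ?mul0r // sgnMl mul1r.
rewrite mxE coef_sum (bigD1 x.1.1) //= big1 ?addr0 => [|k kx]; last first.
  by rewrite /TT twE eq_sym (negbTE kx) mul0r coef0.
by rewrite /TT twE eqxx coefCM sgnMl.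
Qed.

(** In [rho_cons] letters after x contribute a sign through [pa x.1.2], letters before it through
    [pa x.1.1]. As [godd x] is the sum of the two, this regroups into one sign for all other letters
    and one for those before x. *)
Let sg x w := pa x.1.1 (+) (pa x.1.2 && (par w (+) godd x)) (+)
  (godd x && par (take (index x w) w)).

Variables (le : rel G).
Hypothesis le_total : total_order le.

Lemma sorted_head x w : path le x w -> x \in w -> exists w', w = x :: w'.
Proof.
case: le_total => le_asym le_tr _; case: w => // y w /= /andP[xy yw].
rewrite inE => /predU1P[->|xw]; exists w => //; congr (_ :: _).
by apply: le_asym; rewrite xy (allP (order_path_min le_tr yw)).
Qed.

(** Copies of x are adjacent in a sorted word, so removing any of them gives the same word. An even
    x has the same sign at each copy, whence the multiplicity; an odd x occurs at most once. *)
Let rho_sorted x w : sorted le w -> (godd x -> (count_mem x w <= 1)%N) ->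
  rho x w = (count_mem x w)%:R *: sgn (sg x w) (monomial gen (rem x w)).
Proof.
elim: w => [|y w IH] sw cx; first by rewrite /rho /= mxE coef0 scale0r.
have {}IH := IH (path_sorted sw); rewrite rho_cons /= /sg parity_cons /=.
have cxw : godd x -> (count_mem x w <= 1)%N.
  by move=> /cx; apply: leq_trans; exact: leq_addl.
case: (eqVneq y x) cx sw => [-> cx sw|yx _ _] /=; last first.
  rewrite add0r (IH cxw) monomial_cons -scalerAr sgnMr sgnZ sgnK.
  congr (_ *: sgn _ _); rewrite /sg parity_cons /godd.
  by move: (pa _) (pa _) (pa _) (pa _) (par _) (par _) => [] [] [] [] [] [].
rewrite sgnK; have [xw|xw] := boolP (x \in w); last first.
  have c0 : count_mem x w = 0%N by apply/count_memPn.
  rewrite IH ?c0 // scale0r mulr0 sgn0 addr0 scale1r ?take0 parity_nil andbF addbF.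
  by rewrite [godd x (+) _]addbC addbK.
have cw : (0 < count_mem x w)%N by rewrite -has_count has_pred1.
have ox : godd x = false by apply/negP => /cx /=; rewrite eqxx addnC addn1 ltnS leqNgt cw.
have [w' wE] := sorted_head sw xw.
have gw : gen x * monomial gen (rem x w) = monomial gen w.
  by rewrite wE /= eqxx monomial_cons.
rewrite IH ?ox // /sg ox /= andbF !addbF -scalerAr sgnMr gw /=.
by rewrite natrD scalerDl scale1r.
Qed.

(** The parity automorphism. The diagonal entries of [TW w] are w up to the sign of its parity;
    [sigma] allows [dd] to subtract them by a formula linear in the argument. *)
Variable sigma : {rmorphism A -> A}.
Hypothesis sigmaZ : forall c y, sigma (c *: y) = c *: sigma y.
Hypothesis sigma_gen : forall x, sigma (gen x) = sgn (godd x) (gen x).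
Hypothesis char0 : forall m, (m.+1%:R : K) != 0.

Let sigma_word w : sigma (monomial gen w) = sgn (par w) (monomial gen w).
Proof.
elim: w => [|x w IH]; first by rewrite monomial_nil parity_nil rmorph1.
by rewrite monomial_cons parity_cons rmorphM IH sigma_gen sgnMl sgnMr sgnK.
Qed.

(* On a sorted word the leading part of [dd x] is, up to sign, the partial
   derivative with respect to the letter x. *)
Let dd (x : G) (y : A) : A := (Psi y x.1.1 x.1.2)`_(x.2) -
  (if (x.1.1 == x.1.2) && (x.2 == 0%N) then if pa x.1.1 then sigma y else y else 0).

Let ddD x y z : dd x (y + z) = dd x y + dd x z.
Proof.
rewrite /dd !rmorphD mxE coefD addrACA -opprD; congr (_ - _).
by case: ifP => _; [case: ifP|rewrite addr0].
Qed.

Let ddZ x c y : dd x (c *: y) = c *: dd x y.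
Proof.
rewrite /dd PsiZ [_ * Psi y]mul_scalar_mx mxE coefCM mulr_algl scalerBr sigmaZ.
by congr (_ - _); case: ifP => _; [case: ifP|rewrite scaler0].
Qed.

Let dd_word x w : wspan gen (fun v => (deg v + x.2 < deg w)%N \/
  ((deg v + x.2)%N = deg w /\ (size v < (size w).-1)%N)) (dd x (monomial gen w) - rho x w).
Proof.
have := Psi_word w x.1.1 x.1.2 x.2; congr (wspan _ _ _).
have mxB2 (X Y Z : C) i j : (X - Y - Z) i j = X i j - Y i j - Z i j.
  by rewrite !mxE.
rewrite mxB2 /dd /rho !coefB; congr (_ - _ - _); rewrite twE.
case: eqP => [->|_]; last by rewrite coef0.
by rewrite coefC; case: eqP => //= _; rewrite sigma_word; case: (pa x.1.2).
Qed.

Let dd_lower p l x y : (x.2 <= p)%N -> wspan gen (lower p l.+1) y ->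
  wspan gen (lower (p - x.2) l) (dd x y).
Proof.
move=> xp; elim=> [|c w {}y wl _ IH].
  have -> : dd x 0 = 0 by have := ddZ x 0 0; rewrite !scale0r.
  exact: wspan0.
rewrite ddD ddZ; apply: wspanD => //; apply: wspanZ.
rewrite -[dd _ _](subrK (rho x w)); apply: wspanD.
  apply: wspan_mono (dd_word x w) => v; move: wl; rewrite /lower.
  by move: (deg v) (deg w) => dv dw; lia.
apply: wspan_mono (RR_lower w x.1.1 x.1.2 x.2) => v; move: wl; rewrite /lower.
by move: (deg v) (deg w) => dv dw; lia.
Qed.

Lemma rem_sorted_inj x u v : sorted le u -> sorted le v -> x \in u -> x \in v ->
  rem x u = rem x v -> u = v.
Proof.
case: le_total => le_asym le_tr _ su sv xu xv uv.
apply: (sorted_eq le_tr le_asym su sv).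
by rewrite (perm_trans (perm_to_rem xu)) // uv perm_sym perm_to_rem.
Qed.

Let admissible k p w := [/\ ordered_monomials godd le w, size w = k & deg w = p].

(** Induction on the length. For a word w with first letter x, [dd x] turns the relation into one
    between words with x removed. These stay distinct, and the coefficient of [rem x w] is a nonzero
    multiple of [c w]. *)
Lemma independent_top k p (S : seq (seq G)) (c : seq G -> K) : uniq S ->
    (forall w, w \in S -> admissible k p w) ->
    wspan gen (lower p k) (\sum_(w <- S) c w *: monomial gen w) ->
  forall w, w \in S -> c w = 0.
Proof.
elim: k p S c => [|k IH] p S c uS Sadm Slow w wS.
  have nilS v : v \in S -> v = [::] by move=> /Sadm[_ /size0nil].
  have p0 : p = 0%N.
    by have [_ _ <-] := Sadm _ wS; rewrite (nilS _ wS) weight_nil.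
  have S1 : S = [:: [::]].
    case: S uS nilS wS {Sadm Slow} => // u [|v S] /= uS nilS _.
      by rewrite (nilS u) // mem_head.
    have u0 : u = [::] by apply: nilS; rewrite mem_head.
    have v0 : v = [::] by apply: nilS; rewrite !inE eqxx orbT.
    by move: uS; rewrite u0 v0 inE eqxx.
  (* No word is lower than degree 0 and length 0, so the multiple of 1 vanishes. *)
  move: Slow; rewrite S1 big_seq1 monomial_nil (nilS w wS) => /wspan_eq0 c0.
  have /eqP : c [::] *: (1 : A) = 0.
    by apply: c0 => v; rewrite /lower p0 => -[|[]] //; case: (size v).
  by rewrite scaler_eq0 oner_eq0 orbF => /eqP.
have [[sw ow] zw dw] := Sadm w wS.
case: w wS sw ow zw dw => // x s wS sw ow _ dw; set w := x :: s in wS sw ow dw.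
have xp : (x.2 <= p)%N by rewrite -dw weight_cons leq_addr.
pose S' := [seq rem x v | v <- S & x \in v].
(* Sorting [x :: u] recovers the word from which u was obtained by removing x. *)
pose c' u := let v := sort le (x :: u) in
  c v * ((count_mem x v)%:R * (if sg x v then -1 else 1)).
have sortK v : v \in S -> x \in v -> sort le (x :: rem x v) = v.
  case: le_total => le_asym le_tr le_tot /Sadm[[sv _] _ _] xv.
  apply: (sorted_eq le_tr le_asym (sort_sorted le_tot _) sv).
  by rewrite perm_sort perm_sym perm_to_rem.
have c'E v : v \in S -> x \in v ->
    c' (rem x v) = c v * ((count_mem x v)%:R * (if sg x v then -1 else 1)).
  by move=> vS xv; rewrite /c' sortK.
have : c' (rem x w) = 0.
  apply: (IH (p - x.2)%N S').
  - rewrite map_inj_in_uniq ?filter_uniq // => u v; rewrite !mem_filter.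
    move=> /andP[xu /Sadm[[su _] _ _]] /andP[xv /Sadm[[sv _] _ _]].
    by move=> uv; exact: (rem_sorted_inj su sv xu xv uv).
  - move=> u /mapP[v]; rewrite mem_filter => /andP[xv /Sadm[[sv ov] zv dv]] ->.
    have [le_asym le_tr _] := le_total.
    have ss := rem_subseq x v.
    have srem : sorted le (rem x v) by exact: (subseq_sorted le_tr ss sv).
    have crem y : godd y -> (count_mem y (rem x v) <= 1)%N.
      move=> /ov; apply: leq_trans; have /permP -> := perm_to_rem xv.
      exact: leq_addl.
    have zrem : size (rem x v) = k by rewrite size_rem // zv.
    have drem : deg (rem x v) = (p - x.2)%N.
      by rewrite -dv /weight (perm_big _ (perm_to_rem xv)) big_cons addKn.
    by split=> //; split.
  - have := dd_lower xp Slow.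
    have -> : dd x (\sum_(v <- S) c v *: monomial gen v) =
        \sum_(v <- S) c v *: dd x (monomial gen v).
      have dd0 : dd x 0 = 0 by have := ddZ x 0 0; rewrite !scale0r.
      rewrite (big_morph (dd x) (ddD x) dd0).
      by apply: eq_bigr => v _; exact: ddZ.
    have -> : \sum_(u <- S') c' u *: monomial gen u = \sum_(v <- S) c v *: rho x v.
      rewrite big_map big_filter [RHS](bigID (mem^~ x)) /=.
      rewrite [X in _ + X]big1_seq ?addr0 => [|v /andP[xv vS]]; last first.
        have [[sv ov] _ _] := Sadm v vS.
        rewrite rho_sorted //; last exact: ov.
        by rewrite (count_memPn xv) scale0r scaler0.
      rewrite big_seq_cond [RHS]big_seq_cond; apply: eq_bigr => v /andP[vS xv].
      have [[sv ov] _ _] := Sadm v vS.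
      rewrite c'E // rho_sorted //; last exact: ov.
      rewrite scalerA; case: (sg x v) => /=; last by rewrite mulr1.
      by rewrite mulrN1 mulrN scaleNr scalerN.
    move=> H; rewrite -[X in wspan _ _ X](subrK (\sum_(v <- S) c v *: dd x (monomial gen v))).
    apply: wspanD => //; rewrite -sumrB big_seq.
    apply: wspan_sum => v vS; rewrite -scalerBr; apply: wspanZ.
    rewrite -opprB; apply: wspanN; have [_ zv dv] := Sadm v vS.
    apply: wspan_mono (dd_word x v) => u; rewrite /lower zv dv /=.
    by move: (deg u) => du; lia.
  - by apply: map_f; rewrite mem_filter mem_head.
rewrite c'E ?mem_head // => /eqP; rewrite mulf_eq0 => /orP[/eqP//|].
rewrite mulf_eq0 => /orP[]; last by case: ifP; rewrite ?oppr_eq0 oner_eq0.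
have : (0 < count_mem x w)%N by rewrite -has_count has_pred1 mem_head.
by case: (count_mem x w) => // m _; rewrite (negbTE (char0 m)).
Qed.

(** * Generators changed by terms of smaller degree *)

Variable e : G -> A.
Hypothesis e_gen : forall x, wspan gen (fun w => (deg w < x.2)%N) (e x - gen x).

Lemma perturbed_word w :
  wspan gen (fun v => (deg v < deg w)%N) (monomial e w - monomial gen w).
Proof.
have le_word u : wspan gen (fun v => (deg v <= deg u)%N) (monomial gen u).
  exact: wspan_word.
elim: w => [|x w IH]; first by rewrite !monomial_nil subrr; exact: wspan0.
rewrite !monomial_cons weight_cons.
have -> : e x * monomial e w - gen x * monomial gen w =
    (e x - gen x) * (monomial e w - monomial gen w) +
    ((e x - gen x) * monomial gen w + gen x * (monomial e w - monomial gen w)).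
  have c1 (z : A) : 1 * z = z * 1 by rewrite mul1r mulr1.
  by nc c1 c1.
have lt_add a b : wspan gen (fun v => (deg v < x.2)%N) a ->
    wspan gen (fun v => (deg v <= deg w)%N) b ->
    wspan gen (fun v => (deg v < gdeg x + deg w)%N) (a * b).
  apply: wspanM => u v; rewrite weight_cat /gdeg => ux vw.
  by rewrite -addSn leq_add.
apply: wspanD; [|apply: wspanD].
- by apply: lt_add => //; apply: wspan_mono IH => v; exact: ltnW.
- exact: lt_add.
rewrite -(monomial1 gen x); apply: wspanM (wspan_word gen (erefl [:: x])) IH => u v <- vw.
by rewrite weight_cat weight_cons weight_nil addn0 ltn_add2l.
Qed.

Lemma seq_argmax (T : eqType) (f : T -> nat) (s : seq T) x : x \in s ->
  exists2 y, y \in s & forall z, z \in s -> (f z <= f y)%N.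
Proof.
elim: s x => // a s IH x _; case: s IH => [|b s] IH.
  by exists a; rewrite ?mem_head // => z; rewrite inE => /eqP->.
have [y ys ymax] := IH b (mem_head _ _).
have [fya|fay] := leqP (f y) (f a).
  exists a; rewrite ?mem_head // => z; rewrite inE => /predU1P[->//|/ymax fz].
  exact: leq_trans fya.
exists y; first by rewrite inE ys orbT.
by move=> z; rewrite inE => /predU1P[->|/ymax//]; exact: ltnW.
Qed.

Lemma independent_perturbed (S : seq (seq G)) (c : seq G -> K) : uniq S ->
    (forall w, w \in S -> ordered_monomials godd le w) ->
    \sum_(w <- S) c w *: monomial e w = 0 ->
  forall w, w \in S -> c w = 0.
Proof.
move=> uS Sadm S0 w wS; apply/eqP/negPn/negP => cw.
(* Among the words with nonzero coefficient, keep those of largest degree and, of these, the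
   longest. Moving all else to the other side shows that their combination of t-monomials is
   lower. *)
pose S1 := [seq v <- S | c v != 0].
have [w1 w1S pmax] : exists2 w1, w1 \in S1 & forall v, v \in S1 -> (deg v <= deg w1)%N.
  by apply: (@seq_argmax _ _ _ w); rewrite mem_filter cw.
set p := deg w1 in pmax.
pose S2 := [seq v <- S1 | deg v == p].
have [w2 w2S kmax] : exists2 w2, w2 \in S2 & forall v, v \in S2 -> (size v <= size w2)%N.
  by apply: (@seq_argmax _ _ _ w1); rewrite mem_filter eqxx.
set k := size w2 in kmax.
pose S3 := [seq v <- S2 | size v == k].
have w2S3 : w2 \in S3 by rewrite mem_filter eqxx.
suff /(_ _ w2S3) c0 : forall v, v \in S3 -> c v = 0.
  by move: w2S; rewrite !mem_filter c0 eqxx andbF.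
apply: (@independent_top k p).
- by rewrite !filter_uniq.
- move=> v; rewrite !mem_filter => /andP[/eqP zv /andP[/eqP dv /andP[_ vS]]].
  by split=> //; exact: Sadm.
have -> : \sum_(v <- S3) c v *: monomial gen v =
   - (\sum_(v <- S1 | deg v != p) c v *: monomial e v) -
   \sum_(v <- S2 | size v != k) c v *: monomial e v -
   \sum_(v <- S3) c v *: (monomial e v - monomial gen v).
  have S10 : \sum_(v <- S1) c v *: monomial e v = 0.
    rewrite big_filter -[RHS]S0 [RHS](bigID (fun v => c v != 0)) /=.
    rewrite [X in _ = _ + X]big1 ?addr0 // => v; rewrite negbK => /eqP->.
    by rewrite scale0r.
  have E : \sum_(v <- S1 | deg v != p) c v *: monomial e v +
      \sum_(v <- S2 | size v != k) c v *: monomial e v +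
      \sum_(v <- S3) c v *: monomial e v = 0.
    rewrite -[RHS]S10 [RHS](bigID (fun v => deg v != p)) /= -addrA; congr (_ + _).
    rewrite -[RHS]big_filter (eq_filter (a2 := fun v => deg v == p)); last first.
      by move=> v; rewrite negbK.
    rewrite -/S2 [RHS](bigID (fun v => size v != k)) /=; congr (_ + _).
    by rewrite big_filter; apply: eq_bigl => v; rewrite negbK.
  have -> : \sum_(v <- S3) c v *: (monomial e v - monomial gen v) =
      \sum_(v <- S3) c v *: monomial e v - \sum_(v <- S3) c v *: monomial gen v.
    by rewrite -sumrB; apply: eq_bigr => v _; rewrite scalerBr.
  by rewrite opprB addrCA -opprD -opprD E subr0.
have dlow v : wspan gen (fun u => (deg u < deg v)%N) (monomial e v - monomial gen v).
  exact: perturbed_word.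
apply: wspanB; first apply: wspanB; first apply: wspanN.
- rewrite big_seq_cond; apply: wspan_sum => v /andP[vS vp]; apply: wspanZ.
  have dv : (deg v < p)%N by rewrite ltn_neqAle vp pmax.
  rewrite -[monomial e v](subrK (monomial gen v)); apply: wspanD.
    by apply: wspan_mono (dlow v) => u uv; left; apply: ltn_trans dv.
  by apply: wspan_word; left.
- rewrite big_seq_cond; apply: wspan_sum => v /andP[vS vk]; apply: wspanZ.
  have kv : (size v < k)%N by rewrite ltn_neqAle vk kmax.
  have /eqP dv : deg v == p by move: vS; rewrite mem_filter => /andP[].
  rewrite -[monomial e v](subrK (monomial gen v)); apply: wspanD.
    by apply: wspan_mono (dlow v) => u; rewrite dv => uv; left.
  by apply: wspan_word; right.
- rewrite big_seq; apply: wspan_sum => v vS; apply: wspanZ.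
  have /eqP dv : deg v == p by move: vS; rewrite !mem_filter => /and3P[].
  by apply: wspan_mono (dlow v) => u; rewrite dv => uv; left.
Qed.

End Independence.

Theorem ordered_monomials_free (K : fieldType) (A : algType K) (n : nat)
    (pa : 'I_n -> bool) (t : 'I_n -> 'I_n -> fps A) (le : rel ('I_n * 'I_n * nat))
    (e : 'I_n * 'I_n * nat -> A) (S : seq (seq ('I_n * 'I_n * nat)))
    (c : seq ('I_n * 'I_n * nat) -> K) :
    (forall i j, t i j 0%N = (i == j)%:R) -> yang_relation pa t ->
    universal_solution pa t -> (forall m, (m.+1%:R : K) != 0) ->
    (forall x, wspan (gen t) (fun w => (weight (@gdeg n) w < x.2)%N) (e x - gen t x)) ->
    total_order le -> uniq S ->
    (forall w, w \in S -> ordered_monomials (godd pa) le w) ->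
    \sum_(w <- S) c w *: monomial e w = 0 ->
  forall w, w \in S -> c w = 0.
Proof.
move=> t0 t_rel univ char0 e_gen le_total uS Sadm S0.
(* K embeds in scalar matrices, which are central because K is central in A. *)
have fC1 (a : K) (z : 'M[{poly A}]_n) :
    (scalar_mx \o polyC \o in_alg A) a * z = z * (scalar_mx \o polyC \o in_alg A) a.
  rewrite [LHS]mul_scalar_mx [RHS](_ : _ = z *m (a%:A)%:P%:M) //.
  apply/matrixP => i j; rewrite !mxE (bigD1 j) //= mxE eqxx mulr1n.
  rewrite big1 ?addr0 => [|k kj]; last by rewrite mxE (negbTE kj) mulr0.
  by apply/polyP => d; rewrite coefCM coefMC mulr_algl mulr_algr.
have [Psi [PsiZ Psi_t]] := univ _ (scalar_mx \o polyC \o in_alg A) _ fC1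
  (tpl0 pa t0) (tpl_rel t0 t_rel).
(* Changing the sign of the odd generators gives another solution; the universal property turns it
   into the parity automorphism. *)
pose t' i j : fps A := fun r => sgn (pa i (+) pa j) (t i j r).
have t'0 i j : t' i j 0%N = (i == j)%:R.
  by rewrite /t' t0; case: eqP => [->|_]; rewrite ?addbb ?sgn0.
have t'rel : yang_relation pa t'.
  move=> i j h k r s; rewrite /t'.
  transitivity (sgn ((pa i (+) pa j) (+) (pa h (+) pa k)) (t i j r * t h k s -
    sgn ((pa i (+) pa j) && (pa h (+) pa k)) (t h k s * t i j r))).
    rewrite sgnB !sgnMl !sgnMr !sgnK.
    by move: (pa i) (pa j) (pa h) (pa k) => [] [] [] [].
  rewrite t_rel sgnK !sgn_sum; apply: eq_bigr => l _.
  rewrite !sgnMl !sgnMr !sgnB !sgnK.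
  by move: (pa i) (pa j) (pa h) (pa k) => [] [] [] [].
have fC2 (a : K) (z : A) : (in_alg A) a * z = z * (in_alg A) a.
  by rewrite /= mulr_algl mulr_algr.
have [sigma [sigmaZ sigma_t]] := univ _ (in_alg A) t' fC2 t'0 t'rel.
apply: (@independent_perturbed K A n pa t t0 Psi PsiZ Psi_t le le_total sigma _ _
  char0 e e_gen S c uS Sadm S0).
- by move=> a y; rewrite sigmaZ /= mulr_algl.
- by move=> x; rewrite /gen sigma_t.
Qed.

(** * Gauss decomposition *)

Section Entries.
Context (A : pzRingType) (n : nat).
Local Notation R := (fps 'M[A]_n).
Implicit Types (X Y : R) (d e : pred 'I_n).

Definition entry X (i j : 'I_n) : fps A := fun r => X r i j.

Lemma entry_ext X Y : (forall i j, entry X i j = entry Y i j) -> X = Y.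
Proof.
move=> XY; apply: funext => r; apply/matrixP => i j.
exact: (congr1 (fun f : fps A => f r) (XY i j)).
Qed.

Lemma entryM X Y i j : entry (X * Y) i j = \sum_q entry X i q * entry Y q j.
Proof.
apply: funext => r; rewrite fps_sum /entry fpsM summxE.
under eq_bigr do rewrite mxE; rewrite exchange_big /=.
by apply: eq_bigr => q _; rewrite fpsM.
Qed.

Lemma entryD X Y i j : entry (X + Y) i j = entry X i j + entry Y i j.
Proof. by apply: funext => r; rewrite /entry fpsD mxE. Qed.
Lemma entryB X Y i j : entry (X - Y) i j = entry X i j - entry Y i j.
Proof. by apply: funext => r; rewrite /entry fpsB !mxE. Qed.
Lemma entry1 i j : entry 1 i j = (i == j)%:R.
Proof.
apply: funext => r; rewrite /entry fps1.
by case: r => [|r]; rewrite !mxE; case: (i == j); rewrite ?fps1 ?fps0.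
Qed.

Definition proj d : R := fps_cst (diag_mx (\row_i (d i)%:R)).

Lemma proj_entryl d X i j : entry (proj d * X) i j = if d i then entry X i j else 0.
Proof.
apply: funext => r; rewrite /entry fps_cstM [_ * _]mul_diag_mx !mxE.
by case: (d i); rewrite ?mul1r ?mul0r.
Qed.
Lemma proj_entryr d X i j : entry (X * proj d) i j = if d j then entry X i j else 0.
Proof.
apply: funext => r; rewrite /entry fpsM_cst [_ * _]mul_mx_diag !mxE.
by case: (d j); rewrite ?mulr1 ?mulr0.
Qed.
Lemma proj_entry d i j : entry (proj d) i j = (d i && (i == j))%:R.
Proof.
by rewrite -[proj d]mulr1 proj_entryl entry1; case: (d i).
Qed.

Lemma projM d e : (forall i, d i -> e i) -> proj d * proj e = proj d.
Proof.
move=> de; apply: entry_ext => i j; rewrite proj_entryl !proj_entry.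
by case: ifP => [/de->|].
Qed.
Lemma projMr d e : (forall i, d i -> e i) -> proj e * proj d = proj d.
Proof.
move=> de; apply: entry_ext => i j; rewrite proj_entryl !proj_entry.
case: ifP => // ei; case di : (d i) => //=; by rewrite (de i di) in ei.
Qed.

(** The corner on d, completed by the identity, stays invertible among matrices of full size, and no
    change of matrix size is needed. *)
Definition cut d X : R := proj d * X * proj d + (1 - proj d).

Lemma cut0 d X : X 0%N = 1 -> cut d X 0%N = 1.
Proof.
move=> X0; rewrite /cut fpsD fpsB !fpsM0 X0 mulr1 -fpsM0 projM //.
by rewrite addrC subrK.
Qed.

Lemma proj_cut d X : proj d * cut d X = proj d * X * proj d.
Proof.
by rewrite mulrDr mulrBr mulr1 projM // subrr addr0 !mulrA projM.
Qed.
Lemma cut_proj d X : cut d X * proj d = proj d * X * proj d.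
Proof.
by rewrite mulrDl mulrBl mul1r projM // subrr addr0 -!mulrA projM.
Qed.

(** The hypothesis says that no path from d to d passes outside d, as happens when a factor is
    triangular in the right direction. *)
Lemma cutM d X Y : proj d * X * Y * proj d = proj d * X * proj d * (proj d * Y * proj d) ->
  cut d (X * Y) = cut d X * cut d Y.
Proof.
move=> XY; rewrite {2}/cut mulrDl mulrBl mul1r proj_cut {3}/cut [X in _ = _ + (X - _)]addrC addrK.
rewrite -(mulrA (proj d * X)) proj_cut; congr (_ + _); rewrite [proj d * (X * Y)]mulrA XY.
by rewrite !mulrA -(mulrA (proj d * X) (proj d) (proj d)) projM.
Qed.

Lemma fps_inv_unique (B : pzRingType) (f g : fps B) : f 0%N = 1 -> g * f = 1 ->
  g = fps_inv f.
Proof. by move=> f0 gf; rewrite -[g]mulr1 -(fps_mulVr f0) mulrA gf mul1r. Qed.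

Lemma cut_left_inverse d X S i j : S * cut d X = 1 -> d i -> d j ->
  \sum_(q | d q) entry S i q * entry X q j = (i == j)%:R.
Proof.
move=> SX di dj; rewrite -entry1 -SX entryM [RHS](bigID d) /= [X in _ + X]big1.
  rewrite addr0; apply: eq_bigr => q dq; congr (_ * _).
  by rewrite /cut entryD entryB proj_entryr dj proj_entryl dq proj_entry entry1 dq subrr addr0.
move=> q /negbTE dq; rewrite /cut entryD entryB proj_entryr dj proj_entryl dq.
rewrite proj_entry entry1 dq subr0 add0r.
by case: eqP => [qj|_]; [rewrite qj dj in dq|rewrite mulr0].
Qed.

Lemma cut_right_inverse d X S i j : cut d X * S = 1 -> d i -> d j ->
  \sum_(q | d q) entry X i q * entry S q j = (i == j)%:R.
Proof.
move=> SX di dj; rewrite -entry1 -SX entryM [RHS](bigID d) /= [X in _ + X]big1.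
  rewrite addr0; apply: eq_bigr => q dq; congr (_ * _).
  by rewrite /cut entryD entryB proj_entryr dq proj_entryl di proj_entry entry1 di subrr addr0.
move=> q /negbTE dq; rewrite /cut entryD entryB proj_entryr dq.
rewrite proj_entry entry1 di subrr addr0.
by rewrite mul0r.
Qed.

End Entries.

Section MatrixSpan.
Context (K : fieldType) (A : algType K) (n : nat) (pa : 'I_n -> bool).
Context (J : Type) (g : J -> A) (wt : J -> nat) (odd : J -> bool).
Local Notation R := (fps 'M[A]_n).

Definition mspan (X : R) : Prop := forall r i j,
  wspan g (fun w => (weight wt w <= r)%N /\ parity odd w = pa i (+) pa j) (X r i j).

Lemma mspanD X Y : mspan X -> mspan Y -> mspan (X + Y).
Proof. by move=> hX hY r i j; rewrite fpsD mxE; apply: wspanD. Qed.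
Lemma mspanB X Y : mspan X -> mspan Y -> mspan (X - Y).
Proof. by move=> hX hY r i j; rewrite fpsB !mxE; apply: wspanB. Qed.
Lemma mspanM X Y : mspan X -> mspan Y -> mspan (X * Y).
Proof.
move=> hX hY r i j; rewrite fpsM summxE; apply: wspan_sum => s _.
rewrite mxE; apply: wspan_sum => q _.
apply: wspanM (hX s i q) (hY (r - s)%N q j) => u v [us up] [vs vp].
rewrite weight_cat parity_cat up vp; split; last first.
  by move: (pa i) (pa j) (pa q) => [] [] [].
by have := leq_add us vs; rewrite subnKC // -ltnS.
Qed.
Lemma mspan_proj d : mspan (proj A d).
Proof.
move=> r i j; rewrite /proj; case: r => [|r] /=; last by rewrite mxE; exact: wspan0.
rewrite !mxE; case: eqP => [->|_]; last exact: wspan0.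
rewrite mulr1n; case: (d j); last exact: wspan0.
by apply: wspan1; rewrite weight_nil parity_nil addbb.
Qed.
Lemma mspan1 : mspan 1.
Proof.
move=> r i j; rewrite fps1; case: r => [|r]; last by rewrite mxE; exact: wspan0.
rewrite mxE; case: eqP => [->|_]; last exact: wspan0.
by apply: wspan1; rewrite weight_nil parity_nil addbb.
Qed.
Lemma mspan_inv X : mspan X -> mspan (fps_inv X).
Proof.
move=> hX r i j; rewrite /fps_inv /fps_geom fps_sum summxE; apply: wspan_sum => m _.
suff: mspan ((1 - X) ^+ m) by apply.
elim: (nat_of_ord m) => [|k IH]; first exact: mspan1.
by rewrite exprS; apply: mspanM => //; apply: mspanB => //; exact: mspan1.
Qed.
Lemma mspan_cut d X : mspan X -> mspan (cut d X).
Proof.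
move=> hX; apply: mspanD; last by apply: mspanB; [exact: mspan1|exact: mspan_proj].
by do 2?apply: mspanM => //; exact: mspan_proj.
Qed.

End MatrixSpan.

(** * Commutators inside the triangular parts *)

Section QuotientFilter.
Context (B : pzRingType) (n : nat) (pa : 'I_n -> bool) (kap th : B).
Context (kapC : forall z, kap * z = z * kap) (thC : forall z, th * z = z * th).
(** An abstract filtration, so that one proof serves the ring of series and its converse. *)
Variable W : nat -> B -> Prop.
Hypotheses (W0 : forall k, W k 0) (WN : forall k x, W k x -> W k (- x)).
Hypothesis WD : forall k x y, W k x -> W k y -> W k (x + y).
Hypothesis WM : forall k l x y, W k x -> W l y -> W (k + l) (x * y).
Hypothesis WS : forall k x, W k.+1 x -> W k x.
Hypotheses (Wkap : W 1 kap) (Wth : W 2 th).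
Hypothesis Wcancel : forall k x, W k.+1 (kap * x) -> W k x.

Lemma filter_sgn k b x : W k x -> W k (sgn b x).
Proof. by case: b => //; exact: WN. Qed.

Lemma filter_sum k I (r : seq I) (P : pred I) (f : I -> B) :
  (forall i, P i -> W k (f i)) -> W k (\sum_(i <- r | P i) f i).
Proof. by move=> Pf; apply: big_ind => //; exact: WD. Qed.

(** With kap of order 1, th of order 2 and quotients of order 0, each term on the right of
    [exchange_quotient2] has order at least 3. Cancelling kap twice leaves order 1. *)
Lemma exchange_quotient_filter (a b sa sb xa xe xb : 'I_n -> 'I_n -> B)
    (d e : pred 'I_n) i j h k :
    exchange pa kap th a b ->
    (forall i, d i -> e i) -> left_inverse_on d sa a -> left_inverse_on e sb b ->
    (forall i k, d i -> \sum_(q | d q) a i q * xa q k = a i k) ->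
    (forall i k, e i -> \sum_(q | e q) a i q * xe q k = a i k) ->
    (forall i k, e i -> \sum_(q | e q) b i q * xb q k = b i k) ->
    (forall i j, W 0 (xa i j)) -> (forall i j, W 0 (xe i j)) ->
    (forall i j, W 0 (xb i j)) -> d i -> e h ->
  W 1 (xa i j * xb h k -
       sgn ((pa i (+) pa j) && (pa h (+) pa k)) (xb h k * xa i j)).
Proof.
move=> ab de saK sbK axa axe bxb wa we wb di eh; do 2!apply: Wcancel.
rewrite (exchange_quotient2 kapC thC ab de saK sbK axa axe bxb j k di eh).
have wB p l : W 0 (xb p l - xe p l) by apply: WD => //; apply: WN.
have ww i' l : W 0 (\sum_(p | e p) xa i' p * (xb p l - xe p l)).
  by apply: filter_sum => p _; exact: (WM (wa i' p) (wB p l)).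
apply: WD; [apply: WD|].
- apply: (WM Wkap (WM Wth (_ : W 0 _))); apply: filter_sum => p _.
  by apply: filter_sgn; exact: (WM (WM (wa i p) (wb h j)) (wB p k)).
- apply: WN; apply: WS.
  exact: (WM Wth (WM Wth (WM (ww i j) (wB h k)))).
apply: WN; apply: (WM Wkap (WM Wth (_ : W 0 _))); case: ifP => // _.
by apply: filter_sgn; exact: (WM (ww i k) (wa h j)).
Qed.

End QuotientFilter.

(** * The weight filtration on series in two variables *)

Section SeriesFilter.
Context (K : fieldType) (A : algType K) (J : Type) (g : J -> A) (wt : J -> nat).

(** Written without subtraction, so that coefficients with r + s < k have to vanish. *)
Definition sfilter (k : nat) (Z : fps (fps A)) : Prop := forall r s,
  wspan g (fun w => (weight wt w + k <= r + s)%N) (Z r s).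

Lemma sfilter0 k : sfilter k 0.
Proof. by move=> r s; rewrite !fps0; exact: wspan0. Qed.
Lemma sfilterN k Z : sfilter k Z -> sfilter k (- Z).
Proof. by move=> hZ r s; rewrite !fpsN; exact: wspanN. Qed.
Lemma sfilterD k Y Z : sfilter k Y -> sfilter k Z -> sfilter k (Y + Z).
Proof. by move=> hY hZ r s; rewrite !fpsD; exact: wspanD. Qed.
Lemma sfilterM k l Y Z : sfilter k Y -> sfilter l Z -> sfilter (k + l) (Y * Z).
Proof.
move=> hY hZ r s; rewrite fpsM fps_sum; apply: wspan_sum => a _.
rewrite fpsM; apply: wspan_sum => b _.
apply: wspanM (hY a b) (hZ (r - a)%N (s - b)%N) => u v; rewrite weight_cat.
have := ltn_ord a; have := ltn_ord b; move: (nat_of_ord a) (nat_of_ord b) => {}a {}b.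
by lia.
Qed.
Lemma sfilterS k Z : sfilter k.+1 Z -> sfilter k Z.
Proof. by move=> hZ r s; apply: wspan_mono (hZ r s) => w; rewrite addnS; exact: ltnW. Qed.
Lemma fps_fps1 r s : (1 : fps (fps A)) r s = ((r == 0%N) && (s == 0%N))%:R.
Proof. by case: r => [|r] //; rewrite fps1 mulr1n fps1. Qed.
Lemma sfilter_kap : sfilter 1 (kapUV A).
Proof.
move=> r s; rewrite -[kapUV A]mulr1 kapUVE; apply: wspanB.
  case: s => [|s]; first exact: wspan0.
  rewrite fps_fps1; case: r s => [|r] [|s]; try exact: wspan0.
  by apply: wspan1; rewrite weight_nil.
case: r => [|r]; first exact: wspan0.
rewrite fps_fps1; case: r s => [|r] [|s]; try exact: wspan0.
by apply: wspan1; rewrite weight_nil.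
Qed.
Lemma sfilter_th : sfilter 2 (thUV A).
Proof.
move=> r s; rewrite -[thUV A]mulr1 thUVE.
case: r => [|r]; first exact: wspan0; case: s => [|s]; first exact: wspan0.
rewrite fps_fps1; case: r s => [|r] [|s]; try exact: wspan0.
by apply: wspan1; rewrite weight_nil.
Qed.
(** The induction of [kapUV_reg], with weights. *)
Lemma sfilter_cancel k Z : sfilter k.+1 (kapUV A * Z) -> sfilter k Z.
Proof.
move=> hZ r; elim: r => [|r IH] s.
  have := hZ 0%N s.+1; rewrite kapUVE subr0; apply: wspan_mono => w.
  by rewrite !add0n addnS ltnS.
have := hZ r.+1 s.+1; rewrite kapUVE => h.
rewrite -[Z _ _](subrK (Z r s.+1)); apply: wspanD.
  by apply: wspan_mono h => w; rewrite addnS addnS ltnS.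
by apply: wspan_mono (IH s.+1) => w; rewrite addnS addSn.
Qed.
Lemma sfilter_inU (f : fps A) :
  (forall r, wspan g (fun w => (weight wt w <= r)%N) (f r)) -> sfilter 0 (inU f).
Proof.
move=> hf r s; rewrite /inU; case: s => [|s]; last exact: wspan0.
by apply: wspan_mono (hf r) => w; rewrite !addn0.
Qed.
Lemma sfilter_inV (f : fps A) :
  (forall r, wspan g (fun w => (weight wt w <= r)%N) (f r)) -> sfilter 0 (inV f).
Proof.
move=> hf r s; rewrite /inV; case: r => [|r]; last exact: wspan0.
by apply: wspan_mono (hf s) => w; rewrite addn0.
Qed.

Definition exchange_quotient_series n pa :=
  @exchange_quotient_filter (fps (fps A)) n pa _ _ (@kapUV_comm A) (@thUV_comm A) sfilter
    (@sfilter0) (@sfilterN) (@sfilterD) (@sfilterM) (@sfilterS)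
    (@sfilter_kap) (@sfilter_th) (@sfilter_cancel).

Let sfilterMc k l (Y Z : (fps (fps A))^c) : sfilter k Y -> sfilter l Z ->
  sfilter (k + l) (Y * Z).
Proof. by move=> hY hZ; rewrite addnC; exact: (sfilterM hZ hY). Qed.
Let sfilter_cancelc k (Z : (fps (fps A))^c) :
  sfilter k.+1 ((kapUV A : (fps (fps A))^c) * Z) -> sfilter k Z.
Proof. by move=> hZ; apply: sfilter_cancel; rewrite kapUV_comm. Qed.

Definition exchange_quotient_series_converse n pa :=
  @exchange_quotient_filter (fps (fps A))^c n pa (kapUV A) (thUV A)
    (fun z => esym (@kapUV_comm A z)) (fun z => esym (@thUV_comm A z)) sfilter
    (@sfilter0) (@sfilterN) (@sfilterD) (@sfilterMc) (@sfilterS)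
    (@sfilter_kap) (@sfilter_th) (@sfilter_cancelc).

End SeriesFilter.

(** * The Gauss factors of T *)

Section Gauss.
Context (K : fieldType) (A : algType K) (n : nat).
Context (pa : 'I_n -> bool) (blk : 'I_n -> nat).
Local Notation R := (fps 'M[A]_n).
Local Notation G := ('I_n * 'I_n * nat)%type.
Variables (T F D E : R).
Hypothesis TE : T = F * D * E.
Hypotheses (F0 : F 0%N = 1) (D0 : D 0%N = 1) (E0 : E 0%N = 1).
Hypothesis Fblk : forall i j, (blk i <= blk j)%N -> entry F i j = (i == j)%:R.
Hypothesis Dblk : forall i j, blk i != blk j -> entry D i j = 0.
Hypothesis Eblk : forall i j, (blk j <= blk i)%N -> entry E i j = (i == j)%:R.
Hypothesis pa_blk : forall i j, blk i = blk j -> pa i = pa j.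
Hypothesis T_rel : yang_relation pa (entry T).

Local Notation gen := (gen (entry T)).
Local Notation godd := (godd pa).
Definition gwt (x : G) : nat := x.2.+1.

Lemma T0 : T 0%N = 1. Proof. by rewrite TE !fpsM0 F0 D0 E0 !mulr1. Qed.

Lemma entryT0 i j : entry T i j 0%N = (i == j)%:R.
Proof. by rewrite /entry T0 mxE. Qed.

(** F, D and E occupy complementary block positions, so together they form one family with the same
    indices as the t's, of which it is a perturbation. *)
Definition gauss_gen (x : G) : A :=
  let: (i, j, r) := x in
  if (blk i < blk j)%N then E r.+1 i j
  else if (blk j < blk i)%N then F r.+1 i j else D r.+1 i j.

(** At superscript r a single generator has degree r - 1, allowed by [QS]; a product of two or more
    has degree at most r - 2, as [QL] demands. *)
Let QS r p (w : seq G) :=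
  [/\ (weight gwt w <= r)%N, (weight (@gdeg n) w < r)%N & parity godd w = p].
Let QL r p (w : seq G) :=
  [/\ (weight gwt w <= r)%N, ((weight (@gdeg n) w).+1 < r)%N & parity godd w = p].
Let MS r (X : 'M[A]_n) := forall i j, wspan gen (QS r (pa i (+) pa j)) (X i j).
Let ML r (X : 'M[A]_n) := forall i j, wspan gen (QL r (pa i (+) pa j)) (X i j).

Let MLS r X : ML r X -> MS r X.
Proof. by move=> hX i j; apply: wspan_mono (hX i j) => w [? /ltnW]. Qed.

Let MSM r s X Y : MS r X -> MS s Y -> ML (r + s) (X * Y).
Proof.
move=> hX hY i j; rewrite mxE; apply: wspan_sum => q _.
apply: wspanM (hX i q) (hY q j) => u v [u1 u2 u3] [v1 v2 v3].
rewrite /QL !weight_cat parity_cat u3 v3; split; first exact: leq_add.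
  by rewrite -addSn -addnS leq_add.
by move: (pa i) (pa j) (pa q) => [] [] [].
Qed.

Let MLD r X Y : ML r X -> ML r Y -> ML r (X + Y).
Proof. by move=> hX hY i j; rewrite mxE; apply: wspanD. Qed.
Let MSD r X Y : MS r X -> MS r Y -> MS r (X + Y).
Proof. by move=> hX hY i j; rewrite mxE; apply: wspanD. Qed.

Let mul_coef (X Y : R) r : X 0%N = 1 -> Y 0%N = 1 ->
    (forall s, (s < r)%N -> MS s.+1 (X s.+1)) -> (forall s, (s < r)%N -> MS s.+1 (Y s.+1)) ->
  ML r.+1 ((X * Y) r.+1 - X r.+1 - Y r.+1).
Proof.
move=> X0 Y0 hX hY; rewrite fpsM big_ord_recl big_ord_recr /= X0 subnn Y0 mul1r mulr1 ?subn0.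
have -> (a b c : 'M[A]_n) : a + (b + c) - c - a = b.
  by rewrite (addrA a b c) addrK [a + b]addrC addrK.
move=> i j; rewrite summxE; apply: wspan_sum => s _.
have sr := ltn_ord s; have -> : (r.+1 - bump 0 s = (r - s.+1).+1)%N.
  by rewrite /bump /= add1n subSS -subSS subSn.
have -> : bump 0 s = s.+1 by [].
have -> : r.+1 = (s.+1 + (r - s.+1).+1)%N by rewrite addnS subnKC.
move: i j; apply: MSM; first exact: hX.
by apply: hY; rewrite ltn_subrL (leq_ltn_trans (leq0n s) sr).
Qed.

(** Strong induction: T - F - D - E is a sum of products of earlier coefficients. In each block
    position only one of F, D, E is nonzero, so it can be solved for. *)
Lemma gauss_coef r : [/\ MS r.+1 (F r.+1), MS r.+1 (D r.+1), MS r.+1 (E r.+1) &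
  ML r.+1 (T r.+1 - F r.+1 - D r.+1 - E r.+1)].
Proof.
have [N] := ubnP r; elim: N r => // N IH r; rewrite ltnS => rN.
have IHF s : (s < r)%N -> MS s.+1 (F s.+1).
  by move=> sr; have [] := IH s (leq_trans sr rN).
have IHD s : (s < r)%N -> MS s.+1 (D s.+1).
  by move=> sr; have [] := IH s (leq_trans sr rN).
have IHE s : (s < r)%N -> MS s.+1 (E s.+1).
  by move=> sr; have [] := IH s (leq_trans sr rN).
have FD s : (s <= r)%N -> ML s.+1 ((F * D) s.+1 - F s.+1 - D s.+1).
  by move=> sr; apply: mul_coef => // q qs; [apply: IHF|apply: IHD]; exact: leq_trans sr.
have IHFD s : (s < r)%N -> MS s.+1 ((F * D) s.+1).
  move=> sr; have := MLS (FD s (ltnW sr)) => /MSD/(_ (IHD s sr))/MSD/(_ (IHF s sr)).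
  by rewrite subrK subrK.
have FDE : ML r.+1 (T r.+1 - (F * D) r.+1 - E r.+1).
  by rewrite TE; apply: mul_coef => //; rewrite fpsM0 F0 D0 mulr1.
have L : ML r.+1 (T r.+1 - F r.+1 - D r.+1 - E r.+1).
  have := MLD (FD r (leqnn r)) FDE; congr (ML _ _).
  have c1 (z : 'M[A]_n) : 1 * z = z * 1 by rewrite mul1r mulr1.
  by nc c1 c1.
have off r' i j : (T r' - F r' - D r' - E r') i j =
    T r' i j - F r' i j - D r' i j - E r' i j by rewrite !mxE.
have entE X i j s : entry X i j s = X s i j by [].
have gT i j : wspan gen (QS r.+1 (pa i (+) pa j)) (T r.+1 i j).
  rewrite -[T _ _ _]/(gen (i, j, r)) -(monomial1 gen); apply: wspan_word.
  by rewrite /QS !weight_cons !weight_nil parity_cons parity_nil /gwt /gdeg addbF /= !addn0.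
have z s i j : ((i == j)%:R : fps A) s.+1 = 0.
  by case: (i == j).
have TL i j := wspanB (gT i j) (MLS L i j).
have zE i j : (blk j <= blk i)%N -> E r.+1 i j = 0.
  by move=> b; rewrite -[LHS]/(entry E i j r.+1) Eblk.
have zF i j : (blk i <= blk j)%N -> F r.+1 i j = 0.
  by move=> b; rewrite -[LHS]/(entry F i j r.+1) Fblk.
have zD i j : blk i != blk j -> D r.+1 i j = 0.
  by move=> b; rewrite -[LHS]/(entry D i j r.+1) Dblk.
split=> // i j; have := TL i j; rewrite off.
- case: (ltnP (blk j) (blk i)) => b; last by rewrite zF // => _; exact: wspan0.
  rewrite zE ?(ltnW b) // zD ?(gtn_eqF b) // !subr0.
  by rewrite opprB addrC subrK.
- case: (eqVneq (blk i) (blk j)) => b; last by rewrite zD // => _; exact: wspan0.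
  by rewrite zE ?b // zF ?b // !subr0 opprB addrC subrK.
case: (ltnP (blk i) (blk j)) => b; last by rewrite zE // => _; exact: wspan0.
by rewrite zF ?(ltnW b) // zD ?(ltn_eqF b) // !subr0 opprB addrC subrK.
Qed.

Lemma gauss_gen_lower x :
  wspan gen (fun w => (weight (@gdeg n) w < x.2)%N) (gauss_gen x - gen x).
Proof.
case: x => [[i j] r]; have [_ _ _ /(_ i j)] := gauss_coef r.
have off r' : (T r' - F r' - D r' - E r') i j =
    T r' i j - F r' i j - D r' i j - E r' i j by rewrite !mxE.
have zE : (blk j <= blk i)%N -> E r.+1 i j = 0.
  by move=> b; rewrite -[LHS]/(entry E i j r.+1) Eblk //; case: (i == j).
have zF : (blk i <= blk j)%N -> F r.+1 i j = 0.
  by move=> b; rewrite -[LHS]/(entry F i j r.+1) Fblk //; case: (i == j).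
have zD : blk i != blk j -> D r.+1 i j = 0.
  by move=> b; rewrite -[LHS]/(entry D i j r.+1) Dblk.
rewrite off /= => /wspanN H; apply: (wspan_mono (P := QL r.+1 (pa i (+) pa j))).
  by move=> w [_].
move: H; congr (wspan _ _ _); rewrite -[gen _]/(T r.+1 i j).
case: (ltngtP (blk i) (blk j)) => b.
- by rewrite zF ?(ltnW b) // zD ?(ltn_eqF b) // !subr0 opprB.
- by rewrite zE ?(ltnW b) // zD ?(gtn_eqF b) // !subr0 opprB.
- by rewrite zE ?b // zF ?b // !subr0 opprB.
Qed.

Lemma gauss_gen_word x : wspan gen (fun w => (weight gwt w <= gwt x)%N /\
  parity godd w = godd x) (gauss_gen x).
Proof.
case: x => [[i j] r]; have [hF hD hE _] := gauss_coef r.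
have QSw X : MS r.+1 X -> wspan gen (fun w => (weight gwt w <= r.+1)%N /\
  parity godd w = pa i (+) pa j) (X i j).
  by move=> /(_ i j); apply: wspan_mono => w [].
by rewrite /=; case: ltnP => _; [exact: QSw|case: ltnP => _; exact: QSw].
Qed.

Lemma gen_gauss_word x : wspan gauss_gen (fun w => (weight gwt w <= gwt x)%N /\
  parity godd w = godd x) (gen x).
Proof.
have gw i j r : wspan gauss_gen (fun w => (weight gwt w <= r.+1)%N /\
    parity godd w = pa i (+) pa j) (gauss_gen (i, j, r)).
  rewrite -(monomial1 gauss_gen); apply: wspan_word.
  by rewrite weight_cons weight_nil parity_cons parity_nil /gwt addbF addn0.
have delta i j r : wspan gauss_gen (fun w => (weight gwt w <= r)%N /\
    parity godd w = pa i (+) pa j) (((i == j)%:R : fps A) r).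
  case: eqP => [->|_]; last exact: wspan0.
  case: r => [|r]; last exact: wspan0.
  by apply: wspan1; rewrite weight_nil parity_nil addbb.
have hF : mspan pa gauss_gen gwt godd F.
  move=> r i j; case: (ltnP (blk j) (blk i)) => b; last first.
    by rewrite -[F r i j]/(entry F i j r) Fblk.
  case: r => [|r]; first by rewrite F0 mxE; have := delta i j 0%N; case: (i == j).
  by have := gw i j r; rewrite /= b ltnNge (ltnW b).
have hE : mspan pa gauss_gen gwt godd E.
  move=> r i j; case: (ltnP (blk i) (blk j)) => b; last first.
    by rewrite -[E r i j]/(entry E i j r) Eblk.
  case: r => [|r]; first by rewrite E0 mxE; have := delta i j 0%N; case: (i == j).
  by have := gw i j r; rewrite /= b.
have hD : mspan pa gauss_gen gwt godd D.
  move=> r i j; case: (eqVneq (blk i) (blk j)) => b; last first.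
    by rewrite -[D r i j]/(entry D i j r) Dblk //; exact: wspan0.
  case: r => [|r]; first by rewrite D0 mxE; have := delta i j 0%N; case: (i == j).
  by have := gw i j r; rewrite /= b ltnn.
have hT : mspan pa gauss_gen gwt godd T.
  by rewrite TE; apply: mspanM hE; apply: mspanM.
by case: x => [[i j] r]; exact: hT.
Qed.

Lemma gen_almost_supercommutative : almost_supercommutative gen gwt godd.
Proof.
have hT r i j : wspan gen (fun w => (weight gwt w <= r)%N) (entry T i j r).
  case: r => [|r].
    rewrite entryT0; case: (i == j); last exact: wspan0.
    by apply: wspan1; rewrite weight_nil.
  rewrite -[entry T i j r.+1]/(gen (i, j, r)) -(monomial1 gen); apply: wspan_word.
  by rewrite weight_cons weight_nil addn0.
move=> [[i j] r] [[h k] s]; rewrite -[gen (i, j, r)]/(entry T i j r.+1).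
rewrite -[gen (h, k, s)]/(entry T h k s.+1) T_rel; apply: wspan_sgn.
apply: wspan_sum => l _; have := ltn_ord l; rewrite leq_min => /andP[lr ls].
have le u v (w : seq G) : (weight gwt u <= l)%N ->
   (weight gwt v <= r.+1 + s.+1 - 1 - l)%N ->
   (weight gwt u + weight gwt v < r.+1 + s.+1)%N.
  by move=> hu hv; lia.
apply: wspanB; apply: wspanM (hT _ _ _) (hT _ _ _) => u v hu hv; rewrite weight_cat.
  exact: le hu hv.
by rewrite addnC; exact: le hv hu.
Qed.

(** The Gauss generators and the t's express each other without raising the weight, so the property
    passes from the t's. *)
Theorem gauss_almost_supercommutative : almost_supercommutative gauss_gen gwt godd.
Proof.
move=> x y.
have := commute_wspan gen_almost_supercommutative (gauss_gen_word x) (gauss_gen_word y).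
apply: wspan_subst => w wxy.
apply: wspan_mono (word_subst gen_gauss_word w) => u [uw _].
exact: leq_ltn_trans wxy.
Qed.

(** Extension by zero keeps the index set [G] for each factor; [restrict_almost] later discards the
    zeros. *)
Let gE (x : G) : A := let: (i, j, r) := x in
  if (blk i < blk j)%N then E r.+1 i j else 0.
Let gF (x : G) : A := let: (i, j, r) := x in
  if (blk j < blk i)%N then F r.+1 i j else 0.
Let gD (x : G) : A := let: (i, j, r) := x in
  if blk i == blk j then D r.+1 i j else 0.

(** * Corners of T and the upper triangular part *)

Local Notation dn b := [pred q | (blk q <= b)%N].
Local Notation at_ b := [pred q | blk q == b].

Lemma proj_at_dn b : proj A (at_ b) * proj A (dn b) = proj A (at_ b).
Proof. by apply: projM => i /eqP /= ->. Qed.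
Lemma proj_dn_at b : proj A (dn b) * proj A (at_ b) = proj A (at_ b).
Proof. by apply: projMr => i /eqP /= ->. Qed.

Lemma proj_lower b X : (forall i j, (blk i < blk j)%N -> entry X i j = 0) ->
  proj A (dn b) * X * proj A (dn b) = proj A (dn b) * X.
Proof.
move=> hX; apply: entry_ext => i j; rewrite proj_entryr proj_entryl /=.
case: ifP => // /negbT; rewrite -ltnNge => bj; case: ifP => // ib.
by rewrite hX // (leq_ltn_trans ib).
Qed.
Lemma proj_upper b X : (forall i j, (blk j < blk i)%N -> entry X i j = 0) ->
  proj A (dn b) * X * proj A (dn b) = X * proj A (dn b).
Proof.
move=> hX; apply: entry_ext => i j; rewrite !proj_entryr proj_entryl /=.
case: ifP => // bj; case: ifP => // /negbT; rewrite -ltnNge => ib.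
by rewrite hX // (leq_ltn_trans bj).
Qed.

Let F_up i j : (blk i < blk j)%N -> entry F i j = 0.
Proof.
by move=> b; rewrite Fblk ?(ltnW b) //; case: eqP b => // ->; rewrite ltnn.
Qed.
Let E_low i j : (blk j < blk i)%N -> entry E i j = 0.
Proof.
by move=> b; rewrite Eblk ?(ltnW b) //; case: eqP b => // ->; rewrite ltnn.
Qed.
Let D_up i j : (blk i < blk j)%N -> entry D i j = 0.
Proof. by move=> b; rewrite Dblk // (ltn_eqF b). Qed.
Let D_low i j : (blk j < blk i)%N -> entry D i j = 0.
Proof. by move=> b; rewrite Dblk // (gtn_eqF b). Qed.

Let P b := proj A (dn b).
Let PP b : P b * P b = P b. Proof. exact: projM. Qed.

Let PF b : P b * F * P b = P b * F. Proof. exact: proj_lower F_up. Qed.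
Let PD b : P b * D * P b = P b * D. Proof. exact: proj_lower D_up. Qed.
Let PD' b : P b * D * P b = D * P b. Proof. exact: proj_upper D_low. Qed.
Let PE b : P b * E * P b = E * P b. Proof. exact: proj_upper E_low. Qed.

Let PFD b : P b * (F * D) * P b = P b * (F * D).
Proof.
by rewrite mulrA -{1}PF -[LHS]mulrA -[P b * F * _ * _]mulrA mulrA -mulrA (mulrA (P b) D) PD
  mulrA PF.
Qed.

Lemma cut_gauss b : cut (dn b) T = cut (dn b) F * cut (dn b) D * cut (dn b) E.
Proof.
rewrite TE (@cutM _ _ _ (F * D) E); last by rewrite PE PFD !mulrA.
by congr (_ * _); rewrite cutM // PD' PF -!mulrA.
Qed.

(* The rows of [quotE b] in block b are those of E; since [quotE b] is also the
   quotient of T by its corner of blocks <= b, exchange_quotient2 applies to it. *)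
Definition quotE b : R := fps_inv (cut (dn b) E) * (P b * E).
Definition invT b : R :=
  fps_inv (cut (dn b) E) * fps_inv (cut (dn b) D) * fps_inv (cut (dn b) F).

Lemma invTK b : invT b * cut (dn b) T = 1.
Proof.
have [cF cD cE] : [/\ cut (dn b) F 0%N = 1, cut (dn b) D 0%N = 1 & cut (dn b) E 0%N = 1].
  by split; exact: cut0.
rewrite cut_gauss /invT -(mulrA _ (fps_inv (cut _ F))) -[_ * _ * cut _ E]mulrA.
rewrite (mulrA (fps_inv (cut _ F))) fps_mulVl // mul1r -mulrA.
by rewrite (mulrA (fps_inv (cut _ D))) fps_mulVl // mul1r fps_mulVl.
Qed.

Lemma invTKr b : cut (dn b) T * invT b = 1.
Proof.
have -> : invT b = fps_inv (cut (dn b) T) by apply: fps_inv_unique (invTK b); exact: cut0 T0.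
by apply: fps_mulVr; exact: cut0 T0.
Qed.

(** F D is block lower triangular, so its corner is a common left factor of both sides and only the
    corner of E has to be inverted. *)
Lemma quotE_spec b : P b * T * P b * quotE b = P b * T.
Proof.
have cE : cut (dn b) E 0%N = 1 by exact: cut0.
have -> : P b * T * P b = P b * (F * D) * cut (dn b) E * P b.
  by rewrite -[RHS]mulrA cut_proj -/(P b) PE TE !mulrA.
have comm : cut (dn b) E * P b = P b * cut (dn b) E by rewrite cut_proj proj_cut.
have commV : P b * fps_inv (cut (dn b) E) = fps_inv (cut (dn b) E) * P b.
  rewrite -[LHS]mul1r -(fps_mulVl cE) mulrA -[_ * cut _ E * P b]mulrA comm.
  by rewrite mulrA -[_ * cut _ E * fps_inv _]mulrA fps_mulVr // mulr1.
rewrite /quotE -mulrA (mulrA (P b) (fps_inv _)) commV -(mulrA (P b * (F * D))).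
rewrite (mulrA (cut _ E)) (mulrA (cut _ E)) fps_mulVr // mul1r.
by rewrite (mulrA (P b) (P b)) PP mulrA PFD -mulrA -TE.
Qed.

Lemma proj_at_cutE b : proj A (at_ b) * cut (dn b) E = proj A (at_ b).
Proof.
apply: entry_ext => i j; rewrite proj_entryl proj_entry /=.
case: eqP => //= ib; rewrite /cut entryD entryB proj_entryr proj_entryl.
rewrite proj_entry entry1 /= ib leqnn /= subrr addr0.
case: ifP => [jb|jb]; first by rewrite Eblk ?ib.
by case: eqP jb => // <-; rewrite ib leqnn.
Qed.

Lemma cutF_proj_at b : cut (dn b) F * proj A (at_ b) = proj A (at_ b).
Proof.
apply: entry_ext => i j; rewrite proj_entryr proj_entry /=.
case: eqP => jb; last by rewrite andbC; case: eqP => //= ->; case: eqP.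
rewrite /cut entryD entryB proj_entryr proj_entryl.
rewrite proj_entry entry1 /= jb leqnn.
case: leqP => ib /=; last first.
  rewrite subr0 add0r; case: eqP => [ij|]; last by rewrite andbF.
  by rewrite ij jb ltnn in ib.
rewrite Fblk ?jb // subrr addr0; case: eqP => [->|]; last by rewrite andbF.
by rewrite jb eqxx.
Qed.

(** Block b is the last of the corner, where the rows of the unitriangular corner of E are those of
    the identity. *)
Lemma quotE_at b i k : blk i = b -> entry (quotE b) i k = entry E i k.
Proof.
move=> ib; have cE : cut (dn b) E 0%N = 1 by exact: cut0.
have Q : proj A (at_ b) * fps_inv (cut (dn b) E) = proj A (at_ b).
  by rewrite -{1}proj_at_cutE -mulrA fps_mulVr // mulr1.
have := congr1 (fun X => entry X i k)
  (_ : proj A (at_ b) * quotE b = proj A (at_ b) * E).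
rewrite !proj_entryl /= ib eqxx; apply.
by rewrite /quotE mulrA Q mulrA proj_at_dn.
Qed.

(** The last rows of the inverse corner of E and the last columns of that of F are those of the
    identity, so only the inverse of D is seen. *)
Lemma invT_at b i j : blk i = b -> blk j = b ->
  entry (invT b) i j = entry (fps_inv D) i j.
Proof.
move=> ib jb; set Q := proj A (at_ b).
have cE : cut (dn b) E 0%N = 1 by exact: cut0.
have cF : cut (dn b) F 0%N = 1 by exact: cut0.
have cD : cut (dn b) D 0%N = 1 by exact: cut0.
have QE : Q * fps_inv (cut (dn b) E) = Q.
  by rewrite -{1}[Q]proj_at_cutE -mulrA fps_mulVr // mulr1.
have FQ : fps_inv (cut (dn b) F) * Q = Q.
  by rewrite -{1}[Q]cutF_proj_at mulrA fps_mulVl // mul1r.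
have QD : Q * D = D * Q.
  apply: entry_ext => i' j'; rewrite proj_entryl proj_entryr /=.
  case: (eqVneq (blk i') (blk j')) => [->//|ij].
  by rewrite Dblk //; case: ifP; case: ifP.
have DQ : cut (dn b) D * Q = Q * D.
  rewrite -[Q in LHS]proj_dn_at mulrA cut_proj -/(P b) PD' -mulrA proj_dn_at.
  by rewrite QD.
have DVQ : fps_inv (cut (dn b) D) * Q = Q * fps_inv D.
  rewrite -[LHS]mulr1 -(fps_mulVr D0) mulrA -[_ * Q * D]mulrA -DQ mulrA.
  by rewrite fps_mulVl // mul1r.
have := congr1 (fun X => entry X i j) (_ : Q * invT b * Q = Q * fps_inv D * Q).
rewrite !proj_entryr !proj_entryl /= ib jb eqxx; apply.
have QDV : fps_inv D * Q = Q * fps_inv D.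
  rewrite -[LHS]mulr1 -(fps_mulVr D0) mulrA -[_ * Q * D]mulrA QD mulrA.
  by rewrite fps_mulVl // mul1r.
rewrite /invT !mulrA QE -[_ * fps_inv (cut _ F) * Q]mulrA FQ -mulrA DVQ.
by rewrite -[RHS]mulrA QDV.
Qed.

Lemma quotE_entry b i k : (blk i <= b)%N ->
  \sum_(q | dn b q) entry T i q * entry (quotE b) q k = entry T i k.
Proof.
move=> ib; have := congr1 (fun X => entry X i k) (quotE_spec b).
rewrite entryM /P proj_entryl /= ib => <-.
rewrite [RHS](bigID (dn b)) /= [X in _ + X]big1 ?addr0 => [|q /negbTE qb]; last first.
  by rewrite proj_entryr /= qb mul0r.
by apply: eq_bigr => q /= qb; rewrite proj_entryr /= qb proj_entryl /= ib.
Qed.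

(** With trivial parities [mspan] is a bound on weights alone. *)
Let pa0 : 'I_n -> bool := fun=> false.
Let odd0 : G -> bool := fun=> false.

Let mspanW (g : G -> A) X : mspan pa0 g gwt odd0 X -> forall i j r,
  wspan g (fun w => (weight gwt w <= r)%N) (entry X i j r).
Proof. by move=> hX i j r; apply: wspan_mono (hX r i j) => w []. Qed.

Let wspanG (g : G -> A) i j r : wspan g (fun w => (weight gwt w <= r.+1)%N /\
  parity odd0 w = pa0 i (+) pa0 j) (g (i, j, r)).
Proof.
rewrite -(monomial1 g); apply: wspan_word.
by rewrite weight_cons weight_nil parity_cons parity_nil /gwt addn0.
Qed.

Let wspan_delta (g : G -> A) i j r : wspan g (fun w => (weight gwt w <= r)%N /\
  parity odd0 w = pa0 i (+) pa0 j) (((i == j)%:R : fps A) r).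
Proof.
case: eqP => [->|_]; last exact: wspan0.
case: r => [|r]; last exact: wspan0.
by apply: wspan1; rewrite weight_nil parity_nil.
Qed.

Let mspanE : mspan pa0 gE gwt odd0 E.
Proof.
move=> r i j; case: (ltnP (blk i) (blk j)) => b; last first.
  by rewrite -[E r i j]/(entry E i j r) Eblk.
case: r => [|r]; first by rewrite E0 mxE; have := wspan_delta gE i j 0%N; case: (i == j).
by have := wspanG gE i j r; rewrite /= b.
Qed.

Let mspanF : mspan pa0 gF gwt odd0 F.
Proof.
move=> r i j; case: (ltnP (blk j) (blk i)) => b; last first.
  by rewrite -[F r i j]/(entry F i j r) Fblk.
case: r => [|r]; first by rewrite F0 mxE; have := wspan_delta gF i j 0%N; case: (i == j).
by have := wspanG gF i j r; rewrite /= b.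
Qed.

Let mspanD : mspan pa0 gD gwt odd0 D.
Proof.
move=> r i j; case: (eqVneq (blk i) (blk j)) => b; last first.
  by rewrite -[D r i j]/(entry D i j r) Dblk //; exact: wspan0.
case: r => [|r]; first by rewrite D0 mxE; have := wspan_delta gD i j 0%N; case: (i == j).
by have := wspanG gD i j r; rewrite /= b eqxx.
Qed.

Let Ta i j := inU (entry T i j).
Let Tb i j := inV (entry T i j).
Let ab : exchange pa (kapUV A) (thUV A) Ta Tb := yang_relation_exchange entryT0 T_rel.

Let Sa b i j := inU (entry (invT b) i j).
Let Sb b i j := inV (entry (invT b) i j).

Let SaK b : left_inverse_on (dn b) (Sa b) Ta.
Proof.
move=> i j ib jb; rewrite -inU_nat -(cut_left_inverse (invTK b) ib jb) inU_sum.
by apply: eq_bigr => q _; rewrite inUM.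
Qed.
Let SaKr b : left_inverse_on (dn b) Ta (Sa b).
Proof.
move=> i j ib jb; rewrite -inU_nat -(cut_right_inverse (invTKr b) ib jb) inU_sum.
by apply: eq_bigr => q _; rewrite inUM.
Qed.
Let SbK b : left_inverse_on (dn b) (Sb b) Tb.
Proof.
move=> i j ib jb; rewrite -[RHS](rmorph_nat (fps_cst (A := fps A))).
rewrite -(cut_left_inverse (invTK b) ib jb) rmorph_sum.
by apply: eq_bigr => q _; rewrite rmorphM.
Qed.
Let SbKr b : left_inverse_on (dn b) Tb (Sb b).
Proof.
move=> i j ib jb; rewrite -[RHS](rmorph_nat (fps_cst (A := fps A))).
rewrite -(cut_right_inverse (invTKr b) ib jb) rmorph_sum.
by apply: eq_bigr => q _; rewrite rmorphM.
Qed.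

Let almost_sym (g : G -> A) (o : G -> bool) x y :
  below g gwt (gwt x + gwt y) (g x * g y - sgn (o x && o y) (g y * g x)) ->
  below g gwt (gwt y + gwt x) (g y * g x - sgn (o y && o x) (g x * g y)).
Proof.
rewrite addnC [o y && _]andbC; move/(wspan_sgn (o x && o y))/wspanN.
by rewrite sgnB sgnK addbb opprB.
Qed.

(** Rows i and h of E are rows of [quotE (blk i)] and [quotE (blk h)]; the hypothesis nests the two
    corners as [exchange_quotient2] requires. *)
Lemma E_commutator i j h k r s : (blk i <= blk h)%N ->
  wspan gE (fun w => (weight gwt w + 1 <= r + s)%N) (E r i j * E s h k -
    sgn ((pa i (+) pa j) && (pa h (+) pa k)) (E s h k * E r i j)).
Proof.
move=> ih; have hX b : mspan pa0 gE gwt odd0 (quotE b).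
  apply: mspanM; first by apply: mspan_inv; exact: mspan_cut.
  by apply: mspanM => //; exact: mspan_proj.
have le_dn i' : dn (blk i) i' -> dn (blk h) i' by move=> /leq_trans; exact.
have H := exchange_quotient_series (e := dn (blk h)) j k ab le_dn (@SaK _) (@SbK _) _ _ _
  (fun i' j' => sfilter_inU (mspanW (hX (blk i)) i' j'))
  (fun i' j' => sfilter_inU (mspanW (hX (blk h)) i' j'))
  (fun i' j' => sfilter_inV (mspanW (hX (blk h)) i' j')) (leqnn _) (leqnn _).
have := H _ _ _ r s; rewrite !fpsB sgn_coef inU_inV inV_inU !quotE_at //; apply.
- move=> i' k' ib; rewrite /Ta -(quotE_entry k' ib) inU_sum.
  by apply: eq_bigr => q _; rewrite inUM.
- move=> i' k' ib; rewrite /Ta -(quotE_entry k' ib) inU_sum.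
  by apply: eq_bigr => q _; rewrite inUM.
- move=> i' k' ib; rewrite /Tb /inV -(quotE_entry k' ib) rmorph_sum.
  by apply: eq_bigr => q _; rewrite rmorphM.
Qed.

Let gE_almost : almost_supercommutative gE gwt godd.
Proof.
have core i j h k r s : (blk i <= blk h)%N ->
    below gE gwt (gwt (i, j, r) + gwt (h, k, s)) (gE (i, j, r) * gE (h, k, s) -
      sgn (godd (i, j, r) && godd (h, k, s)) (gE (h, k, s) * gE (i, j, r))).
  move=> ih; rewrite /=; case: ifP => _; last first.
    by rewrite mul0r mulr0 sgn0 subrr; exact: wspan0.
  case: ifP => _; last by rewrite mul0r mulr0 sgn0 subrr; exact: wspan0.
  by apply: wspan_mono (E_commutator j k r.+1 s.+1 ih) => w; rewrite addn1.
move=> [[i j] r] [[h k] s]; have [ih|hi] := leqP (blk i) (blk h); first exact: core.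
by apply: almost_sym; apply: core; exact: ltnW.
Qed.

(** * The lower triangular part *)

Definition quotF b : R := F * P b * fps_inv (cut (dn b) F).

Lemma quotF_spec b : quotF b * (P b * T * P b) = T * P b.
Proof.
have cF : cut (dn b) F 0%N = 1 by exact: cut0.
have -> : P b * T * P b = cut (dn b) F * (P b * D * E * P b).
  by rewrite !mulrA cut_proj -/(P b) PF TE !mulrA.
rewrite /quotF -mulrA (mulrA (fps_inv _)) fps_mulVl // mul1r !mulrA.
rewrite -(mulrA F (P b) (P b)) PP -[LHS]mulrA -[in LHS]PE !mulrA.
have -> : F * P b * D * P b * E * P b = F * (P b * D * P b) * E * P b by rewrite !mulrA.
rewrite PD'.
have -> : F * (D * P b) * E * P b = F * D * (P b * E * P b) by rewrite !mulrA.
by rewrite PE TE !mulrA.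
Qed.

Lemma quotF_at b k i : blk i = b -> entry (quotF b) k i = entry F k i.
Proof.
move=> ib; have cF : cut (dn b) F 0%N = 1 by exact: cut0.
have Q : fps_inv (cut (dn b) F) * proj A (at_ b) = proj A (at_ b).
  by rewrite -{1}cutF_proj_at mulrA fps_mulVl // mul1r.
have := congr1 (fun X => entry X k i)
  (_ : quotF b * proj A (at_ b) = F * proj A (at_ b)).
rewrite !proj_entryr /= ib eqxx; apply.
by rewrite /quotF -mulrA Q -mulrA proj_dn_at.
Qed.

Lemma quotF_entry b i k : (blk i <= b)%N ->
  \sum_(q | dn b q) entry (quotF b) k q * entry T q i = entry T k i.
Proof.
move=> ib; have := congr1 (fun X => entry X k i) (quotF_spec b).
rewrite entryM /P proj_entryr /= ib => <-.
rewrite [RHS](bigID (dn b)) /= [X in _ + X]big1 ?addr0 => [|q /negbTE qb]; last first.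
  by rewrite proj_entryr /= ib proj_entryl /= qb mulr0.
by apply: eq_bigr => q /= qb; rewrite proj_entryr /= ib proj_entryl /= qb.
Qed.

(* The argument for E in the converse ring, where T is replaced by its transpose. *)
Lemma F_commutator i j h k r s : (blk i <= blk h)%N ->
  wspan gF (fun w => (weight gwt w + 1 <= r + s)%N) (F s k h * F r j i -
    sgn ((pa i (+) pa j) && (pa h (+) pa k)) (F r j i * F s k h)).
Proof.
move=> ih; have hX b : mspan pa0 gF gwt odd0 (quotF b).
  apply: mspanM; last by apply: mspan_inv; exact: mspan_cut.
  by apply: mspanM => //; exact: mspan_proj.
have le_dn i' : dn (blk i) i' -> dn (blk h) i' by move=> /leq_trans; exact.
(* Transposed and read in the converse ring, a right inverse of the corner becomes a left
   inverse. *)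
have SaKc b : @left_inverse_on (fps (fps A))^c _ (dn b) (fun i j => Sa b j i) (fun i j => Ta j i).
  by move=> i' j' ib jb; rewrite eq_sym; exact: (SaKr jb ib).
have SbKc b : @left_inverse_on (fps (fps A))^c _ (dn b) (fun i j => Sb b j i) (fun i j => Tb j i).
  by move=> i' j' ib jb; rewrite eq_sym; exact: (SbKr jb ib).
have hU b i' k' : dn b i' ->
    \sum_(q | dn b q) inU (entry (quotF b) k' q) * Ta q i' = Ta k' i'.
  move=> ib; rewrite /Ta -(quotF_entry k' ib) inU_sum.
  by apply: eq_bigr => q _; rewrite inUM.
have hV b i' k' : dn b i' ->
    \sum_(q | dn b q) inV (entry (quotF b) k' q) * Tb q i' = Tb k' i'.
  move=> ib; rewrite /Tb /inV -(quotF_entry k' ib) rmorph_sum.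
  by apply: eq_bigr => q _; rewrite rmorphM.
have H := exchange_quotient_series_converse (e := dn (blk h)) j k
  (exchange_converse (@kapUV_comm A) (@thUV_comm A) ab) le_dn (@SaKc _) (@SbKc _)
  (@hU (blk i)) (@hU (blk h)) (@hV (blk h))
  (fun i' j' => sfilter_inU (mspanW (hX (blk i)) j' i'))
  (fun i' j' => sfilter_inU (mspanW (hX (blk h)) j' i'))
  (fun i' j' => sfilter_inV (mspanW (hX (blk h)) j' i')) (leqnn _) (leqnn _).
have coef f f' b : (inV f * inU f' - sgn b (inU f' * inV f)) r s =
    f s * f' r - sgn b (f' r * f s) by rewrite !fpsB sgn_coef inU_inV inV_inU.
rewrite -[F s k h]/(entry F k h s) -[F r j i]/(entry F j i r).
rewrite -(quotF_at k (erefl (blk h))) -(quotF_at j (erefl (blk i))) -coef.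
exact: (H r s).
Qed.

Let gF_almost : almost_supercommutative gF gwt godd.
Proof.
have core i j h k r s : (blk i <= blk h)%N ->
    below gF gwt (gwt (k, h, s) + gwt (j, i, r)) (gF (k, h, s) * gF (j, i, r) -
      sgn (godd (k, h, s) && godd (j, i, r)) (gF (j, i, r) * gF (k, h, s))).
  move=> ih; rewrite /=; case: ifP => _; last first.
    by rewrite mul0r mulr0 sgn0 subrr; exact: wspan0.
  case: ifP => _; last by rewrite mul0r mulr0 sgn0 subrr; exact: wspan0.
  have := F_commutator j k r.+1 s.+1 ih.
  rewrite /godd /= andbC (addbC (pa i)) (addbC (pa h)).
  by apply: wspan_mono => w; rewrite addn1 addnC.
move=> [[k h] s] [[j i] r]; have [ih|hi] := leqP (blk i) (blk h); first exact: core.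
by apply: almost_sym; apply: core; exact: ltnW.
Qed.

(** * The block diagonal part *)

(* The corner of blocks <= b of T has an inverse whose last diagonal block is that
   of D^-1, so D^-1 satisfies exchange relations; D is its inverse. *)
Let gS (x : G) : A := let: (i, j, r) := x in
  if blk i == blk j then fps_inv D r.+1 i j else 0.

Let inv_blk i j : blk i != blk j -> entry (fps_inv D) i j = 0.
Proof.
have QD b : proj A (at_ b) * D = D * proj A (at_ b).
  apply: entry_ext => i' j'; rewrite proj_entryl proj_entryr /=.
  case: (eqVneq (blk i') (blk j')) => [->//|ij].
  by rewrite Dblk //; case: ifP; case: ifP.
have QDV b : fps_inv D * proj A (at_ b) = proj A (at_ b) * fps_inv D.
  rewrite -[LHS]mulr1 -(fps_mulVr D0) mulrA -[_ * proj _ _ * D]mulrA QD mulrA.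
  by rewrite fps_mulVl // mul1r.
move=> ij; have := congr1 (fun X => entry X i j) (QDV (blk i)).
by rewrite proj_entryl proj_entryr /= eqxx eq_sym (negbTE ij).
Qed.

Let fps_inv0 : fps_inv D 0%N = 1.
Proof.
by have := congr1 (fun f : R => f 0%N) (fps_mulVl D0); rewrite fpsM0 D0 mulr1.
Qed.

Let mspanS : mspan pa0 gS gwt odd0 (fps_inv D).
Proof.
move=> r i j; case: (eqVneq (blk i) (blk j)) => b; last first.
  by rewrite -[fps_inv D r i j]/(entry (fps_inv D) i j r) inv_blk //; exact: wspan0.
case: r => [|r].
  by rewrite fps_inv0 mxE; have := wspan_delta gS i j 0%N; case: (i == j).
by have := wspanG gS i j r; rewrite /= b eqxx.
Qed.

Let S_commutator i j h k r s : blk i = blk j -> blk h = blk k -> (blk i <= blk h)%N ->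
  wspan gS (fun w => (weight gwt w + 1 <= r + s)%N)
    (fps_inv D r i j * fps_inv D s h k - fps_inv D s h k * fps_inv D r i j).
Proof.
move=> ij hk ih; pose b := blk h; pose c := blk i.
have coef f f' : (inU f * inV f' - inV f' * inU f) r s = f r * f' s - f' s * f r.
  by rewrite !fpsB inU_inV inV_inU.
rewrite -[fps_inv D r i j]/(entry (fps_inv D) i j r).
rewrite -[fps_inv D s h k]/(entry (fps_inv D) h k s).
have phk : pa h = pa k by exact: pa_blk.
have hS i' j' := mspanW mspanS i' j'.
have bh : dn b h by exact: leqnn. have bk : dn b k by rewrite /b hk /= leqnn.
rewrite -(@invT_at c i j) // -(@invT_at b h k) // -coef.
(* In one block, kap times the commutator equals th times inverse entries, of order 2, and
   cancelling kap leaves order 1. In different blocks h and k lie outside the smaller corner, and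
   the entries commute exactly. *)
move: ih; rewrite leq_eqVlt => /orP[/eqP ih|ih].
  have ib : blk i = b := ih; have jb : blk j = b by rewrite -ij.
  rewrite /c ib; apply: (sfilter_cancel (k := 1)).
  rewrite (@exchange_inverse2 _ _ pa _ _ (@kapUV_comm A) (@thUV_comm A) _ _ ab (dn b) (Sb b)
    (@SbK b) (@SbKr b) (Sa b)) //; try exact: SaK; try exact: SaKr;
    try by rewrite /= ?ib ?jb leqnn.
  have Wsgn p Z : sfilter gS gwt 2 Z -> sfilter gS gwt 2 (sgn p Z).
    by case: p => //; exact: sfilterN.
  apply: Wsgn.
  have UU i' j' : blk i' = b -> blk j' = b -> sfilter gS gwt 0 (Sa b i' j').
    by move=> *; rewrite /Sa invT_at //; exact: sfilter_inU.
  have VV i' j' : blk i' = b -> blk j' = b -> sfilter gS gwt 0 (Sb b i' j').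
    by move=> *; rewrite /Sb invT_at //; exact: sfilter_inV.
  apply: (sfilterM (sfilter_th gS gwt) (_ : sfilter _ _ 0 _)).
  apply: sfilterD; last apply: sfilterN.
    by apply: (sfilterM (k := 0) (l := 0)); [exact: UU|exact: VV].
  by apply: (sfilterM (k := 0) (l := 0)); [exact: VV|exact: UU].
have cb q : dn c q -> dn b q by move=> /leq_trans; apply; exact: ltnW.
rewrite (@inverse_commute _ _ pa _ _ (@kapUV_comm A) (@thUV_comm A) _ _ ab
    (@kapUV_reg A) (dn b) (Sb b)
    (@SbK b) (@SbKr b) (dn c) (Sa c)) //; try exact: SaK; try exact: SaKr.
- by rewrite subrr; exact: wspan0.
- exact: leqnn.
- by rewrite /c ij /= leqnn.
- by rewrite /= -ltnNge.
- by rewrite /= -hk -ltnNge.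
Qed.

Let gS_almost : almost_supercommutative gS gwt odd0.
Proof.
have core i j h k r s : (blk i <= blk h)%N ->
    below gS gwt (gwt (i, j, r) + gwt (h, k, s)) (gS (i, j, r) * gS (h, k, s) -
      sgn (odd0 (i, j, r) && odd0 (h, k, s)) (gS (h, k, s) * gS (i, j, r))).
  move=> ih; rewrite /=; case: eqP => ij; last first.
    by rewrite mul0r mulr0 subrr; exact: wspan0.
  case: eqP => hk; last by rewrite mul0r mulr0 subrr; exact: wspan0.
  by apply: wspan_mono (S_commutator r.+1 s.+1 ij hk ih) => w; rewrite addn1.
move=> [[i j] r] [[h k] s]; have [ih|hi] := leqP (blk i) (blk h); first exact: core.
by apply: almost_sym; apply: core; exact: ltnW.
Qed.

(** The entries of D and of its inverse are combinations of words in each other without gain of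
    weight. *)
Let gD_almost : almost_supercommutative gD gwt odd0.
Proof.
have gen_word (g : G -> A) (X : R) (g' : G -> A) :
    (forall i j r, g' (i, j, r) = if blk i == blk j then X r.+1 i j else 0) ->
    mspan pa0 g gwt odd0 X ->
    forall x, wspan g (fun w => (weight gwt w <= gwt x)%N /\ parity odd0 w = odd0 x) (g' x).
  by move=> gE' hX [[i j] r]; rewrite gE'; case: ifP => _; [exact: hX|exact: wspan0].
have DV : D = fps_inv (fps_inv D) by apply: fps_inv_unique; rewrite ?fps_inv0 ?fps_mulVr.
have hDS : mspan pa0 gS gwt odd0 D.
  by rewrite [X in mspan _ _ _ _ X]DV; exact: mspan_inv mspanS.
have gDS := gen_word gS D gD (fun _ _ _ => erefl) hDS.
have gSD := gen_word gD (fps_inv D) gS (fun _ _ _ => erefl) (mspan_inv mspanD).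
move=> x y; have := commute_wspan gS_almost (gDS x) (gDS y).
apply: wspan_subst => w wxy; apply: wspan_mono (word_subst gSD w) => u [uw _].
exact: leq_ltn_trans wxy.
Qed.

Hypothesis univ : universal_solution pa (entry T).
Hypothesis char0 : forall m, (m.+1%:R : K) != 0.

(** * Bases indexed by part of the generators *)

Section IndexedBasis.
Context (J : choiceType) (phi : J -> G).
Hypothesis phi_inj : injective phi.

Let gJ (j : J) : A := gauss_gen (phi j).
Let oddJ (j : J) : bool := godd (phi j).

Let psi (x : G) : option J :=
  if pselect (exists j, phi j = x) is left ex then Some (sval (cid ex)) else None.

Let phiK : pcancel phi psi.
Proof.
move=> j; rewrite /psi; case: pselect => [ex|[]]; last by exists j.
by congr Some; apply: phi_inj; exact: svalP (cid ex).
Qed.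

Let psi_inj x y a : psi x = Some a -> psi y = Some a -> x = y.
Proof.
rewrite /psi; case: pselect => // ex [<-]; case: pselect => // ey [e].
by rewrite -[LHS](svalP (cid ex)) -[RHS](svalP (cid ey)) e.
Qed.

Section Order.
Variables (le : rel J).
Hypothesis le_total : total_order le.

(* Indices outside the image of phi are placed after all the others. *)
Let leG : rel G := fun x y => match psi x, psi y with
  | Some a, Some b => le a b | Some _, None => true | None, Some _ => false
  | None, None => (choice.pickle x <= choice.pickle y)%N end.

Let leG_total : total_order leG.
Proof.
case: le_total => le_asym le_tr le_tot; split.
- move=> x y; rewrite /leG.
  case px : (psi x) => [a|]; case py : (psi y) => [b|] //; last first.
    by move=> H; apply: (pcan_inj choice.pickleK); apply: anti_leq.
  move=> /le_asym eab; rewrite eab in px; exact: psi_inj px py.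
- move=> y x z; rewrite /leG.
  case: (psi x) => [a|]; case: (psi y) => [b|]; case: (psi z) => [c|] //.
    exact: le_tr.
  exact: leq_trans.
move=> x y; rewrite /leG; case: (psi x) => [a|]; case: (psi y) => [b|] //.
exact: leq_total.
Qed.

Lemma gauss_free : lin_independent (ordered_monomials oddJ le) (monomial gJ).
Proof.
move=> s c us sB S0 j js.
pose c' u := c (pmap psi u).
have map_phiK : cancel (map phi) (pmap psi).
  by move=> w; elim: w => //= x w IH; rewrite phiK /= IH.
have := @ordered_monomials_free K A n pa (entry T) leG gauss_gen [seq map phi w | w <- s] c'
  entryT0 T_rel univ char0 gauss_gen_lower leG_total.
move=> /(_ _ _ _ (map phi j)); rewrite /c' map_phiK; apply; last exact: map_f.
- by rewrite map_inj_uniq //; exact: can_inj map_phiK.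
- move=> u /mapP[w /sB[sw ow] ->]; split.
    rewrite sorted_map; move: sw; congr (sorted _ _).
    by apply: funext => a; apply: funext => b; rewrite /relpre /leG /= !phiK.
  move=> x ox; have [/mapP[a _ xa]|xw] := boolP (x \in map phi w); last first.
    by rewrite (count_memPn xw).
  rewrite xa count_map (eq_count (a2 := pred1 a)); first by apply: ow; rewrite /oddJ -xa.
  by move=> b; rewrite /= (inj_eq phi_inj).
rewrite big_map -[RHS]S0; apply: eq_bigr => w _; rewrite map_phiK.
by congr (_ *: _); rewrite /monomial big_map.
Qed.

End Order.

Lemma gauss_pbw_basis (S : set A) : almost_supercommutative gJ (gwt \o phi) oddJ ->
  (forall y, S y <-> wspan gJ (fun=> True) y) -> pbw_basis oddJ gJ S.
Proof.
move=> comm SE le le_total; split; first exact: gauss_free.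
apply: funext => y; apply: propext; rewrite SE -lin_spanE; split.
  exact: wspan_mono.
by apply: wspan_subst => w _; exact: (ordered_words_span comm (char0 1)).
Qed.

(** A word with a letter outside the image of [phi] is zero; every other word comes from one over
    [J] of the same weight. *)
Lemma restrict_almost (g : G -> A) (o : G -> bool) :
    (forall j, g (phi j) = gJ j) -> (forall x, (forall j, phi j <> x) -> g x = 0) ->
    (forall j, o (phi j) = oddJ j) ->
    almost_supercommutative g gwt o ->
  almost_supercommutative gJ (gwt \o phi) oddJ.
Proof.
move=> gphi g0 ophi comm x y; have := comm (phi x) (phi y); rewrite !gphi !ophi.
apply: wspan_subst => w; rewrite -[(_ + _)%N]/((gwt \o phi) x + (gwt \o phi) y)%N.
move: (_ + _)%N => N wN.
have [all_im|] := boolP (all (fun x => isSome (psi x)) w).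
  have wE : w = map phi (pmap psi w).
    elim: w all_im {wN} => //= z w IH /andP[]; case pz : (psi z) => [a|] //= _ /IH <-.
    by congr (_ :: _); apply: (@psi_inj z (phi a) a); rewrite ?phiK.
  rewrite wE; have -> : monomial g (map phi (pmap psi w)) = monomial gJ (pmap psi w).
    by rewrite /monomial big_map; apply: eq_bigr => j _.
  by apply: wspan_word; move: wN; rewrite {1}wE /weight big_map.
move=> /allPn[z zw]; case pz : (psi z) => [//|] _.
have gz : g z = 0.
  by apply: g0 => j jz; move: pz; rewrite -jz phiK.
case/splitPr: zw => u v; rewrite monomial_cat monomial_cons gz mul0r mulr0.
exact: wspan0.
Qed.

End IndexedBasis.

Section TriangularBases.
Context (J : choiceType) (phi : J -> G).
Hypothesis phi_inj : injective phi.
Let gJ (j : J) : A := gauss_gen (phi j).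
Let oddJ (j : J) : bool := godd (phi j).
Variable S : set A.
Hypothesis SE : forall y, S y <-> wspan gJ (fun=> True) y.

Lemma gauss_pbw_all : (forall x, exists j, phi j = x) -> pbw_basis oddJ gJ S.
Proof.
move=> surj; apply: gauss_pbw_basis => //.
apply: (restrict_almost phi_inj (g := gauss_gen) (o := godd)) => //.
  by move=> x nx; have [j /nx] := surj x.
exact: gauss_almost_supercommutative.
Qed.

Lemma gauss_pbw_upper : (forall j, (blk (phi j).1.1 < blk (phi j).1.2)%N) ->
    (forall x, (blk x.1.1 < blk x.1.2)%N -> exists j, phi j = x) ->
  pbw_basis oddJ gJ S.
Proof.
move=> up surj; apply: gauss_pbw_basis => //.
apply: (restrict_almost phi_inj (g := gE) (o := godd)) => //.
- by move=> j; have := up j; rewrite /gE /gauss_gen; case: (phi j) => [[i k] r] /= ->.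
- move=> [[i k] r] nx; rewrite /gE; case: ifP => // ik.
  by have [j /nx] := surj (i, k, r) ik.
Qed.

Lemma gauss_pbw_lower : (forall j, (blk (phi j).1.2 < blk (phi j).1.1)%N) ->
    (forall x, (blk x.1.2 < blk x.1.1)%N -> exists j, phi j = x) ->
  pbw_basis oddJ gJ S.
Proof.
move=> lo surj; apply: gauss_pbw_basis => //.
apply: (restrict_almost phi_inj (g := gF) (o := godd)) => //.
- move=> j; have := lo j; rewrite /gF /gauss_gen; case: (phi j) => [[i k] r] /= b.
  by rewrite b ltnNge (ltnW b).
- move=> [[i k] r] nx; rewrite /gF; case: ifP => // ik.
  by have [j /nx] := surj (i, k, r) ik.
Qed.

Lemma gauss_pbw_diag : (forall j, blk (phi j).1.1 = blk (phi j).1.2) ->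
    (forall x, blk x.1.1 = blk x.1.2 -> exists j, phi j = x) ->
  pbw_basis oddJ gJ S.
Proof.
move=> di surj; apply: gauss_pbw_basis => //.
apply: (restrict_almost phi_inj (g := gD) (o := odd0)) => //.
- move=> j; have := di j; rewrite /gD /gauss_gen; case: (phi j) => [[i k] r] /= ->.
  by rewrite eqxx ltnn.
- move=> [[i k] r] nx; rewrite /gD; case: eqP => // ik.
  by have [j /nx] := surj (i, k, r) ik.
- by move=> j; rewrite /oddJ /godd (pa_blk (di j)) addbb.
Qed.

End TriangularBases.

End Gauss.

(** * The super Yangian *)

Section Subalgebra.
Context (K : fieldType) (A : algType K).

Lemma subalgebra_genE (J : Type) (g : J -> A) (X : set A) :
    (forall x, X x -> wspan g (fun=> True) x) -> (forall j, subalgebra_gen X (g j)) ->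
  forall y, subalgebra_gen X y <-> wspan g (fun=> True) y.
Proof.
move=> Xg gX y; split.
  apply; split=> [|x /Xg //]; split.
  - by rewrite inE /=; exact: wspan1.
  - move=> c u v; rewrite !inE /= => hu hv.
    by apply: wspanD => //; exact: wspanZ.
  - by move=> u v; rewrite !inE /= => hu hv; apply: wspanM hu hv.
elim=> [|c w {}y _ _ IH] U [Ualg XU].
  (* [subalg_closed] gives 1 and combinations c u + v, so 0 is obtained as (-1) 1 + 1. *)
  have [U1 Ulin _] := Ualg; have := Ulin (-1) 1 1 U1 U1.
  by rewrite scaleN1r addNr inE.
have [U1 Ulin Umul] := Ualg; rewrite -in_setE; apply: Ulin; last first.
  by rewrite in_setE; exact: IH.
elim: w => [|j w IHw]; first by rewrite monomial_nil.
by rewrite monomial_cons; apply: Umul => //; rewrite in_setE; exact: gX.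
Qed.

End Subalgebra.

Section Constant.
Context (A : pzRingType) (k : nat) (mu : 'I_k -> nat).
Local Notation R := (fps 'M[A]_(\sum_(a < k) mu a)).
Context (T F D E : R).

(** The constant terms decompose the constant series 1, which also decomposes trivially; uniqueness
    identifies the two. *)
Lemma gauss_constant : T 0%N = 1%:M -> gauss_decomposition T F D E ->
  [/\ F 0%N = 1, D 0%N = 1 & E 0%N = 1].
Proof.
move=> T0 [TE [F1 F2] D1 [E1 E2]].
pose c0 (X : R) : R := fps_cst (X 0%N).
have dec : gauss_decomposition (c0 T) (c0 F) (c0 D) (c0 E).
  split; [|split|idtac|split].
  - have TE' : T = F * D * E := TE.
    by rewrite {1}/c0 TE' !fpsM0 !rmorphM.
  - by case=> [|r] a; rewrite /c0 /= ?F1 // submxblock0.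
  - by case=> [|r] a b ab; rewrite /c0 /= ?F2 // submxblock0.
  - by case=> [|r] a b ab; rewrite /c0 /= ?D1 // submxblock0.
  - by case=> [|r] a; rewrite /c0 /= ?E1 // submxblock0.
  - by case=> [|r] a b ab; rewrite /c0 /= ?E2 // submxblock0.
have sub1 (a b : 'I_k) i j : submxblock (1%:M : 'M[A]_(\sum_(a < k) mu a)) a b i j =
    ((a == b) && (i == j :> nat))%:R.
  by rewrite !mxE -(inj_eq val_inj) tagnat.eq_Rank.
have one r (a : 'I_k) : submxblock ((1 : R) r) a a = if r == 0%N then 1%:M else 0.
  apply/matrixP => i j; rewrite fps1; case: eqP => _ /=.
    by rewrite mulr1n sub1 eqxx mxE.
  by rewrite mulr0n submxblock0.
have off r (a b : 'I_k) : a != b -> submxblock ((1 : R) r) a b = 0.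
  move=> ab; apply/matrixP => i j; rewrite fps1; case: eqP => _ /=.
    by rewrite mulr1n sub1 (negbTE ab) mxE.
  by rewrite mulr0n submxblock0.
have dec1 : gauss_decomposition (c0 T) (1 : R) (1 : R) (1 : R).
  split; [|split|idtac|split] => //.
  - by rewrite -[RHS]/((1 : R) * 1 * 1) !mulr1 /c0 T0.
  - by move=> r a b ab; apply: off; rewrite -val_eqE (ltn_eqF ab).
  - by move=> r a b ab; apply: off; rewrite -val_eqE (gtn_eqF ab).
have [eF eD eE] := gauss_decomposition_unique (T := c0 T) T0 dec1 dec.
split.
- exact: (congr1 (fun X : R => X 0%N) eF).
- exact: (congr1 (fun X : R => X 0%N) eD).
- exact: (congr1 (fun X : R => X 0%N) eE).
Qed.

End Constant.

(** * Transport along the equality of M + N with the sum of the parts *)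

Section CastT.
Context (K : fieldType) (M N n' : nat) (e : (M + N)%N = n').
Local Notation Y := (superYangian K M N).

Definition cast_T : fps 'M[Y]_n' := fun r => castmx (e, e) (yang_T K M N r).
Definition cast_odd (i : 'I_n') : bool := (M <= i)%N.

Let cast_entry (e' : (M + N)%N = (M + N)%N) i j r :
  castmx (e', e') (yang_T K M N r) i j = yang_t K i j r.
Proof. by rewrite castmx_id mxE. Qed.

Lemma cast_T_relation : yang_relation cast_odd (entry cast_T).
Proof.
rewrite /cast_T /cast_odd; case: n' / e; rewrite (_ : entry _ = fun i j => yang_t K i j).
  exact: yang_t_relation.
by apply: funext => i; apply: funext => j; apply: funext => r; rewrite /entry cast_entry.
Qed.

Lemma cast_T_universal : universal_solution cast_odd (entry cast_T).
Proof.
rewrite /cast_T /cast_odd; case: n' / e; rewrite (_ : entry _ = fun i j => yang_t K i j).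
  move=> B f t' fC t'0 t'rel; exact: yang_lift.
by apply: funext => i; apply: funext => j; apply: funext => r; rewrite /entry cast_entry.
Qed.

Lemma cast_T_span y : wspan (gen (entry cast_T)) (fun=> True) y.
Proof.
rewrite /cast_T; case: n' / e; rewrite (_ : entry _ = fun i j => yang_t K i j).
  exact: yang_span.
by apply: funext => i; apply: funext => j; apply: funext => r; rewrite /entry cast_entry.
Qed.

End CastT.

(** * Block positions and absolute positions *)

Section BlockIndices.
Context (m n : nat) (mu : 'I_(m + n) -> nat).
Local Notation I := 'I_(\sum_a mu a).
Local Notation G := (I * I * nat)%type.

Definition block (i : I) : nat := tagnat.sig1 i.

Lemma block_Rank a (i : 'I_(mu a)) : block (tagnat.Rank a i) = a.
Proof. by rewrite /block tagnat.Rank1K. Qed.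

Lemma RankP (s : I) : exists a (i : 'I_(mu a)), s = tagnat.Rank a i.
Proof. by exists (tagnat.sig1 s), (tagnat.sig2 s); rewrite tagnat.sig2K. Qed.

Lemma Rank_eq a b (i : 'I_(mu a)) (j : 'I_(mu b)) :
  (tagnat.Rank a i == tagnat.Rank b j) = (a == b) && (i == j :> nat).
Proof. by rewrite -(inj_eq val_inj) tagnat.eq_Rank. Qed.

Lemma Rank_inj a : injective (tagnat.Rank (p_ := mu) a).
Proof.
by move=> i j /eqP; rewrite Rank_eq eqxx => /eqP/val_inj.
Qed.

Lemma Rank_inj1 a b (i : 'I_(mu a)) (j : 'I_(mu b)) :
  tagnat.Rank a i = tagnat.Rank b j -> a = b.
Proof. by move=> /eqP; rewrite Rank_eq => /andP[/eqP]. Qed.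

Definition D_phi (x : D_index mu) : G :=
  let: existT a (i, j, r) := x in (tagnat.Rank a i, tagnat.Rank a j, r).
Definition E_phi (x : E_index mu) : G :=
  let: existT ab (i, j, r) := x in
  (tagnat.Rank (val ab).1 i, tagnat.Rank (val ab).2 j, r).
Definition F_phi (x : F_index mu) : G :=
  let: existT ab (i, j, r) := x in
  (tagnat.Rank (val ab).2 i, tagnat.Rank (val ab).1 j, r).
Definition DEF_phi (x : D_index mu + E_index mu + F_index mu) : G :=
  match x with inl (inl d) => D_phi d | inl (inr e) => E_phi e | inr f => F_phi f end.

Lemma D_phi_inj : injective D_phi.
Proof.
move=> [a [[i j] r]] [b [[i' j'] r']] H.
have e1 := congr1 (fun x : G => x.1.1) H; have e2 := congr1 (fun x : G => x.1.2) H.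
have /= <- := congr1 (fun x : G => x.2) H; rewrite {H} /= in e1 e2.
have ab := Rank_inj1 e1; subst b.
by rewrite (Rank_inj e1) (Rank_inj e2).
Qed.

Lemma E_phi_inj : injective E_phi.
Proof.
move=> [ab [[i j] r]] [ab' [[i' j'] r']] H.
have e1 := congr1 (fun x : G => x.1.1) H; have e2 := congr1 (fun x : G => x.1.2) H.
have /= <- := congr1 (fun x : G => x.2) H; rewrite {H} /= in e1 e2.
have abE : ab = ab'.
  apply: val_inj; move: (Rank_inj1 e1) (Rank_inj1 e2).
  by rewrite /=; case: (sval ab) (sval ab') => [? ?] [? ?] /= -> ->.
subst ab'; by rewrite (Rank_inj e1) (Rank_inj e2).
Qed.

Lemma F_phi_inj : injective F_phi.
Proof.
move=> [ab [[i j] r]] [ab' [[i' j'] r']] H.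
have e1 := congr1 (fun x : G => x.1.1) H; have e2 := congr1 (fun x : G => x.1.2) H.
have /= <- := congr1 (fun x : G => x.2) H; rewrite {H} /= in e1 e2.
have abE : ab = ab'.
  apply: val_inj; move: (Rank_inj1 e1) (Rank_inj1 e2).
  by rewrite /=; case: (sval ab) (sval ab') => [? ?] [? ?] /= -> ->.
subst ab'; by rewrite (Rank_inj e1) (Rank_inj e2).
Qed.

Lemma D_phi_block x : block (D_phi x).1.1 = block (D_phi x).1.2.
Proof. by case: x => a [[i j] r]; rewrite /= !block_Rank. Qed.
Lemma E_phi_block x : (block (E_phi x).1.1 < block (E_phi x).1.2)%N.
Proof. by case: x => ab [[i j] r]; rewrite /= !block_Rank (valP ab). Qed.
Lemma F_phi_block x : (block (F_phi x).1.2 < block (F_phi x).1.1)%N.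
Proof. by case: x => ab [[i j] r]; rewrite /= !block_Rank (valP ab). Qed.

Lemma D_phi_surj (x : G) : block x.1.1 = block x.1.2 -> exists d, D_phi d = x.
Proof.
case: x => [[s u] r] /=; have [a [i ->]] := RankP s; have [b [j ->]] := RankP u.
rewrite !block_Rank => /val_inj ab; subst b.
by exists (existT _ a (i, j, r)).
Qed.
Lemma E_phi_surj (x : G) : (block x.1.1 < block x.1.2)%N -> exists d, E_phi d = x.
Proof.
case: x => [[s u] r] /=; have [a [i ->]] := RankP s; have [b [j ->]] := RankP u.
rewrite !block_Rank => ab.
by exists (existT _ (exist (fun ab : 'I__ * 'I__ => (ab.1 < ab.2)%N) (a, b) ab) (i, j, r)).
Qed.
Lemma F_phi_surj (x : G) : (block x.1.2 < block x.1.1)%N -> exists d, F_phi d = x.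
Proof.
case: x => [[s u] r] /=; have [a [i ->]] := RankP s; have [b [j ->]] := RankP u.
rewrite !block_Rank => ab.
by exists (existT _ (exist (fun ab : 'I__ * 'I__ => (ab.1 < ab.2)%N) (b, a) ab) (i, j, r)).
Qed.

Lemma DEF_phi_inj : injective DEF_phi.
Proof.
move=> [[d|e]|f] [[d'|e']|f'] /= H.
- by rewrite (D_phi_inj H).
- by have := E_phi_block e'; rewrite -H D_phi_block ltnn.
- by have := F_phi_block f'; rewrite -H D_phi_block ltnn.
- by have := E_phi_block e; rewrite H D_phi_block ltnn.
- by rewrite (E_phi_inj H).
- by have := ltn_trans (E_phi_block e); rewrite H => /(_ _ (F_phi_block f')); rewrite ltnn.
- by have := F_phi_block f; rewrite H D_phi_block ltnn.
- by have := ltn_trans (F_phi_block f); rewrite H => /(_ _ (E_phi_block e')); rewrite ltnn.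
- by rewrite (F_phi_inj H).
Qed.

Lemma DEF_phi_surj x : exists d, DEF_phi d = x.
Proof.
case: (ltngtP (block x.1.1) (block x.1.2)) => [/E_phi_surj|/F_phi_surj|/D_phi_surj] [d <-].
- by exists (inl (inr d)).
- by exists (inr d).
- by exists (inl (inl d)).
Qed.

(** An absolute position is the total size of the preceding blocks plus the position in the block,
    and the first m blocks have total size M. *)
Lemma Rank_odd M N (hmu : composition M N mu) a (i : 'I_(mu a)) :
  (M <= tagnat.Rank a i)%N = (m <= a)%N.
Proof.
case: hmu => _ <- _; rewrite tagnat.RankEsum big_split_ord /=.
case: (leqP m a) => am.
  rewrite -addnA; apply: leq_trans (leq_addr _ _).
  by rewrite [leqRHS](eq_bigl predT) // => k; rewrite (leq_trans _ am).
apply/negbTE; rewrite -ltnNge; set a' := Ordinal am.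
have aE : lshift n a' = a by apply: val_inj.
rewrite [X in (_ + X + _)%N]big1 => [|k]; last first.
  by rewrite /= ltnNge (leq_trans (ltnW am)) ?leq_addr.
rewrite addn0 [ltnRHS](bigID (fun k : 'I_m => (k < a)%N)) /= ltn_add2l.
rewrite (bigD1 a') /= ?ltnn // aE; apply: leq_trans (leq_addr _ _).
exact: ltn_ord.
Qed.

End BlockIndices.

(** * The four bases *)

Section Conclusion.
Context (K : fieldType) (M N m n : nat) (mu : 'I_(m + n) -> nat).
Hypothesis hmu : composition M N mu.
Hypothesis char0 : forall k, (k.+1%:R : K) != 0.
Local Notation Y := (superYangian K M N).
Local Notation I := 'I_(\sum_a mu a).
Local Notation R := (fps 'M[Y]_(\sum_a mu a)).
Context (F D E : R).
Hypothesis gauss : gauss_decomposition (yang_T_mu K hmu) F D E.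

Local Notation T := (cast_T K (composition_size hmu)).
Local Notation pa := (@cast_odd M (\sum_a mu a)).
Local Notation blk := (@block m n mu).

Let TE : T = F * D * E. Proof. by case: gauss. Qed.

Let constant : [/\ F 0%N = 1, D 0%N = 1 & E 0%N = 1].
Proof. by apply: gauss_constant gauss; exact: yang_T_mu_0. Qed.
Let F0 : F 0%N = 1. Proof. by case: constant. Qed.
Let D0 : D 0%N = 1. Proof. by case: constant. Qed.
Let E0 : E 0%N = 1. Proof. by case: constant. Qed.

Let entryE (X : R) r a b (i : 'I_(mu a)) (j : 'I_(mu b)) :
  X r (tagnat.Rank a i) (tagnat.Rank b j) = submxblock (X r) a b i j.
Proof. by rewrite mxE. Qed.

Let unitri_entry (X : R) (a : 'I_(m + n)) (i j : 'I_(mu a)) :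
    (forall r a, submxblock (X r) a a = if r == 0%N then 1%:M else 0) ->
  entry X (tagnat.Rank a i) (tagnat.Rank a j) =
  (tagnat.Rank a i == tagnat.Rank a j)%:R.
Proof.
move=> X1; apply: funext => r; rewrite /entry entryE X1 Rank_eq eqxx /=.
case: r => [|r]; rewrite /= mxE -?val_eqE /=.
by case: (_ == _ :> nat).
by case: (_ == _ :> nat).
Qed.

Let Fblk i j : (blk i <= blk j)%N -> entry F i j = (i == j)%:R.
Proof.
have [_ [F1 F2] _ _] := gauss.
have [a [i' ->]] := RankP i; have [b [j' ->]] := RankP j; rewrite !block_Rank.
rewrite leq_eqVlt => /orP[/eqP/val_inj ab|ab]; first by subst b; exact: unitri_entry.
apply: funext => r; rewrite /entry entryE F2 // mxE Rank_eq -val_eqE /= (ltn_eqF ab).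
by [].
Qed.

Let Eblk i j : (blk j <= blk i)%N -> entry E i j = (i == j)%:R.
Proof.
have [_ _ _ [E1 E2]] := gauss.
have [a [i' ->]] := RankP i; have [b [j' ->]] := RankP j; rewrite !block_Rank.
rewrite leq_eqVlt => /orP[/eqP/val_inj ab|ab]; first by subst b; exact: unitri_entry.
apply: funext => r; rewrite /entry entryE E2 // mxE Rank_eq -val_eqE /= (gtn_eqF ab).
by [].
Qed.

Let Dblk i j : blk i != blk j -> entry D i j = 0.
Proof.
have [_ _ D1 _] := gauss.
have [a [i' ->]] := RankP i; have [b [j' ->]] := RankP j; rewrite !block_Rank => ab.
by apply: funext => r; rewrite /entry entryE D1 // mxE.
Qed.

Let pa_block i j : blk i = blk j -> pa i = pa j.
Proof.
have [a [i' ->]] := RankP i; have [b [j' ->]] := RankP j; rewrite !block_Rank => ab.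
by rewrite /cast_odd !(Rank_odd hmu) ab.
Qed.

Let T_rel : yang_relation pa (entry T). Proof. exact: cast_T_relation. Qed.
Let univ : universal_solution pa (entry T). Proof. exact: cast_T_universal. Qed.

Local Notation g := (gauss_gen blk F D E).

Let D_eltE : D_elt D = fun d => g (D_phi d).
Proof.
by apply: funext => -[a [[i j] r]] /=; rewrite !block_Rank !ltnn entryE.
Qed.

Let E_eltE : E_elt E = fun e => g (E_phi e).
Proof.
by apply: funext => -[ab [[i j] r]] /=; rewrite !block_Rank (valP ab) entryE.
Qed.

Let F_eltE : F_elt F = fun f => g (F_phi f).
Proof.
apply: funext => -[ab [[i j] r]] /=; rewrite !block_Rank (valP ab) entryE.
by rewrite ltnNge (ltnW (valP ab)).
Qed.

Let DEF_eltE : DEF_elt F D E = fun x => g (DEF_phi x).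
Proof.
by apply: funext => -[[d|e]|f]; rewrite /DEF_elt ?D_eltE ?E_eltE ?F_eltE.
Qed.

Let odd_block a b : (a < b)%N -> (m <= a)%N (+) (m <= b)%N = (a < m <= b)%N.
Proof.
by move=> ab; case: (leqP m a) => //= ma; rewrite (leq_trans ma (ltnW ab)).
Qed.

Let D_oddE : @D_odd m n mu = fun d => godd pa (D_phi d).
Proof.
apply: funext => -[a [[i j] r]]; rewrite /godd /= /cast_odd !(Rank_odd hmu).
by rewrite addbb.
Qed.

Let E_oddE : @E_odd m n mu = fun e => godd pa (E_phi e).
Proof.
apply: funext => -[ab [[i j] r]]; rewrite /godd /= /cast_odd !(Rank_odd hmu).
by rewrite odd_block //; exact: (valP ab).
Qed.

Let F_oddE : @F_odd m n mu = fun f => godd pa (F_phi f).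
Proof.
apply: funext => -[ab [[i j] r]]; rewrite /godd /= /cast_odd !(Rank_odd hmu).
by rewrite addbC odd_block //; exact: (valP ab).
Qed.

Let DEF_oddE : @DEF_odd m n mu = fun x => godd pa (DEF_phi x).
Proof.
by apply: funext => -[[d|e]|f]; rewrite /DEF_odd ?D_oddE ?E_oddE ?F_oddE.
Qed.

Let elt_span (J : Type) (h : J -> Y) j : wspan h (fun=> True) (h j).
Proof. by rewrite -(monomial1 h); exact: wspan_word. Qed.

Let word_span (J J' : Type) (h : J -> Y) (h' : J' -> Y) w :
    (forall x, wspan h (fun=> True) (h' x)) ->
  wspan h (fun=> True) (monomial h' w).
Proof.
move=> hh'; elim: w => [|x w IH]; first by rewrite monomial_nil; exact: wspan1.
by rewrite monomial_cons; apply: wspanM (hh' x) IH.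
Qed.

Let gen_elt (G : set Y) y : G y -> subalgebra_gen G y.
Proof. by move=> Gy U [_]; apply. Qed.

Lemma pbw_D : pbw_basis (@D_odd m n mu) (D_elt D) (Y0 D).
Proof.
rewrite D_oddE {1}D_eltE.
apply: (gauss_pbw_diag TE F0 D0 E0 Fblk Dblk Eblk pa_block T_rel univ char0).
- exact: D_phi_inj.
- rewrite -D_eltE; apply: subalgebra_genE => [_ [a [i [j [[|r] ->]]]]|[a [[i j] r]]].
  (* The generators of [Y0] include the coefficients with r = 0, which are 0 or 1 and lie in the
     span of words anyway. *)
  + rewrite D0 -(entryE (1 : R) 0) [(1 : R) _]/(1%:M) mxE.
    by case: (_ == _); [exact: wspan1|exact: wspan0].
  + exact: (elt_span (D_elt D) (existT _ a (i, j, r))).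
  + by apply: gen_elt; exists a, i, j, r.+1.
- exact: D_phi_block.
- exact: D_phi_surj.
Qed.

Lemma pbw_E : pbw_basis (@E_odd m n mu) (E_elt E) (Yplus E).
Proof.
rewrite E_oddE {1}E_eltE.
apply: (gauss_pbw_upper TE F0 D0 E0 Fblk Dblk Eblk T_rel univ char0).
- exact: E_phi_inj.
- rewrite -E_eltE.
  apply: subalgebra_genE => [_ [a [b [i [j [[|r] [ab // _ ->]]]]]]|[ab [[i j] r]]].
  + pose p := exist (fun p : 'I__ * 'I__ => (p.1 < p.2)%N) (a, b) ab.
    exact: (elt_span (E_elt E) (existT _ p (i, j, r))).
  + apply: gen_elt; exists (val ab).1, (val ab).2, i, j, r.+1.
    by split=> //; exact: (valP ab).
- exact: E_phi_block.
- exact: E_phi_surj.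
Qed.

Lemma pbw_F : pbw_basis (@F_odd m n mu) (F_elt F) (Yminus F).
Proof.
rewrite F_oddE {1}F_eltE.
apply: (gauss_pbw_lower TE F0 D0 E0 Fblk Dblk Eblk T_rel univ char0).
- exact: F_phi_inj.
- rewrite -F_eltE.
  apply: subalgebra_genE => [_ [a [b [i [j [[|r] [ab // _ ->]]]]]]|[ab [[i j] r]]].
  + pose p := exist (fun p : 'I__ * 'I__ => (p.1 < p.2)%N) (a, b) ab.
    exact: (elt_span (F_elt F) (existT _ p (i, j, r))).
  + apply: gen_elt; exists (val ab).1, (val ab).2, i, j, r.+1.
    by split=> //; exact: (valP ab).
- exact: F_phi_block.
- exact: F_phi_surj.
Qed.

Lemma pbw_DEF : pbw_basis (@DEF_odd m n mu) (DEF_elt F D E) [set: Y].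
Proof.
rewrite DEF_oddE DEF_eltE.
apply: (gauss_pbw_all TE F0 D0 E0 Fblk Dblk Eblk T_rel univ char0).
- exact: DEF_phi_inj.
- move=> y; split=> // _; apply: wspan_subst (cast_T_span (composition_size hmu) y) => w _.
  apply: word_span => x.
  apply: wspan_subst (gen_gauss_word pa TE F0 D0 E0 Fblk Dblk Eblk x) => v _.
  apply: word_span => z; have [d <-] := DEF_phi_surj z; exact: elt_span.
- exact: DEF_phi_surj.
Qed.

End Conclusion.

Local Open Scope classical_set_scope.

Theorem corollary8p5 (R : realType) (M N m n : nat) (hMN : (0 < M + N)%N)
    (mu : 'I_(m + n) -> nat) (hmu : composition M N mu)
    (F D E : nat -> 'M[superYangian R[i] M N]_(\sum_a mu a))
    (hT : gauss_decomposition (yang_T_mu R[i] hmu) F D E) :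
  [/\ pbw_basis (@D_odd m n mu) (D_elt D) (Y0 D),
      pbw_basis (@E_odd m n mu) (E_elt E) (Yplus E),
      pbw_basis (@F_odd m n mu) (F_elt F) (Yminus F) &
      pbw_basis (@DEF_odd m n mu) (DEF_elt F D E) [set: superYangian R[i] M N]].
Proof.
have char0 k : (k.+1%:R : R[i]) != 0 by rewrite Num.Theory.pnatr_eq0.
split.
- exact: (@pbw_D _ M N m n mu hmu char0 F D E hT).
- exact: (@pbw_E _ M N m n mu hmu char0 F D E hT).
- exact: (@pbw_F _ M N m n mu hmu char0 F D E hT).
- exact: (@pbw_DEF _ M N m n mu hmu char0 F D E hT).
Qed.
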